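(* Each of the three types of minimal sets in the classification is realized: there exist $f_1,f_2,f_3\in\mathrm{Homeo}_*(\mathbb{T}^2)$ with minimal sets $\mathcal{M}_1,\mathcal{M}_2,\mathcal{M}_3\ne\mathbb{T}^2$ such that (I) every connected component of $\mathbb{T}^2\setminus\mathcal{M}_1$ is a disk; (II) every connected component of $\mathbb{T}^2\setminus\mathcal{M}_2$ is a disk or an essential annulus, and essential annuli occur; (III) $\mathcal{M}_3$ is an extension of a Cantor set.
   Context: $\mathbb{T}^2=\mathbb{R}^2/\mathbb{Z}^2$ with projection $p$. $\mathrm{Homeo}_*(\mathbb{T}^2)$ is the set of homeomorphisms of $\mathbb{T}^2$ isotopic to the identity whose rotation set (the set of limit points mod $\mathbb{Z}^2$ of $(F^{n_k}(\tilde z)-\tilde z)/n_k$, $n_k\to\infty$, $\tilde z\in\mathbb{R}^2$, for a lift $F$) is a single point $(\alpha,\beta)\bmod\mathbb{Z}^2$ with $1,\alpha,\beta$ rationally independent. A minimal set is a nonempty closed invariant set with no proper nonempty closed invariant subset. A disk is the image of the open unit disk under a topological embedding into $\mathbb{T}^2$; an essential annulus is an embedded image of $S^1\times(0,1)$ whose inclusion induces an injection on $\pi_1$. A set is bounded if a connected component of its preimage under $p$ is bounded. For a bounded continuum $\mathcal{C}$, $\mathrm{Fill}(\mathcal{C})$ is the smallest bounded continuum with connected complement containing it (such continua are called acyclic). A minimal set $\mathcal{M}$ with components $\{\Lambda_i\}$ is an extension of a Cantor set if each $\mathrm{Fill}(\Lambda_i)$ is acyclic, these fills are pairwise disjoint,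 and there exist a continuous $\phi:\mathbb{T}^2\to\mathbb{T}^2$ homotopic to the identity and $\hat f\in\mathrm{Homeo}_*(\mathbb{T}^2)$ with $\phi\circ f=\hat f\circ\phi$ such that $\phi(\bigcup_i\mathrm{Fill}(\Lambda_i))$ is a Cantor minimal set of $\hat f$. *)

(* Defs.v *)
From Stdlib Require Import Reals ZArith.
Open Scope R_scope.

(* Model of the torus T^2 = R^2 / Z^2.                                 *)
(* A point of T^2 is represented by any of its lifts in R^2; two       *)
(* representatives denote the same torus point iff they differ by an   *)
(* element of Z^2 (teq).  The projection p : R^2 -> T^2 is the identity *)
(* on representatives.  T^2 carries the flat quotient metric dT, a     *)
(* pseudometric on R^2 with dT x y = 0 <-> teq x y, so that dT-open /  *)
(* closed sets are exactly (lifts of) open / closed sets of T^2.       *)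

Definition Point : Type := (R * R)%type.

Definition teq (x y : Point) : Prop :=
  exists m n : Z, fst x - fst y = IZR m /\ snd x - snd y = IZR n.

Definition cdist (a : R) : R := Rmin (frac_part a) (1 - frac_part a).

Definition dT (x y : Point) : R :=
  sqrt (Rsqr (cdist (fst x - fst y)) + Rsqr (cdist (snd x - snd y))).

Definition dE (x y : Point) : R :=
  sqrt (Rsqr (fst x - fst y) + Rsqr (snd x - snd y)).

Section Topo.
Variable d : Point -> Point -> R.

Definition open_in (U : Point -> Prop) : Prop :=
  forall x, U x -> exists e, 0 < e /\ forall y, d x y < e -> U y.

Definition closed_in (C : Point -> Prop) : Prop :=
  forall x, (forall e, 0 < e -> exists y, C y /\ d x y < e) -> C x.

Definition connected_in (S : Point -> Prop) : Prop :=
  ~ exists U V : Point -> Prop,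
      open_in U /\ open_in V /\
      (forall x, S x -> U x \/ V x) /\
      (exists x, S x /\ U x) /\ (exists x, S x /\ V x) /\
      (forall x, S x -> U x -> V x -> False).

Definition component_of (A C : Point -> Prop) : Prop :=
  (exists x, C x) /\ (forall x, C x -> A x) /\ connected_in C /\
  (forall D : Point -> Prop, (forall x, D x -> A x) -> connected_in D ->
     (exists x, D x /\ C x) -> forall x, D x -> C x).
End Topo.

Definition cont_map (d1 d2 : Point -> Point -> R) (f : Point -> Point) : Prop :=
  forall x eps, 0 < eps -> exists delta, 0 < delta /\
    forall y, d1 x y < delta -> d2 (f x) (f y) < eps.

Definition compl (A : Point -> Prop) : Point -> Prop := fun x => ~ A x.

Definition is_homeo (f : Point -> Point) : Prop :=
  cont_map dT dT f /\
  exists g, cont_map dT dT g /\ (forall x, teq (g (f x)) x) /\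
            (forall x, teq (f (g x)) x).

Definition in01 (t : R) : Prop := 0 <= t <= 1.

Definition cont_homotopy (H : R -> Point -> Point) : Prop :=
  forall t x eps, in01 t -> 0 < eps -> exists delta, 0 < delta /\
    forall t' y, in01 t' -> Rabs (t - t') < delta -> dT x y < delta ->
      dT (H t x) (H t' y) < eps.

Definition homotopic_id (phi : Point -> Point) : Prop :=
  exists H : R -> Point -> Point, cont_homotopy H /\
    (forall x, teq (H 0 x) x) /\ (forall x, teq (H 1 x) (phi x)).

Definition isotopic_id (f : Point -> Point) : Prop :=
  exists H : R -> Point -> Point, cont_homotopy H /\
    (forall t, in01 t -> is_homeo (H t)) /\
    (forall x, teq (H 0 x) x) /\ (forall x, teq (H 1 x) (f x)).

Definition is_lift (f F : Point -> Point) : Prop :=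
  cont_map dE dE F /\ forall x, teq (F x) (f x).

Definition rot_limit (F : Point -> Point) (v : Point) : Prop :=
  exists (z : Point) (n : nat -> nat),
    (forall k, (n k < n (S k))%nat) /\
    Un_cv (fun k => (fst (Nat.iter (n k) F z) - fst z) / INR (n k)) (fst v) /\
    Un_cv (fun k => (snd (Nat.iter (n k) F z) - snd z) / INR (n k)) (snd v).

Definition rat_indep (a b : R) : Prop :=
  forall p q r : Z, IZR p + IZR q * a + IZR r * b = 0 ->
    p = 0%Z /\ q = 0%Z /\ r = 0%Z.

Definition Homeo_star (f : Point -> Point) : Prop :=
  is_homeo f /\ isotopic_id f /\
  exists F, is_lift f F /\
    exists a b : R, rat_indep a b /\
      (exists v, rot_limit F v) /\
      (forall v, rot_limit F v -> teq v (a, b)).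

Definition invariant (f : Point -> Point) (M : Point -> Prop) : Prop :=
  (forall x, M x -> M (f x)) /\
  (forall y, M y -> exists x, M x /\ teq (f x) y).

Definition minimal_set (f : Point -> Point) (M : Point -> Prop) : Prop :=
  (exists x, M x) /\ closed_in dT M /\ invariant f M /\
  (forall N, (forall x, N x -> M x) -> (exists x, N x) -> closed_in dT N ->
     invariant f N -> forall x, M x -> N x).

Definition embedding (U : Point -> Prop) (e : Point -> Point) : Prop :=
  (forall u, U u -> forall eps, 0 < eps -> exists delta, 0 < delta /\
     forall v, U v -> dE u v < delta -> dT (e u) (e v) < eps) /\
  (forall u v, U u -> U v -> teq (e u) (e v) -> u = v) /\
  (forall u, U u -> forall eps, 0 < eps -> exists delta, 0 < delta /\
     forall v, U v -> dT (e u) (e v) < delta -> dE u v < eps).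

Definition image (U : Point -> Prop) (e : Point -> Point) : Point -> Prop :=
  fun x => exists u, U u /\ teq (e u) x.

Definition origin : Point := (0, 0).

Definition unit_disk : Point -> Prop := fun u => dE origin u < 1.
Definition std_annulus : Point -> Prop := fun u => 1 < dE origin u < 2.

Definition is_disk (C : Point -> Prop) : Prop :=
  exists e, embedding unit_disk e /\ forall x, C x <-> image unit_disk e x.

Definition loop_in (S : Point -> Prop) (g : R -> Point) : Prop :=
  (forall t, in01 t -> S (g t)) /\ teq (g 0) (g 1) /\
  (forall t eps, in01 t -> 0 < eps -> exists delta, 0 < delta /\
     forall s, in01 s -> Rabs (t - s) < delta -> dT (g t) (g s) < eps).

Definition nullhomotopic_in (S : Point -> Prop) (g : R -> Point) : Prop :=
  exists H : R -> R -> Point,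
    (forall s t, in01 s -> in01 t -> S (H s t)) /\
    (forall s t eps, in01 s -> in01 t -> 0 < eps -> exists delta, 0 < delta /\
       forall s' t', in01 s' -> in01 t' -> Rabs (s - s') < delta ->
         Rabs (t - t') < delta -> dT (H s t) (H s' t') < eps) /\
    (forall t, in01 t -> teq (H 0 t) (g t)) /\
    (forall t, in01 t -> teq (H 1 t) (g 0)) /\
    (forall s, in01 s -> teq (H s 0) (g 0) /\ teq (H s 1) (g 0)).

Definition pi1_injective (S : Point -> Prop) : Prop :=
  forall g, loop_in S g -> nullhomotopic_in (fun _ => True) g ->
    nullhomotopic_in S g.

Definition is_essential_annulus (C : Point -> Prop) : Prop :=
  (exists e, embedding std_annulus e /\
     forall x, C x <-> image std_annulus e x) /\
  pi1_injective C.

(* bounded: some connected component of the preimage is bounded *)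
Definition bounded_E (S : Point -> Prop) : Prop :=
  exists r, forall x, S x -> dE origin x <= r.

Definition bounded_T (C : Point -> Prop) : Prop :=
  exists D, component_of dE C D /\ bounded_E D.

(* T^2 is compact, so compact subsets = closed subsets *)
Definition continuum (K : Point -> Prop) : Prop :=
  (exists x, K x) /\ closed_in dT K /\ connected_in dT K.

Definition acyclic (K : Point -> Prop) : Prop :=
  continuum K /\ bounded_T K /\ connected_in dT (compl K).

Definition is_fill (C K : Point -> Prop) : Prop :=
  acyclic K /\ (forall x, C x -> K x) /\
  (forall K', acyclic K' -> (forall x, C x -> K' x) -> forall x, K x -> K' x).

Definition cantor_set (K : Point -> Prop) : Prop :=
  (exists x, K x) /\ closed_in dT K /\
  (forall x, K x -> forall eps, 0 < eps ->
     exists y, K y /\ ~ teq x y /\ dT x y < eps) /\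
  (forall S, (forall x, S x -> K x) -> connected_in dT S ->
     forall x y, S x -> S y -> teq x y).

Definition extension_of_cantor (f : Point -> Point) (M : Point -> Prop) : Prop :=
  exists Fill : (Point -> Prop) -> (Point -> Prop),
    (forall L, component_of dT M L -> is_fill L (Fill L)) /\
    (forall L L', component_of dT M L -> component_of dT M L' ->
       ~ (forall x, L x <-> L' x) ->
       forall x, Fill L x -> Fill L' x -> False) /\
    exists (phi fh : Point -> Point),
      cont_map dT dT phi /\ homotopic_id phi /\ Homeo_star fh /\
      (forall x, teq (phi (f x)) (fh (phi x))) /\
      let K := fun y => exists x L, component_of dT M L /\ Fill L x /\
                                    teq (phi x) y in
      minimal_set fh K /\ cantor_set K.

(* Main.v *)
(* A Denjoy homeomorphism is obtained from an irrational rotation by blowing up the orbit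
   of 0 to a family of gaps; what remains on the circle is a Cantor minimal set. Three
   maps of the torus are built from it. The product of two Denjoy maps has a Cantor
   minimal set (III). The product of a Denjoy map with a rotation has a Cantor set of
   circles as minimal set, with annuli, one for each gap, as complementary components
   (II). For the suspension flow of a Denjoy map, the gaps sweep out a single
   injectively immersed strip, which is an open disk, and the time-b map is minimal on the
   complement of the strip (I). Minimality has one reason in all three cases:
   the map is semiconjugate to a totally irrational translation, and every point of M is
   approximated by full preimages of open sets under the semiconjugacy, so that Kronecker
   density lifts to M. *)

From Stdlib Require Import Reals ZArith Lra Lia Psatz Classical ClassicalEpsilon.
From Stdlib Require Import FunctionalExtensionality PropExtensionality List Cantor.
From Coquelicot Require Import Coquelicot.
Require Import Defs.
Open Scope R_scope.

(** Gap lengths never have to be compared: the Denjoy map is continuous because it is an increasing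
    bijection of the line. Mapping gaps to gaps affinely makes its powers an exact action [shift] of
    Z, and [interp] interpolates linearly between consecutive powers. This one family is used twice:
    for parameters from 0 to 1 it is the isotopy from the identity, and over all heights it traces
    the leaves of the suspension. All maps are kept as lifts to the plane that commute with Z^2, so
    the rotation vector follows from bounded distance to a translation. The obstacle to minimality
    is an endpoint of a gap: the preimage of any neighborhood of its image contains the whole gap.
    The remedy is to center the open set in the base at a point that need not be the image. In (I)
    the suspended rotation number is [a / b], which makes (a, b) the rotation vector of the time-b
    map. In (II) every complementary component is an annulus. In (III) the components of M are
    points, so nothing has to be filled or collapsed. *)

(** * Distances on the torus *)

Lemma Int_part_bounds (a : R) : IZR (Int_part a) <= a < IZR (Int_part a) + 1.
Proof. destruct (base_Int_part a); lra. Qed.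

Lemma Int_part_eq (a : R) (n : Z) : IZR n <= a < IZR n + 1 -> Int_part a = n.
Proof.
  intros H; destruct (Int_part_bounds a) as [H1 H2].
  assert (IZR n < IZR (Int_part a + 1)) by (rewrite plus_IZR; lra).
  assert (IZR (Int_part a) < IZR (n + 1)) by (rewrite plus_IZR; lra).
  apply lt_IZR in H0, H3; lia.
Qed.

Lemma cdist_le (a : R) (m : Z) : cdist a <= Rabs (a - IZR m).
Proof.
  unfold cdist, frac_part.
  destruct (Int_part_bounds a) as [H1 H2].
  destruct (Z_le_gt_dec m (Int_part a)) as [H|H].
  - apply IZR_le in H. apply Rle_trans with (1 := Rmin_l _ _).
    rewrite Rabs_pos_eq; lra.
  - assert (H0 : (Int_part a + 1 <= m)%Z) by lia.
    apply IZR_le in H0; rewrite plus_IZR in H0.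
    apply Rle_trans with (1 := Rmin_r _ _).
    rewrite Rabs_left1; lra.
Qed.

Lemma cdist_attained (a : R) : exists m : Z, Rabs (a - IZR m) = cdist a.
Proof.
  unfold cdist, frac_part.
  destruct (Int_part_bounds a) as [H1 H2].
  destruct (Rle_dec (a - IZR (Int_part a)) (1 - (a - IZR (Int_part a)))) as [H|H].
  - exists (Int_part a). rewrite Rmin_left, Rabs_pos_eq; lra.
  - exists (Int_part a + 1)%Z. rewrite plus_IZR, Rmin_right, Rabs_left1; lra.
Qed.

Lemma cdist_pos (a : R) : 0 <= cdist a.
Proof. destruct (cdist_attained a) as [m <-]; apply Rabs_pos. Qed.

Lemma norm_box (a b : R) :
  Rabs a <= sqrt (Rsqr a + Rsqr b) /\ Rabs b <= sqrt (Rsqr a + Rsqr b) /\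
  sqrt (Rsqr a + Rsqr b) <= Rabs a + Rabs b.
Proof.
  pose proof (Rle_0_sqr a); pose proof (Rle_0_sqr b).
  rewrite <- (sqrt_Rsqr_abs a), <- (sqrt_Rsqr_abs b).
  repeat split; try (apply sqrt_le_1; lra).
  pose proof (sqrt_pos (Rsqr a)); pose proof (sqrt_pos (Rsqr b)).
  apply Rsqr_incr_0; try lra.
  - rewrite Rsqr_sqrt, Rsqr_plus, !Rsqr_sqrt by lra. nra.
  - apply sqrt_pos.
Qed.

(** Replaces [dT] in the arguments: the integers are explicit witnesses, so fractional parts and
    square roots disappear. The two notions agree up to a factor 2 in the radius. *)
Definition tnear (e : R) (x y : Point) : Prop :=
  exists m n : Z, Rabs (fst x - fst y - IZR m) < e /\
                  Rabs (snd x - snd y - IZR n) < e.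

Lemma dT_tnear (e : R) (x y : Point) : dT x y < e -> tnear e x y.
Proof.
  unfold dT; intros H.
  destruct (cdist_attained (fst x - fst y)) as [m Hm].
  destruct (cdist_attained (snd x - snd y)) as [n Hn].
  destruct (norm_box (cdist (fst x - fst y)) (cdist (snd x - snd y))) as [H1 [H2 _]].
  rewrite Rabs_pos_eq in H1, H2 by apply cdist_pos.
  exists m, n; rewrite Hm, Hn; lra.
Qed.

Lemma tnear_dT (e : R) (x y : Point) : tnear (e / 2) x y -> dT x y < e.
Proof.
  unfold dT; intros [m [n [H1 H2]]].
  pose proof (cdist_le (fst x - fst y) m).
  pose proof (cdist_le (snd x - snd y) n).
  destruct (norm_box (cdist (fst x - fst y)) (cdist (snd x - snd y))) as [_ [_ H3]].
  rewrite !Rabs_pos_eq in H3 by apply cdist_pos. lra.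
Qed.

Lemma dE_box (e : R) (x y : Point) :
  dE x y < e -> Rabs (fst x - fst y) < e /\ Rabs (snd x - snd y) < e.
Proof.
  unfold dE; intros H.
  destruct (norm_box (fst x - fst y) (snd x - snd y)) as [H1 [H2 _]]; lra.
Qed.

Lemma box_dE (e : R) (x y : Point) :
  Rabs (fst x - fst y) < e / 2 -> Rabs (snd x - snd y) < e / 2 -> dE x y < e.
Proof.
  unfold dE; intros.
  destruct (norm_box (fst x - fst y) (snd x - snd y)) as [_ [_ H1]]; lra.
Qed.

Lemma teq_refl (x : Point) : teq x x.
Proof. exists 0%Z, 0%Z; lra. Qed.

Lemma teq_sym (x y : Point) : teq x y -> teq y x.
Proof. intros [m [n H]]; exists (- m)%Z, (- n)%Z; rewrite !opp_IZR; lra. Qed.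

Lemma teq_trans (x y z : Point) : teq x y -> teq y z -> teq x z.
Proof.
  intros [m [n H]] [m' [n' H']]; exists (m + m')%Z, (n + n')%Z.
  rewrite !plus_IZR; lra.
Qed.

Lemma tnear_sym (e : R) (x y : Point) : tnear e x y -> tnear e y x.
Proof.
  intros [m [n [H1 H2]]]; exists (- m)%Z, (- n)%Z; rewrite !opp_IZR.
  split; rewrite <- Rabs_Ropp; match goal with |- Rabs ?a < _ =>
    match type of H1 with Rabs ?b < _ => replace a with b by ring; assumption end
    || match type of H2 with Rabs ?b < _ => replace a with b by ring; assumption end end.
Qed.

Lemma teq_tnear (e : R) (x y : Point) : 0 < e -> teq x y -> tnear e x y.
Proof.
  intros He [m [n [H1 H2]]]; exists m, n.
  rewrite H1, H2, !Rminus_diag, Rabs_R0; lra.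
Qed.

Lemma tnear_teq_r (e : R) (x y z : Point) : tnear e x y -> teq y z -> tnear e x z.
Proof.
  intros [m [n [H1 H2]]] [k [l [H3 H4]]]; exists (m + k)%Z, (n + l)%Z.
  rewrite !plus_IZR.
  replace (fst x - fst z - (IZR m + IZR k)) with (fst x - fst y - IZR m) by lra.
  replace (snd x - snd z - (IZR n + IZR l)) with (snd x - snd y - IZR n) by lra.
  auto.
Qed.

Lemma tnear_teq_l (e : R) (x y z : Point) : tnear e x y -> teq x z -> tnear e z y.
Proof. intros H1 H2; apply tnear_sym; eapply tnear_teq_r; eauto using tnear_sym. Qed.

Lemma tnear_translate (e : R) (x y : Point) :
  tnear e x y -> exists z, teq y z /\
    Rabs (fst x - fst z) < e /\ Rabs (snd x - snd z) < e.
Proof.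
  intros [m [n [H1 H2]]]; exists (fst y + IZR m, snd y + IZR n); split.
  - exists (- m)%Z, (- n)%Z; rewrite !opp_IZR; simpl; lra.
  - simpl; split; [replace (fst x - (fst y + IZR m)) with (fst x - fst y - IZR m) by ring
    | replace (snd x - (snd y + IZR n)) with (snd x - snd y - IZR n) by ring]; auto.
Qed.

Lemma box_tnear (e : R) (x y : Point) :
  Rabs (fst x - fst y) < e -> Rabs (snd x - snd y) < e -> tnear e x y.
Proof. intros; exists 0%Z, 0%Z; rewrite !Rminus_0_r; auto. Qed.

Lemma open_tnear (U : Point -> Prop) (x : Point) :
  open_in dT U -> U x -> exists e, 0 < e /\ forall y, tnear e x y -> U y.
Proof.
  intros HU Hx; destruct (HU x Hx) as [e [He H]].
  exists (e / 2); split; [lra|]; intros y Hy; apply H, tnear_dT, Hy.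
Qed.

Lemma open_teq (U : Point -> Prop) (x y : Point) :
  open_in dT U -> U x -> teq x y -> U y.
Proof.
  intros HU Hx Hxy; destruct (open_tnear U x HU Hx) as [e [He H]].
  apply H, teq_tnear; auto.
Qed.

Lemma closed_teq (A : Point -> Prop) (x y : Point) :
  closed_in dT A -> A x -> teq x y -> A y.
Proof.
  intros HA Hx Hxy; apply HA; intros e He; exists x; split; auto.
  apply tnear_dT, teq_tnear; [lra|]; apply teq_sym; auto.
Qed.

(** * Continuity at a point in terms of epsilon and delta *)

Lemma continuous_R (f : R -> R) (t : R) :
  continuous f t <-> forall e, 0 < e -> exists d, 0 < d /\
    forall s, Rabs (s - t) < d -> Rabs (f s - f t) < e.
Proof.
  unfold continuous; rewrite filterlim_locally; split.
  - intros H e He; destruct (H (mkposreal e He)) as [d Hd].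
    exists d; split; [apply cond_pos|]; intros s Hs; apply (Hd s Hs).
  - intros H e; destruct (H e (cond_pos e)) as [d [Hd H']].
    exists (mkposreal d Hd); intros s Hs; apply (H' s Hs).
Qed.

Lemma continuous_R2 (f : R * R -> R) (p : R * R) :
  continuous f p <-> forall e, 0 < e -> exists d, 0 < d /\
    forall q, Rabs (fst q - fst p) < d -> Rabs (snd q - snd p) < d ->
      Rabs (f q - f p) < e.
Proof.
  unfold continuous; rewrite filterlim_locally; split.
  - intros H e He; destruct (H (mkposreal e He)) as [d Hd].
    exists d; split; [apply cond_pos|]; intros q H1 H2; apply Hd; split; assumption.
  - intros H e; destruct (H e (cond_pos e)) as [d [Hd H']].
    exists (mkposreal d Hd); intros q [H1 H2]; apply H'; assumption.
Qed.

Lemma continuous_RR2 (f : R * (R * R) -> R) (p : R * (R * R)) :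
  continuous f p <-> forall e, 0 < e -> exists d, 0 < d /\
    forall q, Rabs (fst q - fst p) < d -> Rabs (fst (snd q) - fst (snd p)) < d ->
      Rabs (snd (snd q) - snd (snd p)) < d ->
      Rabs (f q - f p) < e.
Proof.
  unfold continuous; rewrite filterlim_locally; split.
  - intros H e He; destruct (H (mkposreal e He)) as [d Hd].
    exists d; split; [apply cond_pos|]; intros q H1 H2 H3.
    apply Hd; repeat split; assumption.
  - intros H e; destruct (H e (cond_pos e)) as [d [Hd H']].
    exists (mkposreal d Hd); intros q [H1 [H2 H3]]; apply H'; assumption.
Qed.

(** * Connectedness *)

(** Supremum of the t such that A holds on all of [0, t]. The sets are only required to be open
    relative to the interval, as they are when pulled back along a path. *)
Lemma interval_connected (A B : R -> Prop) :
  (forall t, in01 t -> A t \/ B t) ->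
  (forall t, in01 t -> A t -> exists d, 0 < d /\
     forall s, in01 s -> Rabs (s - t) < d -> A s) ->
  (forall t, in01 t -> B t -> exists d, 0 < d /\
     forall s, in01 s -> Rabs (s - t) < d -> B s) ->
  (forall t, in01 t -> A t -> B t -> False) ->
  A 0 -> A 1.
Proof.
  intros Hc HA HB Hd H0; unfold in01 in *.
  destruct (completeness (fun t => 0 <= t <= 1 /\ forall s, 0 <= s <= t -> A s))
    as [l [Hub Hl]].
  - exists 1; intros t [Ht _]; lra.
  - exists 0; split; [lra|]; intros s Hs; replace s with 0 by lra; auto.
  - assert (Hl0 : 0 <= l).
    { apply Hub; split; [lra|]; intros s Hs; replace s with 0 by lra; auto. }
    assert (Hl1 : l <= 1) by (apply Hl; intros t [Ht _]; lra).
    assert (Happ : forall d, 0 < d -> exists t, l - d < t <= l /\ 0 <= t /\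
              forall s, 0 <= s <= t -> A s).
    { intros d Hd'; apply NNPP; intros Hn.
      assert (l <= l - d); [|lra].
      apply Hl; intros t [Ht Ht']; apply Rnot_lt_le; intros Hlt; apply Hn.
      assert (t <= l) by (apply Hub; split; auto).
      exists t; repeat split; auto; lra. }
    assert (HAl : A l).
    { destruct (Hc l) as [|HBl]; [lra|auto|].
      destruct (HB l) as [d [Hd1 Hd2]]; [lra|auto|].
      destruct (Happ d Hd1) as [t [Ht [Ht0 Ht']]].
      exfalso; apply (Hd t); [lra|apply Ht'; lra|apply Hd2; [lra|]].
      apply Rabs_def1; lra. }
    destruct (HA l) as [d [Hd1 Hd2]]; [lra|auto|].
    destruct (Happ d Hd1) as [t [Ht [Ht0 Ht']]].
    assert (Hm : Rmin 1 (l + d / 2) <= l).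
    { apply Hub; split.
      - split; [apply Rmin_glb; lra|apply Rmin_l].
      - intros s [Hs1 Hs2].
        pose proof (Rmin_l 1 (l + d / 2)); pose proof (Rmin_r 1 (l + d / 2)).
        destruct (Rle_dec s t) as [Hst|Hst]; [apply Ht'; lra|].
        apply Hd2; [lra|apply Rabs_def1; lra]. }
    replace 1 with l; auto.
    revert Hm; unfold Rmin; destruct (Rle_dec 1 (l + d / 2)); lra.
Qed.

(** Lying on the same side of every separation of S. Besides the ends of paths in the plane this
    relates different representatives of one torus point, so chains may jump by Z^2. *)
Definition joined (S : Point -> Prop) (x y : Point) : Prop :=
  forall U V : Point -> Prop, open_in dT U -> open_in dT V ->
    (forall x, S x -> U x \/ V x) -> (forall x, S x -> U x -> V x -> False) ->
    U x -> U y.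

Lemma joined_connected (S : Point -> Prop) :
  (forall x y, S x -> S y -> joined S x y) -> connected_in dT S.
Proof.
  intros H [U [V [HU [HV [Hc [[x [Sx Ux]] [[y [Sy Vy]] Hd]]]]]]].
  apply (Hd y Sy); auto. apply (H x y Sx Sy U V); auto.
Qed.

Lemma joined_trans (S : Point -> Prop) (x y z : Point) :
  joined S x y -> joined S y z -> joined S x z.
Proof. intros H1 H2 U V HU HV Hc Hd Ux; apply (H2 U V), (H1 U V); auto. Qed.

Lemma joined_teq (S : Point -> Prop) (x y : Point) : teq x y -> joined S x y.
Proof. intros H U V HU _ _ _ Ux; eapply open_teq; eauto. Qed.

Lemma joined_path (S : Point -> Prop) (a b : R -> R) :
  (forall t, in01 t -> continuous a t /\ continuous b t /\ S (a t, b t)) ->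
  joined S (a 0, b 0) (a 1, b 1).
Proof.
  intros H U V HU HV Hc Hd.
  assert (Hop : forall W, open_in dT W -> forall t, in01 t -> W (a t, b t) ->
    exists d, 0 < d /\ forall s, in01 s -> Rabs (s - t) < d -> W (a s, b s)).
  { intros W HW t Ht HWt; destruct (open_tnear W _ HW HWt) as [e [He HWe]].
    destruct (H t Ht) as [Ha [Hb _]]; rewrite continuous_R in Ha, Hb.
    destruct (Ha e He) as [d1 [Hd1 Ha1]]; destruct (Hb e He) as [d2 [Hd2 Hb2]].
    exists (Rmin d1 d2); split; [apply Rmin_pos; auto|].
    intros s Hs Hst; apply HWe, box_tnear; simpl; rewrite Rabs_minus_sym;
      [apply Ha1|apply Hb2]; eapply Rlt_le_trans; eauto using Rmin_l, Rmin_r. }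
  apply (interval_connected (fun t => U (a t, b t)) (fun t => V (a t, b t))); auto.
  - intros t Ht; apply Hc, H, Ht.
  - intros t Ht; apply Hd, H, Ht.
Qed.

Lemma joined_segment (S : Point -> Prop) (x y : Point) :
  (forall t, in01 t -> S (fst x + t * (fst y - fst x), snd x + t * (snd y - snd x))) ->
  joined S x y.
Proof.
  intros H.
  assert (J := joined_path S (fun t => fst x + t * (fst y - fst x))
                 (fun t => snd x + t * (snd y - snd x))).
  simpl in J.
  replace x with (fst x + 0 * (fst y - fst x), snd x + 0 * (snd y - snd x)) at 1
    by (rewrite !Rmult_0_l, !Rplus_0_r; destruct x; auto).
  replace y with (fst x + 1 * (fst y - fst x), snd x + 1 * (snd y - snd x)) at 3
    by (rewrite !Rmult_1_l; destruct y; simpl; f_equal; ring).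
  apply J; intros t Ht; repeat split; auto;
    apply (continuous_plus (V := R_NormedModule)); try apply continuous_const;
    apply (continuous_mult (K := R_AbsRing)); try apply continuous_const; apply continuous_id.
Qed.

(** * Rational independence and Kronecker density *)

Definition irrational (s : R) : Prop :=
  forall p q : Z, IZR p + IZR q * s = 0 -> q = 0%Z.

(** Infinite descent on |q|: d divides p, then q, and the quotients solve the same equation. The
    divisibility hypothesis expresses that d is squarefree. *)
Lemma no_rational_sqrt (d : Z) :
  (1 < d)%Z -> (forall a : Z, (d | a * a)%Z -> (d | a)%Z) ->
  forall p q : Z, (p * p = d * (q * q))%Z -> q = 0%Z.
Proof.
  intros Hd Hdiv p q.
  remember (Z.to_nat (Z.abs q)) as k eqn:Hk.
  revert p q Hk; induction k as [k IH] using (well_founded_induction lt_wf).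
  intros p q Hk H; destruct (Z.eq_dec q 0) as [|Hq]; auto; exfalso.
  destruct (Hdiv p) as [p' Hp]; [exists (q * q)%Z; lia|].
  destruct (Hdiv q) as [q' Hq']; [exists (p' * p')%Z; subst p; nia|].
  assert (q' = 0%Z); [|lia].
  apply (IH (Z.to_nat (Z.abs q'))) with (p := p'); auto; [nia|].
  subst p q; nia.
Qed.

Lemma square_divisible (d a : Z) : (d = 2 \/ d = 3 \/ d = 6)%Z ->
  (d | a * a)%Z -> (d | a)%Z.
Proof.
  intros Hd; rewrite <- !Z.mod_divide by lia; rewrite Z.mul_mod by lia.
  intros H; assert (0 <= a mod d < d)%Z by (apply Z.mod_pos_bound; lia).
  destruct Hd as [ -> | [ -> | -> ]];
  match type of H0 with (0 <= ?x < _)%Z => remember x as r eqn:E; clear E end;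
  assert (Hr : (r = 0 \/ r = 1 \/ r = 2 \/ r = 3 \/ r = 4 \/ r = 5)%Z) by lia;
  destruct Hr as [|[|[|[|[|]]]]]; subst r; auto; try lia; discriminate.
Qed.

Lemma rat_indep_exists : exists a b : R, rat_indep a b.
Proof.
  exists (sqrt 2), (sqrt 3); intros p q r H.
  assert (H2 : sqrt 2 * sqrt 2 = 2) by (apply sqrt_sqrt; lra).
  assert (H3 : sqrt 3 * sqrt 3 = 3) by (apply sqrt_sqrt; lra).
  assert (irr : forall d, (d = 2 \/ d = 3 \/ d = 6)%Z ->
            forall p q : Z, (p * p = d * (q * q))%Z -> q = 0%Z).
  { intros d Hd; apply no_rational_sqrt; [lia|]; intros a; apply square_divisible; auto. }
  (* Squaring p = -(q sqrt 2 + r sqrt 3) gives p^2 - 2 q^2 - 3 r^2 = 2 q r sqrt 6, so irrationality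
     of sqrt 6 forces q r = 0. What remains involves one square root only. *)
  assert (Hqr : (q * r)%Z = 0%Z).
  { assert ((2 * (q * r)) = 0)%Z; [|lia].
    apply (irr 6%Z) with (p := (p * p - 2 * (q * q) - 3 * (r * r))%Z); auto.
    apply eq_IZR; rewrite !mult_IZR, !minus_IZR, !mult_IZR.
    assert (E : IZR p * IZR p - 2 * (IZR q * IZR q) - 3 * (IZR r * IZR r) =
                2 * (IZR q * IZR r) * (sqrt 2 * sqrt 3)).
    { replace (IZR p) with (- (IZR q * sqrt 2 + IZR r * sqrt 3)) by lra.
      transitivity (IZR q * IZR q * (sqrt 2 * sqrt 2) + IZR r * IZR r * (sqrt 3 * sqrt 3)
        + 2 * (IZR q * IZR r) * (sqrt 2 * sqrt 3)
        - 2 * (IZR q * IZR q) - 3 * (IZR r * IZR r)); [ring|rewrite H2, H3; ring]. }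
    rewrite E.
    transitivity ((2 * (IZR q * IZR r)) * (2 * (IZR q * IZR r)) *
      ((sqrt 2 * sqrt 2) * (sqrt 3 * sqrt 3))); [ring|rewrite H2, H3; ring]. }
  assert (Hq0r0 : q = 0%Z \/ r = 0%Z) by lia.
  destruct Hq0r0 as [-> | ->].
  - assert (r = 0%Z); [|subst; split; auto; apply eq_IZR; lra].
    apply (irr 3%Z) with (p := p); auto. apply eq_IZR; rewrite !mult_IZR.
    replace (IZR p) with (- (IZR r * sqrt 3)) by lra.
    transitivity (IZR r * IZR r * (sqrt 3 * sqrt 3)); [ring|rewrite H3; ring].
  - assert (q = 0%Z); [|subst; split; auto; apply eq_IZR; lra].
    apply (irr 2%Z) with (p := p); auto. apply eq_IZR; rewrite !mult_IZR.
    replace (IZR p) with (- (IZR q * sqrt 2)) by lra.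
    transitivity (IZR q * IZR q * (sqrt 2 * sqrt 2)); [ring|rewrite H2; ring].
Qed.

Lemma rat_indep_irrational_l (a b : R) : rat_indep a b -> irrational a.
Proof. intros H p q E; apply (H p q 0%Z); lra. Qed.

Lemma rat_indep_irrational_r (a b : R) : rat_indep a b -> irrational b.
Proof. intros H p q E; apply (H p 0%Z q); lra. Qed.

Lemma irrational_neq_0 (b : R) : irrational b -> b <> 0.
Proof. intros H ->; discriminate (H 0%Z 1%Z); lra. Qed.

Lemma rat_indep_irrational_div (a b : R) : rat_indep a b -> irrational (a / b).
Proof.
  intros H p q E.
  assert (Hb : b <> 0) by (apply irrational_neq_0, (rat_indep_irrational_r a), H).
  apply (H 0%Z q p).
  transitivity ((IZR p + IZR q * (a / b)) * b); [field; auto|rewrite E; ring].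
Qed.

Lemma pigeonhole (T : Type) (f : nat -> T) (l : list T) :
  (forall i, In (f i) l) -> exists i j, (i < j)%nat /\ f i = f j.
Proof.
  intros Hin; apply NNPP; intros Hn.
  assert (Hinj : forall i j, f i = f j -> i = j).
  { intros i j E; destruct (Nat.lt_total i j) as [L|[|L]]; auto; exfalso; apply Hn;
      [exists i, j|exists j, i]; auto. }
  assert (Hlen : (length (map f (seq 0 (S (length l)))) <= length l)%nat).
  { apply NoDup_incl_length.
    - apply NoDup_map_NoDup_ForallPairs; [|apply seq_NoDup].
      intros i j _ _; apply Hinj.
    - intros x Hx; apply in_map_iff in Hx; destruct Hx as [i [<- _]]; auto. }
  rewrite length_map, length_seq in Hlen; lia.
Qed.

(** Dirichlet's box argument: the points i (a, b) modulo 1 are sorted into N^2 squares of side 1/N <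
    e, and the difference of two indices in one square serves as n. *)
Lemma dirichlet2 (a b e : R) : 0 < e ->
  exists (n : nat) (p q : Z), (0 < n)%nat /\
    Rabs (INR n * a - IZR p) < e /\ Rabs (INR n * b - IZR q) < e.
Proof.
  intros He.
  destruct (nfloor_ex (/ e)) as [k [_ Hk]]; [left; apply Rinv_0_lt_compat, He|].
  set (N := S k).
  assert (HN : 0 < INR N) by (apply lt_0_INR; unfold N; lia).
  assert (HNe : 1 < INR N * e).
  { unfold N; rewrite S_INR; apply Rmult_lt_compat_r with (r := e) in Hk; auto.
    rewrite Rinv_l in Hk; lra. }
  pose (box := fun (c : R) (i : nat) => Int_part (INR N * frac_part (INR i * c))).
  assert (Hbox : forall c i, In (box c i) (map Z.of_nat (seq 0 N))).
  { intros c i; apply in_map_iff; exists (Z.to_nat (box c i)).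
    destruct (base_fp (INR i * c)) as [F1 F2].
    destruct (Int_part_bounds (INR N * frac_part (INR i * c))) as [I1 I2].
    fold (box c i) in I1, I2.
    assert (0 <= box c i)%Z.
    { assert (-1 < box c i)%Z; [apply lt_IZR; nra|lia]. }
    assert (box c i < Z.of_nat N)%Z.
    { apply lt_IZR; rewrite <- INR_IZR_INZ. nra. }
    rewrite in_seq; lia. }
  assert (Hclose : forall c i j, box c i = box c j -> exists p : Z,
      Rabs ((INR j - INR i) * c - IZR p) < e).
  { intros c i j E; exists (Int_part (INR j * c) - Int_part (INR i * c))%Z.
    rewrite minus_IZR.
    destruct (Int_part_bounds (INR N * frac_part (INR i * c))) as [I1 I2].
    destruct (Int_part_bounds (INR N * frac_part (INR j * c))) as [J1 J2].
    fold (box c i) in I1, I2; fold (box c j) in J1, J2; rewrite E in I1, I2.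
    unfold frac_part in *.
    apply Rabs_def1; nra. }
  destruct (pigeonhole _ (fun i => (box a i, box b i))
     (list_prod (map Z.of_nat (seq 0 N)) (map Z.of_nat (seq 0 N)))) as [i [j [Hij E]]].
  - intros i; apply in_prod; apply Hbox.
  - injection E; intros E2 E1.
    destruct (Hclose a i j E1) as [p Hp]; destruct (Hclose b i j E2) as [q Hq].
    exists (j - i)%nat, p, q; rewrite minus_INR by lia; split; auto; lia.
Qed.

(** Dirichlet yields a nonzero step v = k s - p shorter than e. After adding an integer M to the
    target so that it lies on the side of v, multiples of v come within one step of it. The lower
    bound K on m costs only a shift of the target; [kronecker2] uses it to obtain a nonnegative
    time. *)
Lemma kronecker (s y e : R) (K : nat) : irrational s -> 0 < e ->
  exists (m : nat) (n : Z), (K <= m)%nat /\ Rabs (INR m * s - y - IZR n) < e.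
Proof.
  intros Hs He.
  enough (H : forall y, exists (m : nat) (n : Z), Rabs (INR m * s - y - IZR n) < e).
  { destruct (H (y - INR K * s)) as [m [n Hmn]]; exists (K + m)%nat, n; split; [lia|].
    rewrite plus_INR.
    replace ((INR K + INR m) * s - y - IZR n)
      with (INR m * s - (y - INR K * s) - IZR n) by ring; auto. }
  clear y; intros y.
  destruct (dirichlet2 s s e He) as [k [p [_ [Hk [Hv _]]]]].
  set (v := INR k * s - IZR p) in *.
  assert (Hv0 : v <> 0).
  { intros E; assert (Z.of_nat k = 0%Z); [|lia].
    apply (Hs (- p)%Z); rewrite opp_IZR, <- INR_IZR_INZ; unfold v in E; lra. }
  assert (HM : exists M : Z, 0 <= (y + IZR M) / v).
  { destruct (archimed (Rabs y)) as [Hup _].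
    destruct (Rlt_dec 0 v) as [Hp|Hn].
    - exists (up (Rabs y)); apply Rmult_le_pos; [|left; apply Rinv_0_lt_compat; auto].
      pose proof (Rle_abs (- y)); rewrite Rabs_Ropp in H; lra.
    - exists (- up (Rabs y))%Z; rewrite opp_IZR.
      replace ((y + - IZR (up (Rabs y))) / v) with ((IZR (up (Rabs y)) - y) / (- v))
        by (field; auto).
      apply Rmult_le_pos; [|left; apply Rinv_0_lt_compat; lra].
      pose proof (Rle_abs y); lra. }
  destruct HM as [M HM]; destruct (nfloor_ex _ HM) as [j [J1 J2]].
  exists (j * k)%nat, (M + Z.of_nat j * p)%Z.
  rewrite plus_IZR, mult_IZR, mult_INR, <- INR_IZR_INZ.
  replace (INR j * INR k * s - y - (IZR M + INR j * IZR p))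
    with (- (((y + IZR M) / v - INR j) * v)).
  - rewrite Rabs_Ropp, Rabs_mult. rewrite (Rabs_pos_eq (_ - _)) by lra.
    pose proof (Rabs_pos_lt v Hv0); nra.
  - transitivity (INR j * v - (y + IZR M)); [field; auto|unfold v; ring].
Qed.

(* Multiples of one small vector [n0 (a, b) - (p0, q0)] follow a line of irrational
   slope, and such a line comes close to every point of the torus. *)
Lemma kronecker2 (a b x y e : R) : rat_indep a b -> 0 < e ->
  exists (n : nat) (p q : Z),
    Rabs (INR n * a - x - IZR p) < e /\ Rabs (INR n * b - y - IZR q) < e.
Proof.
  intros Hab He.
  destruct (dirichlet2 a b (e / 2)) as [n0 [p0 [q0 [Hn0 [Hv1 Hv2]]]]]; [lra|].
  set (v1 := INR n0 * a - IZR p0) in *; set (v2 := INR n0 * b - IZR q0) in *.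
  assert (Hz : forall p q : Z, IZR p * v1 + IZR q * v2 = 0 -> p = 0%Z /\ q = 0%Z).
  { intros p q E.
    destruct (Hab (- p * p0 - q * q0)%Z (p * Z.of_nat n0)%Z (q * Z.of_nat n0)%Z)
      as [_ [E1 E2]]; [|nia].
    rewrite minus_IZR, !mult_IZR, opp_IZR, <- INR_IZR_INZ; unfold v1, v2 in E; lra. }
  assert (Hv10 : v1 <> 0).
  { intros E; destruct (Hz 1%Z 0%Z); [rewrite E; ring|lia]. }
  assert (Hnu : exists nu : Z, (nu = 1 \/ nu = -1)%Z /\ 0 < IZR nu / v1).
  { destruct (Rlt_dec 0 v1).
    - exists 1%Z; split; auto. apply Rdiv_lt_0_compat; lra.
    - exists (-1)%Z; split; auto. replace (-1 / v1) with (1 / (- v1)) by (field; auto).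
      apply Rdiv_lt_0_compat; lra. }
  destruct Hnu as [nu [Hnu Hnuv]].
  assert (Hnu2 : IZR nu * IZR nu = 1) by (destruct Hnu; subst; simpl; lra).
  destruct (nfloor_ex (Rabs x) (Rabs_pos x)) as [K [_ HK]].
  (* The line through 0 in direction v has ordinate (x + nu m) v2 / v1 at abscissa x + nu m, and m
     is chosen to bring this near y modulo 1. The sign nu of v1 and m > |x| make the time s of that
     crossing nonnegative. Rounding s down to j moves the point by less than |v|, which is the other
     e / 2. *)
  destruct (kronecker (IZR nu * (v2 / v1)) (y - x * (v2 / v1)) (e / 2) (S K))
    as [m [n [Hm Hmn]]].
  - intros p q E; assert (E' : q = 0%Z \/ (q * nu)%Z = 0%Z); [right|lia].
    apply (Hz p). rewrite mult_IZR.
    transitivity ((IZR p + IZR q * (IZR nu * (v2 / v1))) * v1); [field; auto|rewrite E; ring].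
  - lra.
  - assert (HKm : Rabs x < INR m).
    { apply Rlt_le_trans with (1 := HK); rewrite <- S_INR; apply le_INR; auto. }
    set (s := (x + IZR nu * INR m) / v1).
    assert (Hs : 0 <= s).
    { replace s with ((IZR nu / v1) * (INR m + IZR nu * x)).
      - apply Rmult_le_pos; [lra|]. pose proof (Rle_abs x); pose proof (Rle_abs (- x)).
        rewrite Rabs_Ropp in H0. destruct Hnu; subst; simpl; lra.
      - unfold s; transitivity ((IZR nu * INR m + IZR nu * IZR nu * x) / v1);
          [field; auto|rewrite Hnu2; field; auto]. }
    destruct (nfloor_ex s Hs) as [j [J1 J2]].
    exists (j * n0)%nat, (nu * Z.of_nat m + Z.of_nat j * p0)%Z, (n + Z.of_nat j * q0)%Z.
    rewrite !plus_IZR, !mult_IZR, mult_INR, <- !INR_IZR_INZ.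
    assert (Hj : forall v, Rabs v < e / 2 -> Rabs ((s - INR j) * v) < e / 2).
    { intros v Hv; rewrite Rabs_mult, (Rabs_pos_eq (_ - _)) by lra.
      pose proof (Rabs_pos v); nra. }
    split.
    + replace (INR j * INR n0 * a - x - (IZR nu * INR m + INR j * IZR p0))
        with (- ((s - INR j) * v1)).
      * rewrite Rabs_Ropp; apply Rlt_trans with (1 := Hj _ Hv1); lra.
      * transitivity (INR j * v1 - s * v1); [ring|].
        replace (s * v1) with (x + IZR nu * INR m) by (unfold s; field; auto).
        unfold v1; ring.
    + replace (INR j * INR n0 * b - y - (IZR n + INR j * IZR q0))
        with (- ((s - INR j) * v2) +
              (INR m * (IZR nu * (v2 / v1)) - (y - x * (v2 / v1)) - IZR n)).
      * apply Rle_lt_trans with (1 := Rabs_triang _ _).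
        rewrite Rabs_Ropp; specialize (Hj _ Hv2); lra.
      * replace (s) with (x / v1 + IZR nu * INR m / v1) by (unfold s; field; auto).
        unfold v2; field; auto.
Qed.

Lemma irrational_dense (s x y : R) : irrational s -> x < y ->
  exists n m : Z, x < IZR n * s + IZR m < y.
Proof.
  intros Hs Hxy.
  destruct (kronecker s ((x + y) / 2) ((y - x) / 2) 0 Hs) as [m [n [_ H]]]; [lra|].
  exists (Z.of_nat m), (- n)%Z; rewrite opp_IZR, <- INR_IZR_INZ.
  apply Rabs_def2 in H; lra.
Qed.

(** * Denjoy staircases *)

(** The weights sum to 1. Hence constants pass through, and the staircases built from it have degree
    one without normalization. *)
Definition wsum (a : nat -> R) : R := Series (fun k => (/ 2) ^ S k * a k).

Lemma half_pow_pos (k : nat) : 0 < (/ 2) ^ k.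
Proof. apply pow_lt; lra. Qed.

Lemma ex_series_half : ex_series (fun k => (/ 2) ^ S k).
Proof.
  apply (ex_series_ext (fun k => / 2 * (/ 2) ^ k)); [intros; simpl; ring|].
  apply (ex_series_scal (V := R_NormedModule)), ex_series_geom.
  rewrite Rabs_pos_eq; lra.
Qed.

Lemma ex_wsum (a : nat -> R) (B : R) : (forall k, Rabs (a k) <= B) ->
  ex_series (fun k => (/ 2) ^ S k * a k).
Proof.
  intros H; apply (ex_series_le (V := R_CompleteNormedModule)) with (b := fun k => B * (/ 2) ^ S k).
  - intros k; change norm with Rabs; rewrite Rabs_mult.
    rewrite Rabs_pos_eq by (left; apply half_pow_pos).
    rewrite Rmult_comm; apply Rmult_le_compat_r; [left; apply half_pow_pos|apply H].
  - apply (ex_series_scal (V := R_NormedModule)), ex_series_half.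
Qed.

Lemma wsum_const (c : R) : wsum (fun _ => c) = c.
Proof.
  unfold wsum; rewrite (Series_ext _ (fun k => (c * / 2) * (/ 2) ^ k))
    by (intros; simpl; ring).
  rewrite Series_scal_l, Series_geom by (rewrite Rabs_pos_eq; lra). lra.
Qed.

Lemma wsum_minus (a b : nat -> R) (B : R) :
  (forall k, Rabs (a k) <= B) -> (forall k, Rabs (b k) <= B) ->
  wsum a - wsum b = wsum (fun k => a k - b k).
Proof.
  intros Ha Hb; unfold wsum; rewrite <- Series_minus;
    [apply Series_ext; intros; ring|eapply ex_wsum; eauto|eapply ex_wsum; eauto].
Qed.

Lemma wsum_split (a : nat -> R) (B : R) (N : nat) : (forall k, Rabs (a k) <= B) ->
  wsum a = sum_f_R0 (fun k => (/ 2) ^ S k * a k) N +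
           (/ 2) ^ S N * wsum (fun k => a (S N + k)%nat).
Proof.
  intros H; unfold wsum; rewrite (Series_incr_n _ (S N)); [|lia|eapply ex_wsum; eauto].
  f_equal; rewrite <- Series_scal_l; apply Series_ext; intros k.
  replace (S (S N + k)) with (S N + S k)%nat by lia.
  rewrite pow_add; ring.
Qed.

Lemma wsum_nonneg (a : nat -> R) (B : R) : (forall k, 0 <= a k <= B) -> 0 <= wsum a.
Proof.
  intros H; rewrite <- (wsum_const 0); apply Series_le.
  - intros k; pose proof (half_pow_pos (S k)); specialize (H k).
    rewrite Rmult_0_r; split; [lra|]; apply Rmult_le_pos; lra.
  - apply ex_wsum with B; intros k; specialize (H k); rewrite Rabs_pos_eq; lra.
Qed.

Lemma wsum_pos (a : nat -> R) (B : R) (k0 : nat) :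
  (forall k, 0 <= a k <= B) -> 0 < a k0 -> 0 < wsum a.
Proof.
  intros H H0; rewrite (wsum_split a B k0).
  2: intros k; specialize (H k); rewrite Rabs_pos_eq; lra.
  assert (Ht : 0 <= wsum (fun k => a (S k0 + k)%nat)) by (apply wsum_nonneg with B; auto).
  pose proof (half_pow_pos (S k0)) as Hw.
  assert (Hterm : forall k, 0 <= (/ 2) ^ S k * a k).
  { intros k; apply Rmult_le_pos; [left; apply half_pow_pos|apply H]. }
  assert (0 < sum_f_R0 (fun k => (/ 2) ^ S k * a k) k0); [|nra].
  destruct k0 as [|k0].
  - unfold sum_f_R0; apply Rmult_lt_0_compat; auto.
  - rewrite tech5; apply Rplus_le_lt_0_compat.
    + apply cond_pos_sum; auto.
    + apply Rmult_lt_0_compat; auto.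
Qed.

Lemma wsum_le (a b : nat -> R) (B : R) :
  (forall k, Rabs (a k) <= B) -> (forall k, Rabs (b k) <= B) ->
  (forall k, a k <= b k) -> wsum a <= wsum b.
Proof.
  intros Ha Hb H; apply Rminus_le_0; rewrite (wsum_minus b a B) by auto.
  apply wsum_nonneg with (B + B); intros k; specialize (Ha k); specialize (Hb k).
  specialize (H k); apply Rabs_le_between in Ha, Hb; lra.
Qed.

Lemma wsum_lt (a b : nat -> R) (B : R) (k0 : nat) :
  (forall k, Rabs (a k) <= B) -> (forall k, Rabs (b k) <= B) ->
  (forall k, a k <= b k) -> a k0 < b k0 -> wsum a < wsum b.
Proof.
  intros Ha Hb H H0; apply Rlt_0_minus in H0; apply Rlt_0_minus.
  rewrite (wsum_minus b a B) by auto.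
  apply wsum_pos with (B + B) k0; auto; intros k; specialize (Ha k); specialize (Hb k).
  specialize (H k); apply Rabs_le_between in Ha, Hb; lra.
Qed.

Lemma wsum_shift (a : nat -> R) (B c : R) : (forall k, Rabs (a k) <= B) ->
  wsum (fun k => a k + c) = wsum a + c.
Proof.
  intros Ha; transitivity (wsum a + wsum (fun _ => c)); [|rewrite wsum_const; auto].
  unfold wsum; rewrite <- Series_plus.
  - apply Series_ext; intros; ring.
  - apply ex_wsum with B; auto.
  - apply ex_wsum with (Rabs c); intros; lra.
Qed.

Lemma wsum_close (a b : nat -> R) (B : R) (N : nat) :
  (forall k, Rabs (a k) <= B) -> (forall k, Rabs (b k) <= B) ->
  (forall k, (k <= N)%nat -> a k = b k) -> wsum a - wsum b <= (/ 2) ^ S N * (B + B).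
Proof.
  intros Ha Hb H; rewrite (wsum_split a B N), (wsum_split b B N) by auto.
  rewrite (sum_eq (fun k => (/ 2) ^ S k * a k) (fun k => (/ 2) ^ S k * b k)) by
    (intros; rewrite H; auto).
  assert (wsum (fun k => a (S N + k)%nat) <= B).
  { rewrite <- (wsum_const B); apply (wsum_le _ _ B); auto.
    - intros _; rewrite Rabs_pos_eq; [lra|]. apply Rle_trans with (2 := Ha 0%nat), Rabs_pos.
    - intros k; specialize (Ha (S N + k)%nat); apply Rabs_le_between in Ha; lra. }
  assert (- B <= wsum (fun k => b (S N + k)%nat)).
  { rewrite <- (wsum_const (- B)); apply (wsum_le _ _ B); auto.
    - intros _; rewrite Rabs_Ropp, Rabs_pos_eq; [lra|].
      apply Rle_trans with (2 := Ha 0%nat), Rabs_pos.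
    - intros k; specialize (Hb (S N + k)%nat); apply Rabs_le_between in Hb; lra. }
  pose proof (half_pow_pos (S N)); nra.
Qed.

(** [flr] is the floor plus one and [cel] is the ceiling: the right- and left-continuous versions of
    one integer staircase. They agree off the integers and differ by 1 on them. *)
Definition flr (u : R) : R := IZR (up u).
Definition cel (u : R) : R := 1 - IZR (up (- u)).

Lemma flr_bounds (u : R) : u < flr u <= u + 1.
Proof. unfold flr; destruct (archimed u); lra. Qed.

Lemma cel_bounds (u : R) : u <= cel u < u + 1.
Proof. unfold cel; destruct (archimed (- u)); lra. Qed.

Lemma flr_eq (u : R) (m : Z) : u < IZR m <= u + 1 -> flr u = IZR m.
Proof. intros H; unfold flr; f_equal; symmetry; apply tech_up; lra. Qed.

Lemma cel_eq (u : R) (m : Z) : u <= IZR m < u + 1 -> cel u = IZR m.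
Proof.
  intros H; unfold cel; rewrite <- (tech_up (- u) (1 - m)); rewrite minus_IZR; lra.
Qed.

Lemma cel_IZR (u : R) : exists m : Z, cel u = IZR m.
Proof. exists (1 - up (- u))%Z; rewrite minus_IZR; auto. Qed.

Lemma flr_le_cel (u v : R) : u < v -> flr u <= cel v.
Proof.
  intros H; destruct (cel_IZR v) as [m Hm]; pose proof (cel_bounds v).
  pose proof (flr_bounds u); rewrite Hm in *; unfold flr in *.
  apply IZR_le; assert (up u < m + 1)%Z; [|lia]; apply lt_IZR; rewrite plus_IZR; lra.
Qed.

Lemma cel_le_flr (u : R) : cel u <= flr u.
Proof.
  destruct (cel_IZR u) as [m Hm]; pose proof (cel_bounds u).
  pose proof (flr_bounds u); rewrite Hm in *; unfold flr in *.
  apply IZR_le; assert (m < up u + 1)%Z; [|lia]; apply lt_IZR; rewrite plus_IZR; lra.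
Qed.

Lemma flr_add_IZR (u : R) (m : Z) : flr (u + IZR m) = flr u + IZR m.
Proof.
  pose proof (flr_bounds u); unfold flr at 2; rewrite <- plus_IZR; apply flr_eq.
  rewrite plus_IZR; fold (flr u); lra.
Qed.

Lemma cel_add_IZR (u : R) (m : Z) : cel (u + IZR m) = cel u + IZR m.
Proof.
  destruct (cel_IZR u) as [k Hk]; pose proof (cel_bounds u).
  rewrite Hk, <- plus_IZR in *; apply cel_eq; rewrite plus_IZR; lra.
Qed.

(** * Staircases with jumps along an orbit *)

Definition orbit (al t : R) : Prop := exists n m : Z, t = IZR n * al + IZR m.

(** The integer multiplier is written as a difference i - j with (i, j) decoded from k. Each orbit
    point is thus listed infinitely often, which is harmless: only the positivity of its total mass
    matters. *)
Definition orbit_pt (al : R) (k : nat) : R :=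
  frac_part ((INR (fst (of_nat k)) - INR (snd (of_nat k))) * al).

Lemma orbit_pt_spec (al t : R) :
  orbit al t <-> exists (k : nat) (m : Z), t = orbit_pt al k + IZR m.
Proof.
  split.
  - intros [n [m ->]].
    exists (to_nat (Z.to_nat n, Z.to_nat (- n))).
    unfold orbit_pt; rewrite cancel_of_to; simpl; rewrite !INR_IZR_INZ, <- minus_IZR.
    replace (Z.of_nat (Z.to_nat n) - Z.of_nat (Z.to_nat (- n)))%Z with n by lia.
    exists (m + Int_part (IZR n * al))%Z; unfold frac_part; rewrite plus_IZR; ring.
  - intros [k [m ->]]; unfold orbit_pt, frac_part.
    rewrite !INR_IZR_INZ, <- minus_IZR.
    match goal with |- orbit _ (IZR ?n * _ - IZR ?i + _) => exists n, (m - i)%Z end.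
    rewrite (minus_IZR m); ring.
Qed.

Lemma orbit_shift (al t : R) (n m : Z) :
  orbit al (t + IZR n * al + IZR m) <-> orbit al t.
Proof.
  split; intros [i [j E]].
  - exists (i - n)%Z, (j - m)%Z; rewrite !minus_IZR; lra.
  - exists (i + n)%Z, (j + m)%Z; rewrite !plus_IZR; lra.
Qed.

(* The two one-sided limits of the distribution function of the measure
   that gives mass [2^-(k+1)] to [orbit_pt al k + Z]. *)
Definition lo (al t : R) : R := wsum (fun k => cel (t - orbit_pt al k)).
Definition hi (al t : R) : R := wsum (fun k => flr (t - orbit_pt al k)).

Lemma orbit_pt_bounds (al : R) (k : nat) : 0 <= orbit_pt al k < 1.
Proof.
  unfold orbit_pt.
  destruct (base_fp ((INR (fst (of_nat k)) - INR (snd (of_nat k))) * al)); lra.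
Qed.

Lemma cel_term_bound (al t B : R) : Rabs t <= B ->
  forall k, Rabs (cel (t - orbit_pt al k)) <= B + 2.
Proof.
  intros H k; pose proof (cel_bounds (t - orbit_pt al k)); pose proof (orbit_pt_bounds al k).
  apply Rabs_le_between in H; apply Rabs_le_between; lra.
Qed.

Lemma flr_term_bound (al t B : R) : Rabs t <= B ->
  forall k, Rabs (flr (t - orbit_pt al k)) <= B + 2.
Proof.
  intros H k; pose proof (flr_bounds (t - orbit_pt al k)); pose proof (orbit_pt_bounds al k).
  apply Rabs_le_between in H; apply Rabs_le_between; lra.
Qed.

Lemma lo_le_hi (al t : R) : lo al t <= hi al t.
Proof.
  apply wsum_le with (Rabs t + 2).
  - apply cel_term_bound; lra.
  - apply flr_term_bound; lra.
  - intros k; apply cel_le_flr.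
Qed.

(** The k-th terms differ exactly when t - [orbit_pt al k] is an integer. *)
Lemma lo_lt_hi (al t : R) : lo al t < hi al t <-> orbit al t.
Proof.
  rewrite orbit_pt_spec; split.
  - intros H; apply NNPP; intros Hn; apply (Rlt_irrefl (lo al t)).
    replace (lo al t) with (hi al t) at 2; auto.
    unfold hi, lo; f_equal; apply functional_extensionality; intros k.
    destruct (cel_IZR (t - orbit_pt al k)) as [m Hm].
    pose proof (cel_bounds (t - orbit_pt al k)); rewrite Hm in *; apply flr_eq.
    split; [|lra]; destruct (Req_dec (t - orbit_pt al k) (IZR m)); [|lra].
    exfalso; apply Hn; exists k, m; lra.
  - intros [k [m E]]; apply wsum_lt with (Rabs t + 2) k.
    + apply cel_term_bound; lra.
    + apply flr_term_bound; lra.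
    + intros; apply cel_le_flr.
    + rewrite (cel_eq _ m), (flr_eq _ (m + 1)); rewrite ?plus_IZR; lra.
Qed.

(** By density an orbit point lies strictly between t and u and contributes its mass. The intervals
    [lo t, hi t] are therefore pairwise disjoint and ordered like their indices. *)
Lemma hi_lt_lo (al t u : R) : irrational al -> t < u -> hi al t < lo al u.
Proof.
  intros Hal Htu; destruct (irrational_dense al t u Hal Htu) as [n [m Hnm]].
  assert (Ho : orbit al (IZR n * al + IZR m)) by (exists n, m; auto).
  apply orbit_pt_spec in Ho; destruct Ho as [k [i E]]; rewrite E in Hnm.
  apply wsum_lt with (Rabs t + Rabs u + 2) k.
  - apply flr_term_bound; pose proof (Rabs_pos u); lra.
  - apply cel_term_bound; pose proof (Rabs_pos t); lra.
  - intros; apply flr_le_cel; lra.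
  - apply Rle_lt_trans with (IZR i).
    + rewrite <- (cel_eq (IZR i) i) by lra. apply flr_le_cel; lra.
    + apply Rlt_le_trans with (flr (IZR i)); [apply flr_bounds|apply flr_le_cel; lra].
Qed.

Lemma lo_add_IZR (al t : R) (m : Z) : lo al (t + IZR m) = lo al t + IZR m.
Proof.
  unfold lo; rewrite <- (wsum_shift _ (Rabs t + 2)) by (apply cel_term_bound; lra).
  f_equal; apply functional_extensionality; intros k; rewrite <- cel_add_IZR; f_equal; ring.
Qed.

Lemma hi_add_IZR (al t : R) (m : Z) : hi al (t + IZR m) = hi al t + IZR m.
Proof.
  unfold hi; rewrite <- (wsum_shift _ (Rabs t + 2)) by (apply flr_term_bound; lra).
  f_equal; apply functional_extensionality; intros k; rewrite <- flr_add_IZR; f_equal; ring.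
Qed.

Lemma lo_bounds (al t : R) : t - 1 <= lo al t <= t + 1.
Proof.
  assert (Hb : forall c k, c = t - 1 \/ c = t + 1 -> Rabs ((fun _ : nat => c) k) <= Rabs t + 2).
  { intros c k [-> | ->]; pose proof (Rle_abs t); pose proof (Rle_abs (- t));
      rewrite Rabs_Ropp in *; apply Rabs_le_between; lra. }
  assert (Hc : forall k, Rabs (cel (t - orbit_pt al k)) <= Rabs t + 2)
    by (apply cel_term_bound; lra).
  split; unfold lo.
  - rewrite <- (wsum_const (t - 1)) at 1; apply wsum_le with (Rabs t + 2); auto.
    intros k; pose proof (cel_bounds (t - orbit_pt al k)); pose proof (orbit_pt_bounds al k); lra.
  - rewrite <- (wsum_const (t + 1)) at 1; apply wsum_le with (Rabs t + 2); auto.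
    intros k; pose proof (cel_bounds (t - orbit_pt al k)); pose proof (orbit_pt_bounds al k); lra.
Qed.

(** Serves the head of a weighted series, where each staircase is locally constant on one side; the
    tail is small because of the weights. *)
Lemma uniform_delta (Q : nat -> R -> Prop) (N : nat) :
  (forall k, exists d, 0 < d /\ forall x, 0 <= x < d -> Q k x) ->
  exists d, 0 < d <= 1 /\ forall x k, 0 <= x < d -> (k <= N)%nat -> Q k x.
Proof.
  intros H; induction N as [|N [d [Hd IH]]].
  - destruct (H 0%nat) as [d [Hd HQ]]; exists (Rmin d 1); split.
    + split; [apply Rmin_pos; lra|apply Rmin_r].
    + intros x k Hx Hk; replace k with 0%nat by lia; apply HQ.
      pose proof (Rmin_l d 1); lra.
  - destruct (H (S N)) as [d' [Hd' HQ]]; exists (Rmin d d'); split.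
    + split; [apply Rmin_pos; lra|]. pose proof (Rmin_l d d'); lra.
    + intros x k Hx Hk; pose proof (Rmin_l d d'); pose proof (Rmin_r d d').
      destruct (Nat.eq_dec k (S N)) as [->|]; [apply HQ; lra|apply IH; [lra|lia]].
Qed.

Lemma half_pow_small (B e : R) : 0 < e -> exists N, (/ 2) ^ S N * B < e.
Proof.
  intros He; destruct (pow_lt_1_zero (/ 2)) with (y := e / (Rabs B + 1)) as [N HN].
  - rewrite Rabs_pos_eq; lra.
  - apply Rdiv_lt_0_compat; auto; pose proof (Rabs_pos B); lra.
  - exists N; specialize (HN (S N) (Nat.le_succ_diag_r N)).
    rewrite Rabs_pos_eq in HN by (left; apply half_pow_pos).
    pose proof (half_pow_pos (S N)); pose proof (Rabs_pos B); pose proof (Rle_abs B).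
    apply Rmult_lt_compat_r with (r := Rabs B + 1) in HN; [|lra].
    unfold Rdiv in HN; rewrite Rmult_assoc, Rinv_l in HN by lra. nra.
Qed.

Lemma lo_left_limit (al t e : R) : 0 < e ->
  exists d, 0 < d /\ forall x, 0 <= x < d -> lo al t - lo al (t - x) < e.
Proof.
  intros He; destruct (half_pow_small ((Rabs t + 1 + 2) + (Rabs t + 1 + 2)) e He) as [N HN].
  destruct (uniform_delta (fun k x => cel (t - orbit_pt al k) = cel (t - x - orbit_pt al k)) N)
    as [d [Hd H]].
  - intros k; destruct (cel_IZR (t - orbit_pt al k)) as [m Hm].
    pose proof (cel_bounds (t - orbit_pt al k)); rewrite Hm in *.
    exists (t - orbit_pt al k - (IZR m - 1)); split; [lra|].
    intros x Hx; symmetry; apply cel_eq; lra.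
  - exists d; split; [lra|]; intros x Hx; apply Rle_lt_trans with (2 := HN).
    apply wsum_close; auto; apply cel_term_bound; [lra|].
    apply Rle_trans with (1 := Rabs_triang t (- x)); rewrite Rabs_Ropp.
    rewrite (Rabs_pos_eq x); lra.
Qed.

Lemma lo_right_limit (al t e : R) : 0 < e ->
  exists d, 0 < d /\ forall x, 0 < x < d -> lo al (t + x) - hi al t < e.
Proof.
  intros He; destruct (half_pow_small ((Rabs t + 1 + 2) + (Rabs t + 1 + 2)) e He) as [N HN].
  destruct (uniform_delta (fun k x => 0 < x ->
     cel (t + x - orbit_pt al k) = flr (t - orbit_pt al k)) N) as [d [Hd H]].
  - intros k; pose proof (flr_bounds (t - orbit_pt al k)).
    exists (flr (t - orbit_pt al k) - (t - orbit_pt al k)); split; [lra|].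
    intros x Hx Hx0; unfold flr in *; apply cel_eq; lra.
  - exists d; split; [lra|]; intros x Hx; apply Rle_lt_trans with (2 := HN).
    apply wsum_close; [| |intros; apply H; auto; lra].
    + apply cel_term_bound. apply Rle_trans with (1 := Rabs_triang t x).
      rewrite (Rabs_pos_eq x); lra.
    + apply flr_term_bound; lra.
Qed.

(** At the supremum l of the t with lo t <= x, left continuity of [lo] gives lo l <= x, and its
    right limit hi l cannot be below x. *)
Lemma lo_hi_cover (al x : R) : irrational al -> exists t, lo al t <= x <= hi al t.
Proof.
  intros Hal.
  assert (Hmono : forall t u, t <= u -> lo al t <= lo al u).
  { intros t u [H| ->]; [|lra]; pose proof (hi_lt_lo al t u Hal H).
    pose proof (lo_le_hi al t); lra. }
  destruct (completeness (fun t => lo al t <= x)) as [l [Hub Hl]].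
  - exists (x + 1); intros t Ht; pose proof (lo_bounds al t); lra.
  - exists (x - 1); pose proof (lo_bounds al (x - 1)); lra.
  - exists l; split; apply Rnot_lt_le; intros Hlt.
    + destruct (lo_left_limit al l (lo al l - x)) as [d [Hd H]]; [lra|].
      assert (l <= l - d / 2); [|lra].
      apply Hl; intros t Ht; apply Rnot_lt_le; intros Hlt'.
      specialize (H (d / 2)); specialize (Hmono (l - d / 2) t); lra.
    + destruct (lo_right_limit al l (x - hi al l)) as [d [Hd H]]; [lra|].
      assert (l + d / 2 <= l); [|lra].
      apply Hub; specialize (H (d / 2)); lra.
Qed.

(** * The collapsing map and the action of Z *)

(** The monotone map that collapses each interval [lo t, hi t] to t: a lift of the semiconjugacy
    from the Denjoy map to the rotation. Disjointness of the intervals makes the chosen value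
    unique. *)
Definition pos (al x : R) : R :=
  epsilon (inhabits 0) (fun t => lo al t <= x <= hi al t).

Lemma pos_spec (al x t : R) : irrational al -> pos al x = t <-> lo al t <= x <= hi al t.
Proof.
  intros Hal; assert (H : lo al (pos al x) <= x <= hi al (pos al x)).
  { apply (epsilon_spec (inhabits 0) (fun t => lo al t <= x <= hi al t)).
    apply lo_hi_cover; auto. }
  split; [intros <-; auto|intros Ht].
  destruct (Rtotal_order (pos al x) t) as [L|[|L]]; auto;
    apply (hi_lt_lo al) in L; auto; lra.
Qed.

Lemma pos_bounds (al x : R) : irrational al -> lo al (pos al x) <= x <= hi al (pos al x).
Proof. intros H; apply pos_spec; auto. Qed.

Lemma pos_mono (al x y : R) : irrational al -> x <= y -> pos al x <= pos al y.
Proof.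
  intros Hal H; apply Rnot_lt_le; intros L; apply (hi_lt_lo al) in L; auto.
  pose proof (pos_bounds al x Hal); pose proof (pos_bounds al y Hal); lra.
Qed.

Lemma pos_add_IZR (al x : R) (m : Z) : irrational al -> pos al (x + IZR m) = pos al x + IZR m.
Proof.
  intros Hal; apply pos_spec; auto; rewrite lo_add_IZR, hi_add_IZR.
  pose proof (pos_bounds al x Hal); lra.
Qed.

Lemma pos_dist (al x : R) : irrational al -> Rabs (pos al x - x) <= 2.
Proof.
  intros Hal; pose proof (pos_bounds al x Hal); pose proof (lo_bounds al (pos al x)).
  pose proof (lo_bounds al (pos al x + 1)).
  assert (hi al (pos al x) < lo al (pos al x + 1)) by (apply hi_lt_lo; auto; lra).
  apply Rabs_le_between; lra.
Qed.

(* Maps the gap over [t] affinely onto the gap over [t + n al]; where the gap is a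
   single point, the quotient is a division by 0 multiplied by 0. *)
Definition shift (al : R) (n : Z) (x : R) : R :=
  let t := pos al x in let u := t + IZR n * al in
  lo al u + (x - lo al t) * ((hi al u - lo al u) / (hi al t - lo al t)).

Definition cantor (al x : R) : Prop := forall t, ~ (lo al t < x < hi al t).

(** The orbit is invariant under adding n al, so source and target gap are degenerate together. This
    isolates the division by 0 in [shift]. *)
Lemma shift_cases (al : R) (n : Z) (x : R) : irrational al ->
  let t := pos al x in let u := t + IZR n * al in
  (x = lo al t /\ hi al t = lo al t /\ hi al u = lo al u /\ shift al n x = lo al u) \/
  (lo al t < hi al t /\ lo al u < hi al u).
Proof.
  intros Hal t u; pose proof (lo_le_hi al t) as [L|E].
  - right; split; auto; rewrite lo_lt_hi in *.
    unfold u; rewrite <- (orbit_shift al t n 0), Rplus_0_r in L; auto.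
  - left; pose proof (pos_bounds al x Hal) as Hx; fold t in Hx.
    assert (hi al u = lo al u).
    { pose proof (lo_le_hi al u) as [L|]; auto; rewrite lo_lt_hi in L.
      unfold u in L; rewrite <- (Rplus_0_r (t + _)) in L.
      change 0 with (IZR 0) in L; rewrite orbit_shift, <- lo_lt_hi in L; lra. }
    assert (x = lo al t) by lra.
    repeat split; auto; unfold shift; fold t; fold u; rewrite <- H0; ring.
Qed.

Lemma pos_shift (al : R) (n : Z) (x : R) : irrational al ->
  pos al (shift al n x) = pos al x + IZR n * al.
Proof.
  intros Hal; apply pos_spec; auto.
  destruct (shift_cases al n x Hal) as [(_ & _ & H & ->)|[H1 H2]]; [lra|].
  pose proof (pos_bounds al x Hal); unfold shift.
  set (t := pos al x) in *; set (u := t + IZR n * al) in *.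
  assert (E : (x - lo al t) * ((hi al u - lo al u) / (hi al t - lo al t)) =
    (x - lo al t) / (hi al t - lo al t) * (hi al u - lo al u)) by (field; lra).
  assert (0 <= (x - lo al t) / (hi al t - lo al t)) by (apply Rcomplements.Rdiv_le_0_compat; lra).
  assert ((x - lo al t) / (hi al t - lo al t) <= 1).
  { apply Rcomplements.Rle_div_l; lra. }
  rewrite E; nra.
Qed.

(** Affine maps between intervals compose to affine maps. The inverse of [shift al n] is therefore
    [shift al (- n)], and the suspension closes up exactly. *)
Lemma shift_shift (al : R) (n m : Z) (x : R) : irrational al ->
  shift al n (shift al m x) = shift al (n + m) x.
Proof.
  intros Hal; pose proof (pos_shift al m x Hal) as Hp.
  unfold shift at 1; rewrite Hp.
  destruct (shift_cases al m x Hal) as [(H1 & H2 & H3 & ->)|[H1 H2]].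
  - unfold shift; rewrite plus_IZR.
    replace (pos al x + (IZR n + IZR m) * al) with (pos al x + IZR m * al + IZR n * al) by ring.
    rewrite <- H1; ring.
  - unfold shift; rewrite plus_IZR.
    replace (pos al x + (IZR n + IZR m) * al) with (pos al x + IZR m * al + IZR n * al) by ring.
    field; lra.
Qed.

Lemma shift_0 (al x : R) : irrational al -> shift al 0 x = x.
Proof.
  intros Hal; destruct (shift_cases al 0 x Hal) as [(H1 & H2 & H3 & ->)|[H1 H2]].
  - rewrite Rmult_0_l, Rplus_0_r; auto.
  - unfold shift; rewrite Rmult_0_l, Rplus_0_r; field; lra.
Qed.

Lemma shift_incr (al : R) (n : Z) (x y : R) : irrational al -> x < y ->
  shift al n x < shift al n y.
Proof.
  intros Hal Hxy; pose proof (pos_mono al x y Hal (Rlt_le _ _ Hxy)) as [L|E].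
  - pose proof (pos_bounds al (shift al n x) Hal) as Hx.
    pose proof (pos_bounds al (shift al n y) Hal) as Hy.
    rewrite pos_shift in Hx, Hy by auto.
    assert (hi al (pos al x + IZR n * al) < lo al (pos al y + IZR n * al)); [|lra].
    apply hi_lt_lo; auto; lra.
  - pose proof (pos_bounds al x Hal); pose proof (pos_bounds al y Hal).
    destruct (shift_cases al n x Hal) as [(H1 & H2 & _)|[H1 H2]]; [rewrite <- E in *; lra|].
    unfold shift; rewrite <- E; apply Rplus_lt_compat_l, Rmult_lt_compat_r; [|lra].
    apply Rdiv_lt_0_compat; lra.
Qed.

Lemma shift_add_IZR (al : R) (n : Z) (x : R) (m : Z) : irrational al ->
  shift al n (x + IZR m) = shift al n x + IZR m.
Proof.
  intros Hal; unfold shift; rewrite pos_add_IZR by auto.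
  replace (pos al x + IZR m + IZR n * al) with (pos al x + IZR n * al + IZR m) by ring.
  rewrite !lo_add_IZR, !hi_add_IZR.
  set (t := pos al x); set (u := t + IZR n * al).
  replace (hi al u + IZR m - (lo al u + IZR m)) with (hi al u - lo al u) by ring.
  replace (hi al t + IZR m - (lo al t + IZR m)) with (hi al t - lo al t) by ring. ring.
Qed.

Lemma shift_gap (al : R) (n : Z) (x t : R) : irrational al -> lo al t < x < hi al t ->
  lo al (t + IZR n * al) < shift al n x < hi al (t + IZR n * al).
Proof.
  intros Hal Hx; assert (E : pos al x = t) by (apply pos_spec; auto; lra).
  destruct (shift_cases al n x Hal) as [(H1 & H2 & _)|[H1 H2]]; rewrite E in *; [lra|].
  unfold shift; rewrite E; set (u := t + IZR n * al) in *.
  replace ((x - lo al t) * ((hi al u - lo al u) / (hi al t - lo al t))) with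
    ((x - lo al t) / (hi al t - lo al t) * (hi al u - lo al u)) by (field; lra).
  assert (0 < (x - lo al t) / (hi al t - lo al t)) by (apply Rdiv_lt_0_compat; lra).
  assert ((x - lo al t) / (hi al t - lo al t) < 1) by (apply Rcomplements.Rlt_div_l; lra).
  nra.
Qed.

Lemma cantor_shift (al : R) (n : Z) (x : R) : irrational al ->
  cantor al (shift al n x) <-> cantor al x.
Proof.
  intros Hal.
  assert (H : forall n x, cantor al (shift al n x) -> cantor al x).
  { intros k y H t Ht; apply (H (t + IZR k * al)), shift_gap; auto. }
  split; [apply H|]; intros Hx; apply (H (- n)%Z).
  rewrite shift_shift, Z.add_opp_diag_l, shift_0; auto.
Qed.

Lemma cantor_lo (al t : R) : irrational al -> cantor al (lo al t).
Proof.
  intros Hal u [H1 H2]; pose proof (lo_le_hi al t).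
  destruct (Rtotal_order t u) as [L|[->|L]]; [| lra|]; apply (hi_lt_lo al) in L; auto; lra.
Qed.

Lemma cantor_add_IZR (al x : R) (m : Z) : cantor al (x + IZR m) <-> cantor al x.
Proof.
  split; intros H t Ht.
  - apply (H (t + IZR m)); rewrite lo_add_IZR, hi_add_IZR; lra.
  - apply (H (t + IZR (- m))); rewrite lo_add_IZR, hi_add_IZR, opp_IZR; lra.
Qed.

Lemma cantor_compl (al x : R) : ~ cantor al x -> exists t, lo al t < x < hi al t.
Proof. intros H; apply NNPP; intros Hn; apply H; intros t Ht; apply Hn; exists t; auto. Qed.

Lemma cantor_closed (al x : R) : ~ cantor al x ->
  exists d, 0 < d /\ forall y, Rabs (y - x) < d -> ~ cantor al y.
Proof.
  intros H; destruct (cantor_compl al x H) as [t Ht].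
  exists (Rmin (x - lo al t) (hi al t - x)); split; [apply Rmin_pos; lra|].
  intros y Hy Hc; apply (Hc t); apply Rabs_def2 in Hy.
  pose proof (Rmin_l (x - lo al t) (hi al t - x)).
  pose proof (Rmin_r (x - lo al t) (hi al t - x)); lra.
Qed.

Lemma cantor_nowhere_dense (al x y : R) : irrational al -> x < y ->
  exists z, x < z < y /\ ~ cantor al z.
Proof.
  intros Hal Hxy; pose proof (pos_bounds al x Hal); pose proof (pos_bounds al y Hal).
  pose proof (pos_mono al x y Hal (Rlt_le _ _ Hxy)) as [L|E].
  - destruct (irrational_dense al _ _ Hal L) as [n [m Hnm]].
    set (t := IZR n * al + IZR m) in *.
    assert (Ho : orbit al t) by (exists n, m; auto); apply lo_lt_hi in Ho.
    assert (hi al (pos al x) < lo al t) by (apply hi_lt_lo; auto; lra).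
    assert (hi al t < lo al (pos al y)) by (apply hi_lt_lo; auto; lra).
    exists ((lo al t + hi al t) / 2); split; [lra|]; intros Hc; apply (Hc t); lra.
  - exists ((x + y) / 2); split; [lra|]; intros Hc; apply (Hc (pos al x)); rewrite <- E in *; lra.
Qed.

(** [pos] takes different values at x - e and x + e, since otherwise x would be interior to a gap.
    By monotonicity, a point with value strictly between these two lies within e of x. The center c
    is their midpoint and not [pos al x]: if x is an endpoint of a gap, every interval around
    [pos al x] has the whole gap in its preimage. *)
Lemma cantor_fiber (al x e : R) : irrational al -> cantor al x -> 0 < e ->
  exists c d, 0 < d /\ forall z, Rabs (pos al z - c) < d -> Rabs (z - x) < e.
Proof.
  intros Hal Hx He.
  assert (L : pos al (x - e) < pos al (x + e)).
  { destruct (pos_mono al (x - e) (x + e) Hal) as [|E]; [lra|auto|exfalso].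
    pose proof (pos_bounds al (x - e) Hal); pose proof (pos_bounds al (x + e) Hal).
    apply (Hx (pos al (x - e))); rewrite <- E in *; lra. }
  exists ((pos al (x - e) + pos al (x + e)) / 2), ((pos al (x + e) - pos al (x - e)) / 2).
  split; [lra|]; intros z Hz; apply Rabs_def2 in Hz; apply Rabs_def1; apply Rnot_le_lt; intros Hn.
  - pose proof (pos_mono al (x + e) z Hal); lra.
  - pose proof (pos_mono al z (x - e) Hal); lra.
Qed.

(** The source of continuity for the Denjoy map: monotonicity of both inverse bijections, with no
    estimate on gaps. *)
Lemma increasing_continuous (f g : R -> R) (x : R) :
  (forall x y, x < y -> f x < f y) -> (forall x y, x < y -> g x < g y) ->
  (forall x, f (g x) = x) -> (forall x, g (f x) = x) -> continuous f x.
Proof.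
  intros Hf Hg Hfg Hgf; apply continuous_R; intros e He.
  assert (H1 : g (f x - e) < x) by (rewrite <- (Hgf x) at 2; apply Hg; lra).
  assert (H2 : x < g (f x + e)) by (rewrite <- (Hgf x) at 1; apply Hg; lra).
  exists (Rmin (x - g (f x - e)) (g (f x + e) - x)); split; [apply Rmin_pos; lra|].
  intros s Hs; apply Rabs_def2 in Hs.
  pose proof (Rmin_l (x - g (f x - e)) (g (f x + e) - x)).
  pose proof (Rmin_r (x - g (f x - e)) (g (f x + e) - x)).
  assert (f s < f x + e) by (rewrite <- (Hfg (f x + e)); apply Hf; lra).
  assert (f x - e < f s) by (rewrite <- (Hfg (f x - e)); apply Hf; lra).
  apply Rabs_def1; lra.
Qed.

Lemma shift_continuous (al : R) (n : Z) (x : R) : irrational al -> continuous (shift al n) x.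
Proof.
  intros Hal; apply (increasing_continuous _ (shift al (- n))); intros;
    try (apply shift_incr; auto); rewrite shift_shift by auto.
  - rewrite Z.add_opp_diag_r; apply shift_0; auto.
  - rewrite Z.add_opp_diag_l; apply shift_0; auto.
Qed.

(** * Families of circle homeomorphisms *)

Definition cont2 (h : R -> R -> R) : Prop :=
  forall p : R * R, continuous (fun q : R * R => h (fst q) (snd q)) p.

(** An isotopy of lifts of circle maps starting at the identity, with inverses k. The parameter runs
    over all of R because the suspension uses it as a height. *)
Record circle_family (h k : R -> R -> R) : Prop := {
  cf_cont : cont2 h;
  cf_cont_inv : cont2 k;
  cf_right : forall s x, h s (k s x) = x;
  cf_left : forall s x, k s (h s x) = x;
  cf_add : forall s x (m : Z), h s (x + IZR m) = h s x + IZR m;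
  cf_0 : forall x, h 0 x = x }.

(* [dl_fiber] is the source of minimality: a neighborhood of any point of [M] contains the
   full preimage of an interval, so it is visited by every orbit. *)
Record denjoy_like (rho : R) (f P : R -> R) (M : R -> Prop) : Prop := {
  dl_conj : forall x, P (f x) = P x + rho;
  dl_add : forall x (m : Z), P (x + IZR m) = P x + IZR m;
  dl_dist : forall x, Rabs (P x - x) <= 2;
  dl_inv : forall x, M (f x) <-> M x;
  dl_per : forall x (m : Z), M (x + IZR m) <-> M x;
  dl_ex : exists x, M x;
  dl_closed : forall x, ~ M x -> exists d, 0 < d /\ forall y, Rabs (y - x) < d -> ~ M y;
  dl_fiber : forall x e, M x -> 0 < e ->
    exists c d, 0 < d /\ forall z, Rabs (P z - c) < d -> Rabs (z - x) < e }.

(** With y = k s0 x0, the inequalities h s (y - e) < x < h s (y + e) persist for (s, x) near (s0,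
    x0), and monotonicity then traps k s x between y - e and y + e. *)
Lemma inverse_cont2 (h k : R -> R -> R) :
  (forall s x y, x < y -> h s x < h s y) -> (forall s x, h s (k s x) = x) ->
  cont2 h -> cont2 k.
Proof.
  intros Hinc Hhk Hc [s0 x0]; apply continuous_R2; intros e He; simpl.
  set (y := k s0 x0).
  assert (Hy : h s0 y = x0) by apply Hhk.
  assert (H1 : h s0 (y - e) < x0) by (rewrite <- Hy; apply Hinc; lra).
  assert (H2 : x0 < h s0 (y + e)) by (rewrite <- Hy; apply Hinc; lra).
  pose proof (proj1 (continuous_R2 _ _) (Hc (s0, y - e)) ((x0 - h s0 (y - e)) / 2)) as C1.
  pose proof (proj1 (continuous_R2 _ _) (Hc (s0, y + e)) ((h s0 (y + e) - x0) / 2)) as C2.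
  destruct C1 as [d1 [Hd1 C1]]; [lra|]; destruct C2 as [d2 [Hd2 C2]]; [lra|].
  simpl in C1, C2.
  set (m := Rmin ((x0 - h s0 (y - e)) / 2) ((h s0 (y + e) - x0) / 2)).
  assert (Hm1 : m <= (x0 - h s0 (y - e)) / 2) by apply Rmin_l.
  assert (Hm2 : m <= (h s0 (y + e) - x0) / 2) by apply Rmin_r.
  assert (Hm : 0 < m) by (apply Rmin_pos; lra).
  set (d := Rmin m (Rmin d1 d2)).
  assert (Hd : d <= m /\ d <= d1 /\ d <= d2).
  { unfold d; pose proof (Rmin_l m (Rmin d1 d2)); pose proof (Rmin_r m (Rmin d1 d2)).
    pose proof (Rmin_l d1 d2); pose proof (Rmin_r d1 d2); lra. }
  exists d; split; [unfold d; apply Rmin_pos, Rmin_pos; auto|].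
  intros [s x] Hs Hx; simpl in *.
  specialize (C1 (s, y - e)); specialize (C2 (s, y + e)); simpl in C1, C2.
  rewrite !Rminus_diag, Rabs_R0 in C1, C2.
  assert (C1' := C1 ltac:(lra) ltac:(lra)); assert (C2' := C2 ltac:(lra) ltac:(lra)).
  apply Rabs_def2 in C1', C2', Hx.
  pose proof (Hhk s x) as Hsx.
  apply Rabs_def1; apply Rnot_le_lt; intros Hn.
  - assert (h s (y + e) <= h s (k s x)); [|lra].
    destruct Hn as [Hn|Hn]; [left; apply Hinc; lra|right; f_equal; lra].
  - assert (h s (k s x) <= h s (y - e)); [|lra].
    destruct Hn as [Hn|Hn]; [left; apply Hinc; lra|right; f_equal; lra].
Qed.

(** * Interpolation between the powers of the Denjoy map *)

Definition interp (al s x : R) : R :=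
  let n := Int_part s in
  (1 - (s - IZR n)) * shift al n x + (s - IZR n) * shift al (n + 1) x.

Lemma interp_eq (al s x : R) (n : Z) : IZR n <= s <= IZR n + 1 ->
  interp al s x = (1 - (s - IZR n)) * shift al n x + (s - IZR n) * shift al (n + 1) x.
Proof.
  intros [H1 [H2|H2]]; unfold interp.
  - rewrite (Int_part_eq s n) by lra; auto.
  - rewrite (Int_part_eq s (n + 1)) by (rewrite plus_IZR; lra).
    rewrite plus_IZR, H2; ring.
Qed.

Lemma interp_IZR (al x : R) (n : Z) : interp al (IZR n) x = shift al n x.
Proof. rewrite (interp_eq al (IZR n) x n) by lra; ring. Qed.

(** The identification that closes up the suspension: at height s + n the leaf labelled x continues
    as the leaf labelled [shift al n x] at height s. *)
Lemma interp_shift (al s x : R) (n : Z) : irrational al ->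
  interp al (s + IZR n) x = interp al s (shift al n x).
Proof.
  intros Hal; pose proof (Int_part_bounds s).
  rewrite (interp_eq al s _ (Int_part s)) by lra.
  rewrite (interp_eq al (s + IZR n) x (Int_part s + n)) by (rewrite plus_IZR; lra).
  rewrite !shift_shift by auto.
  replace (Int_part s + n + 1)%Z with (Int_part s + 1 + n)%Z by lia.
  rewrite plus_IZR; ring.
Qed.

Lemma interp_incr (al s x y : R) : irrational al -> x < y -> interp al s x < interp al s y.
Proof.
  intros Hal Hxy; unfold interp; destruct (Int_part_bounds s).
  pose proof (shift_incr al (Int_part s) x y Hal Hxy).
  pose proof (shift_incr al (Int_part s + 1) x y Hal Hxy). nra.
Qed.

Lemma interp_add_IZR (al s x : R) (m : Z) : irrational al ->
  interp al s (x + IZR m) = interp al s x + IZR m.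
Proof. intros Hal; unfold interp; rewrite !shift_add_IZR by auto; ring. Qed.

(** One formula on both sides of the breakpoint s = n, so joint continuity follows without
    gluing. *)
Lemma interp_local (al s x : R) (n : Z) : IZR n - 1 <= s <= IZR n + 1 ->
  interp al s x = shift al n x + Rmax (s - IZR n) 0 * (shift al (n + 1) x - shift al n x)
    + Rmax (IZR n - s) 0 * (shift al (n - 1) x - shift al n x).
Proof.
  intros H; destruct (Rle_dec (IZR n) s).
  - rewrite (interp_eq al s x n), (Rmax_left (s - IZR n)), (Rmax_right (IZR n - s)) by lra; ring.
  - rewrite (interp_eq al s x (n - 1)) by (rewrite minus_IZR; lra).
    rewrite (Rmax_right (s - IZR n)), (Rmax_left (IZR n - s)) by lra.
    rewrite minus_IZR, Z.sub_add; ring.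
Qed.

Lemma continuous_Rmax_0 (u : R) : continuous (fun v => Rmax v 0) u.
Proof.
  apply continuous_R; intros e He; exists e; split; auto; intros v Hv.
  apply Rabs_def2 in Hv; unfold Rmax; destruct (Rle_dec v 0), (Rle_dec u 0);
    apply Rabs_def1; lra.
Qed.

Lemma interp_cont2 (al : R) : irrational al -> cont2 (interp al).
Proof.
  intros Hal [s0 x0]; destruct (Int_part_bounds s0) as [B1 B2].
  set (n := Int_part s0) in *.
  apply (continuous_ext_loc _ (fun q : R * R => shift al n (snd q) +
    Rmax (fst q - IZR n) 0 * (shift al (n + 1) (snd q) - shift al n (snd q)) +
    Rmax (IZR n - fst q) 0 * (shift al (n - 1) (snd q) - shift al n (snd q)))).
  - assert (Hd : 0 < Rmin (s0 - (IZR n - 1)) (IZR n + 1 - s0)) by (apply Rmin_pos; lra).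
    exists (mkposreal _ Hd); intros [s x] [Hs _]; simpl in *.
    apply Rabs_def2 in Hs; unfold minus, plus, opp in Hs; simpl in Hs.
    pose proof (Rmin_l (s0 - (IZR n - 1)) (IZR n + 1 - s0)).
    pose proof (Rmin_r (s0 - (IZR n - 1)) (IZR n + 1 - s0)).
    symmetry; apply interp_local; lra.
  - assert (Hs : forall m p, continuous (fun q : R * R => shift al m (snd q)) p).
    { intros m p; apply (continuous_comp snd (shift al m));
        [apply continuous_snd|apply shift_continuous; auto]. }
    assert (Hf : forall p : R * R, continuous (fun q : R * R => fst q) p)
      by (intros; apply continuous_fst).
    assert (Hm : forall m m' p, continuous (fun q : R * R =>
                 shift al m (snd q) - shift al m' (snd q)) p)
      by (intros; apply (continuous_minus (V := R_NormedModule)); apply Hs).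
    apply (continuous_plus (V := R_NormedModule));
      [apply (continuous_plus (V := R_NormedModule))|]; auto;
      apply (continuous_mult (K := R_AbsRing)); auto.
    + apply (continuous_comp (fun q : R * R => fst q - IZR n) (fun v => Rmax v 0));
        [|apply continuous_Rmax_0].
      apply (continuous_minus (V := R_NormedModule)); auto; apply continuous_const.
    + apply (continuous_comp (fun q : R * R => IZR n - fst q) (fun v => Rmax v 0));
        [|apply continuous_Rmax_0].
      apply (continuous_minus (V := R_NormedModule)); auto; apply continuous_const.
Qed.

Lemma interp_surjective (al s y : R) : irrational al -> exists x, interp al s x = y.
Proof.
  intros Hal; set (c := interp al s 0).
  destruct (Int_part_bounds (y - c)) as [H1 H2]; set (m := Int_part (y - c)) in *.
  assert (E1 : interp al s (IZR m) = c + IZR m)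
    by (rewrite <- (Rplus_0_l (IZR m)) at 1; apply interp_add_IZR; auto).
  assert (E2 : interp al s (IZR (m + 1)) = c + IZR m + 1)
    by (rewrite <- (Rplus_0_l (IZR (m + 1))), interp_add_IZR, plus_IZR by auto; fold c; ring).
  destruct (IVT_gen (interp al s) (IZR m) (IZR (m + 1)) y) as [x [_ Hx]].
  - intros x; apply continuity_pt_filterlim.
    apply (continuous_comp_2 (fun _ => s) (fun x => x) (interp al));
      [apply continuous_const|apply continuous_id|apply interp_cont2; auto].
  - rewrite E1, E2, Rmin_left, Rmax_right; lra.
  - exists x; auto.
Qed.

Definition interp_inv (al s y : R) : R := epsilon (inhabits 0) (fun x => interp al s x = y).

Lemma interp_family (al : R) : irrational al -> circle_family (interp al) (interp_inv al).
Proof.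
  intros Hal.
  assert (Hr : forall s x, interp al s (interp_inv al s x) = x).
  { intros s x; apply (epsilon_spec (inhabits 0) (fun y => interp al s y = x)).
    apply interp_surjective; auto. }
  assert (Hinc : forall s x y, x < y -> interp al s x < interp al s y)
    by (intros; apply interp_incr; auto).
  constructor; auto.
  - apply interp_cont2; auto.
  - apply (inverse_cont2 (interp al)); auto; apply interp_cont2; auto.
  - intros s x; specialize (Hr s (interp al s x)).
    destruct (Rtotal_order (interp_inv al s (interp al s x)) x) as [L|[|L]]; auto;
      apply (Hinc s) in L; lra.
  - intros; apply interp_add_IZR; auto.
  - intros x; change 0 with (IZR 0); rewrite interp_IZR; apply shift_0; auto.
Qed.

Lemma interp_denjoy (al : R) : irrational al -> denjoy_like al (interp al 1) (pos al) (cantor al).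
Proof.
  intros Hal; assert (E : forall x, interp al 1 x = shift al 1 x)
    by (intros; change 1 with (IZR 1); apply interp_IZR).
  constructor.
  - intros x; rewrite E, pos_shift, Rmult_1_l; auto.
  - intros; apply pos_add_IZR; auto.
  - intros; apply pos_dist; auto.
  - intros x; rewrite E; apply cantor_shift; auto.
  - intros; apply cantor_add_IZR.
  - exists (lo al 0); apply cantor_lo; auto.
  - intros; apply cantor_closed; auto.
  - intros; apply cantor_fiber; auto.
Qed.

Lemma translation_family (b : R) : circle_family (fun s x => x + s * b) (fun s x => x - s * b).
Proof.
  assert (Hc : forall b, cont2 (fun s x => x + s * b)).
  { intros c p; apply (continuous_plus (V := R_NormedModule)); [apply continuous_snd|].
    apply (continuous_mult (K := R_AbsRing)); [apply continuous_fst|apply continuous_const]. }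
  constructor; intros; try ring; auto.
  intros p; assert (E : forall u v : R, u + v * - b = u - v * b) by (intros; ring).
  apply (continuous_ext (fun q : R * R => snd q + fst q * (- b))); [intros q; apply E|].
  apply Hc.
Qed.

Lemma translation_denjoy (b : R) : denjoy_like b (fun x => x + 1 * b) (fun x => x) (fun _ => True).
Proof.
  constructor; intros; auto; try tauto; try ring.
  - rewrite Rminus_diag, Rabs_R0; lra.
  - exists 0; auto.
  - exists x, e; auto.
Qed.

(** * Families of torus homeomorphisms *)

Definition translate (p : Point) (m n : Z) : Point := (fst p + IZR m, snd p + IZR n).

Lemma teq_translate (x y : Point) : teq x y <-> exists m n, x = translate y m n.
Proof.
  split; intros [m [n H]]; exists m, n.
  - destruct x as [x1 x2], y as [y1 y2]; unfold translate; simpl in *; f_equal; lra.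
  - subst x; unfold translate; simpl; lra.
Qed.

Lemma translate_teq (p : Point) (m n : Z) : teq (translate p m n) p.
Proof. apply teq_translate; eauto. Qed.

Record torus_family (G K : R -> Point -> Point) : Prop := {
  tf_cont : forall p : R * Point, continuous (fun q => fst (G (fst q) (snd q))) p /\
                                  continuous (fun q => snd (G (fst q) (snd q))) p;
  tf_cont_inv : forall p : R * Point, continuous (fun q => fst (K (fst q) (snd q))) p /\
                                      continuous (fun q => snd (K (fst q) (snd q))) p;
  tf_right : forall s p, G s (K s p) = p;
  tf_left : forall s p, K s (G s p) = p;
  tf_add : forall s p m n, G s (translate p m n) = translate (G s p) m n;
  tf_0 : forall p, G 0 p = p }.

(** The interface shared by the three examples: Phi lifts a semiconjugacy to the translation by (a,
    b). [sc_dist] yields the rotation vector and [sc_fiber] the minimality of M. *)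
Record torus_semiconj (a b : R) (F Phi : Point -> Point) (M : Point -> Prop) : Prop := {
  sc_conj : forall p, Phi (F p) = (fst (Phi p) + a, snd (Phi p) + b);
  sc_add : forall p m n, Phi (translate p m n) = translate (Phi p) m n;
  sc_dist : exists B, forall p, Rabs (fst (Phi p) - fst p) <= B /\ Rabs (snd (Phi p) - snd p) <= B;
  sc_inv : forall p, M (F p) <-> M p;
  sc_per : forall p m n, M (translate p m n) <-> M p;
  sc_ex : exists p, M p;
  sc_closed : forall p, ~ M p -> exists d, 0 < d /\
    forall q, Rabs (fst q - fst p) < d -> Rabs (snd q - snd p) < d -> ~ M q;
  sc_fiber : forall p e, M p -> 0 < e -> exists c d, 0 < d /\
    forall z, Rabs (fst (Phi z) - fst c) < d -> Rabs (snd (Phi z) - snd c) < d ->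
      Rabs (fst z - fst p) < e /\ Rabs (snd z - snd p) < e }.

Lemma continuous_joint (G : R -> Point -> Point) (t : R) (x : Point) (e : R) :
  (forall p : R * Point, continuous (fun q => fst (G (fst q) (snd q))) p /\
                         continuous (fun q => snd (G (fst q) (snd q))) p) ->
  0 < e -> exists d, 0 < d /\ forall s y, Rabs (t - s) < d ->
    Rabs (fst x - fst y) < d -> Rabs (snd x - snd y) < d ->
    Rabs (fst (G t x) - fst (G s y)) < e /\ Rabs (snd (G t x) - snd (G s y)) < e.
Proof.
  intros H He; destruct (H (t, x)) as [H1 H2]; rewrite continuous_RR2 in H1, H2.
  destruct (H1 e He) as [d1 [Hd1 C1]]; destruct (H2 e He) as [d2 [Hd2 C2]].
  exists (Rmin d1 d2); split; [apply Rmin_pos; auto|].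
  intros s y Hs Hy1 Hy2; pose proof (Rmin_l d1 d2); pose proof (Rmin_r d1 d2).
  specialize (C1 (s, y)); specialize (C2 (s, y)); simpl in C1, C2.
  rewrite (Rabs_minus_sym s t), (Rabs_minus_sym (fst y)), (Rabs_minus_sym (snd y)) in C1, C2.
  split; rewrite Rabs_minus_sym; [apply C1|apply C2]; lra.
Qed.

Lemma family_homotopy (G : R -> Point -> Point) :
  (forall p : R * Point, continuous (fun q => fst (G (fst q) (snd q))) p /\
                         continuous (fun q => snd (G (fst q) (snd q))) p) ->
  (forall s p m n, G s (translate p m n) = translate (G s p) m n) ->
  cont_homotopy G.
Proof.
  intros Hc Ha t x e _ He.
  destruct (continuous_joint G t x (e / 2) Hc) as [d [Hd H]]; [lra|].
  exists d; split; auto; intros s y _ Hs Hxy.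
  apply dT_tnear, tnear_translate in Hxy; destruct Hxy as [z [Hyz [Hz1 Hz2]]].
  destruct (H s z Hs Hz1 Hz2) as [E1 E2]; apply tnear_dT.
  apply tnear_teq_r with (G s z); [apply box_tnear; auto|].
  apply teq_sym, teq_translate in Hyz; destruct Hyz as [m [n ->]].
  rewrite Ha; apply translate_teq.
Qed.

Lemma homotopy_slice (G : R -> Point -> Point) (s : R) :
  cont_homotopy G -> in01 s -> cont_map dT dT (G s).
Proof.
  intros H Hs x e He; destruct (H s x e Hs He) as [d [Hd H']].
  exists d; split; auto; intros y Hy; apply H'; auto.
  rewrite Rminus_diag, Rabs_R0; auto.
Qed.

Lemma tf_inv_add (G K : R -> Point -> Point) : torus_family G K ->
  forall s p m n, K s (translate p m n) = translate (K s p) m n.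
Proof.
  intros T s p m n; rewrite <- (tf_right _ _ T s p) at 1.
  rewrite <- (tf_add _ _ T), (tf_left _ _ T); auto.
Qed.

Lemma family_homeo (G K : R -> Point -> Point) (s : R) :
  torus_family G K -> in01 s -> is_homeo (G s).
Proof.
  intros T Hs; split.
  - apply homotopy_slice; auto; apply family_homotopy; apply T.
  - exists (K s); repeat split.
    + apply homotopy_slice; auto; apply family_homotopy; [apply T|apply (tf_inv_add G K T)].
    + intros x; rewrite (tf_left _ _ T); apply teq_refl.
    + intros x; rewrite (tf_right _ _ T); apply teq_refl.
Qed.

Lemma family_cont_E (G K : R -> Point -> Point) (s : R) :
  torus_family G K -> cont_map dE dE (G s).
Proof.
  intros T x e He.
  destruct (continuous_joint G s x (e / 2) (tf_cont _ _ T)) as [d [Hd H]]; [lra|].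
  exists d; split; auto; intros y Hy; apply dE_box in Hy; destruct Hy as [H1 H2].
  destruct (H s y) as [E1 E2]; auto; [rewrite Rminus_diag, Rabs_R0; auto|].
  apply box_dE; auto.
Qed.

(** * Rotation vectors and minimality *)

Lemma subsequence_ge (n : nat -> nat) :
  (forall k, (n k < n (S k))%nat) -> forall k, (k <= n k)%nat.
Proof. intros H; induction k; [lia|specialize (H k); lia]. Qed.

Lemma bounded_deviation_cv (u : nat -> R) (n : nat -> nat) (a C : R) :
  (forall k, (n k < n (S k))%nat) -> (forall k, Rabs (u k - INR (n k) * a) <= C) ->
  Un_cv (fun k => u k / INR (n k)) a.
Proof.
  intros Hn Hu e He.
  assert (HC : 0 <= C) by (apply Rle_trans with (2 := Hu 0%nat), Rabs_pos).
  destruct (nfloor_ex (C / e)) as [N [_ HN]]; [apply Rcomplements.Rdiv_le_0_compat; lra|].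
  exists (S N); intros k Hk; unfold Rdist.
  assert (Hnk : INR N + 1 <= INR (n k)).
  { rewrite <- S_INR; apply le_INR; pose proof (subsequence_ge n Hn k); lia. }
  pose proof (pos_INR N).
  replace (u k / INR (n k) - a) with ((u k - INR (n k) * a) / INR (n k)) by (field; lra).
  unfold Rdiv; rewrite Rabs_mult, Rabs_inv, (Rabs_pos_eq (INR _)) by lra.
  apply Rcomplements.Rlt_div_l; [lra|].
  apply Rle_lt_trans with (1 := Hu k).
  apply Rmult_lt_compat_r with (r := e) in HN; auto.
  unfold Rdiv in HN; rewrite Rmult_assoc, Rinv_l in HN by lra; nra.
Qed.

Lemma semiconj_iter (a b : R) (F Phi : Point -> Point) (M : Point -> Prop) :
  torus_semiconj a b F Phi M -> forall n p,
  Phi (Nat.iter n F p) = (fst (Phi p) + INR n * a, snd (Phi p) + INR n * b).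
Proof.
  intros S n p; induction n as [|n IH].
  - simpl; rewrite !Rmult_0_l, !Rplus_0_r; apply surjective_pairing.
  - rewrite S_INR; simpl Nat.iter; rewrite (sc_conj _ _ _ _ _ S), IH; simpl; f_equal; ring.
Qed.

(** Phi displaces each coordinate by at most B, so the n-th iterate of p stays within 2 B of p + n
    (a, b) in each coordinate; division by n removes the error along every subsequence. *)
Lemma semiconj_rotation (a b : R) (F Phi : Point -> Point) (M : Point -> Prop) :
  torus_semiconj a b F Phi M -> forall v, rot_limit F v <-> v = (a, b).
Proof.
  intros S; destruct (sc_dist _ _ _ _ _ S) as [B HB].
  assert (Hdev : forall n p,
    Rabs (fst (Nat.iter n F p) - fst p - INR n * a) <= 2 * B /\
    Rabs (snd (Nat.iter n F p) - snd p - INR n * b) <= 2 * B).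
  { intros n p; pose proof (semiconj_iter a b F Phi M S n p) as E.
    destruct (HB p) as [P1 P2]; destruct (HB (Nat.iter n F p)) as [Q1 Q2].
    rewrite E in Q1, Q2; simpl in Q1, Q2.
    apply Rabs_le_between in P1, P2, Q1, Q2; split; apply Rabs_le_between; lra. }
  assert (Hcv : forall z n, (forall k, (n k < n (Datatypes.S k))%nat) ->
    Un_cv (fun k => (fst (Nat.iter (n k) F z) - fst z) / INR (n k)) a /\
    Un_cv (fun k => (snd (Nat.iter (n k) F z) - snd z) / INR (n k)) b).
  { intros z n Hn; split; apply bounded_deviation_cv with (2 * B); auto; intros k; apply Hdev. }
  intros v; split.
  - intros [z [n [Hn [C1 C2]]]]; destruct (Hcv z n Hn) as [C1' C2'].
    rewrite (surjective_pairing v); f_equal; eapply UL_sequence; eauto.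
  - intros ->; exists origin, (fun k => k); split; [lia|]; apply (Hcv origin (fun k => k)); lia.
Qed.

Lemma family_Homeo_star (G K : R -> Point -> Point) (a b : R) Phi M :
  torus_family G K -> torus_semiconj a b (G 1) Phi M -> rat_indep a b -> Homeo_star (G 1).
Proof.
  intros T S Hab; assert (H01 : in01 1) by (unfold in01; lra).
  split; [eapply family_homeo; eauto|]; split.
  - exists G; repeat split.
    + apply family_homotopy; apply T.
    + eapply homotopy_slice; eauto; apply family_homotopy; apply T.
    + apply (family_homeo G K t T H).
    + intros x; rewrite (tf_0 _ _ T); apply teq_refl.
    + intros x; apply teq_refl.
  - exists (G 1); split.
    + split; [eapply family_cont_E; eauto|intros; apply teq_refl].
    + exists a, b; split; auto; split.
      * exists (a, b); eapply semiconj_rotation; eauto.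
      * intros v Hv; apply (semiconj_rotation _ _ _ _ _ S) in Hv; subst; apply teq_refl.
Qed.

(** Kronecker brings the translated orbit of Phi x, modulo Z^2, into the box around c from
    [sc_fiber], and everything over that box is close to y. The starting point x is arbitrary. *)
Lemma semiconj_recurrent (a b : R) (F Phi : Point -> Point) (M : Point -> Prop) :
  torus_semiconj a b F Phi M -> rat_indep a b -> forall x y e, M y -> 0 < e ->
  exists n, tnear e (Nat.iter n F x) y.
Proof.
  intros S Hab x y e Hy He.
  destruct (sc_fiber _ _ _ _ _ S y e Hy He) as [c [d [Hd H]]].
  destruct (kronecker2 a b (fst c - fst (Phi x)) (snd c - snd (Phi x)) d Hab Hd)
    as [n [p [q [H1 H2]]]].
  exists n; destruct (H (translate (Nat.iter n F x) (- p) (- q))) as [E1 E2].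
  - rewrite (sc_add _ _ _ _ _ S), (semiconj_iter a b F Phi M S); simpl; rewrite opp_IZR.
    replace (_ - fst c) with (INR n * a - (fst c - fst (Phi x)) - IZR p) by ring; auto.
  - rewrite (sc_add _ _ _ _ _ S), (semiconj_iter a b F Phi M S); simpl; rewrite opp_IZR.
    replace (_ - snd c) with (INR n * b - (snd c - snd (Phi x)) - IZR q) by ring; auto.
  - eapply tnear_teq_l; [apply box_tnear; eauto|apply translate_teq].
Qed.

Lemma semiconj_closed (a b : R) (F Phi : Point -> Point) (M : Point -> Prop) :
  torus_semiconj a b F Phi M -> closed_in dT M.
Proof.
  intros S x Hx; apply NNPP; intros Hn.
  destruct (sc_closed _ _ _ _ _ S x Hn) as [d [Hd H]].
  destruct (Hx d Hd) as [y [Hy Hxy]].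
  apply dT_tnear, tnear_translate in Hxy; destruct Hxy as [z [Hyz [Hz1 Hz2]]].
  apply (H z); rewrite ?(Rabs_minus_sym (fst z)), ?(Rabs_minus_sym (snd z)); auto.
  apply teq_sym, teq_translate in Hyz; destruct Hyz as [m [n ->]].
  apply (sc_per _ _ _ _ _ S); auto.
Qed.

Lemma family_minimal (G K : R -> Point -> Point) (a b : R) Phi M :
  torus_family G K -> torus_semiconj a b (G 1) Phi M -> rat_indep a b -> minimal_set (G 1) M.
Proof.
  intros T S Hab; repeat split.
  - apply (sc_ex _ _ _ _ _ S).
  - eapply semiconj_closed; eauto.
  - intros x Hx; apply (sc_inv _ _ _ _ _ S); auto.
  - intros y Hy; exists (K 1 y); rewrite (tf_right _ _ T); split; [|apply teq_refl].
    apply (sc_inv _ _ _ _ _ S); rewrite (tf_right _ _ T); auto.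
  - intros N HNM [x Hx] HNc [HNi _] y Hy; apply HNc; intros e He.
    destruct (semiconj_recurrent _ _ _ _ _ S Hab x y (e / 2) Hy) as [n Hn]; [lra|].
    exists (Nat.iter n (G 1) x); split.
    + clear Hn; induction n; simpl; auto.
    + apply tnear_dT, tnear_sym; auto.
Qed.

(** * Product maps and the suspension flow *)

Lemma cf_inv_add (h k : R -> R -> R) : circle_family h k ->
  forall s x (m : Z), k s (x + IZR m) = k s x + IZR m.
Proof.
  intros F s x m; rewrite <- (cf_right _ _ F s x) at 1.
  rewrite <- (cf_add _ _ F), (cf_left _ _ F); auto.
Qed.

Lemma continuous_cont2 {U : UniformSpace} (h : R -> R -> R) (f g : U -> R) (x : U) :
  cont2 h -> continuous f x -> continuous g x -> continuous (fun y => h (f y) (g y)) x.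
Proof. intros Hh Hf Hg; apply (continuous_comp_2 f g h); auto; apply Hh. Qed.

Lemma continuous_time (p : R * Point) : continuous (fun q : R * Point => fst q) p.
Proof. apply continuous_fst. Qed.

Lemma continuous_abscissa (p : R * Point) : continuous (fun q : R * Point => fst (snd q)) p.
Proof. apply (continuous_comp snd fst); [apply continuous_snd|apply continuous_fst]. Qed.

Lemma continuous_ordinate (p : R * Point) : continuous (fun q : R * Point => snd (snd q)) p.
Proof. apply (continuous_comp snd snd); [apply continuous_snd|apply continuous_snd]. Qed.

Definition prod_map (h1 h2 : R -> R -> R) (s : R) (p : Point) : Point :=
  (h1 s (fst p), h2 s (snd p)).

Lemma prod_family (h1 k1 h2 k2 : R -> R -> R) :
  circle_family h1 k1 -> circle_family h2 k2 ->
  torus_family (prod_map h1 h2) (prod_map k1 k2).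
Proof.
  intros F1 F2; constructor; unfold prod_map; simpl.
  - intros p; split; apply continuous_cont2; try apply F1; try apply F2;
      try apply continuous_time; [apply continuous_abscissa|apply continuous_ordinate].
  - intros p; split; apply continuous_cont2; try apply F1; try apply F2;
      try apply continuous_time; [apply continuous_abscissa|apply continuous_ordinate].
  - intros s [x y]; simpl; rewrite (cf_right _ _ F1), (cf_right _ _ F2); auto.
  - intros s [x y]; simpl; rewrite (cf_left _ _ F1), (cf_left _ _ F2); auto.
  - intros s [x y] m n; unfold translate; simpl.
    rewrite (cf_add _ _ F1), (cf_add _ _ F2); auto.
  - intros [x y]; simpl; rewrite (cf_0 _ _ F1), (cf_0 _ _ F2); auto.
Qed.

Lemma prod_semiconj (a b : R) (h1 h2 : R -> R -> R) (P1 P2 : R -> R) (M1 M2 : R -> Prop) :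
  denjoy_like a (h1 1) P1 M1 -> denjoy_like b (h2 1) P2 M2 ->
  torus_semiconj a b (prod_map h1 h2 1) (fun p => (P1 (fst p), P2 (snd p)))
    (fun p => M1 (fst p) /\ M2 (snd p)).
Proof.
  intros D1 D2; constructor; unfold prod_map, translate; simpl.
  - intros [x y]; simpl; rewrite (dl_conj _ _ _ _ D1), (dl_conj _ _ _ _ D2); auto.
  - intros [x y] m n; simpl; rewrite (dl_add _ _ _ _ D1), (dl_add _ _ _ _ D2); auto.
  - exists 2; intros p; split; [apply (dl_dist _ _ _ _ D1)|apply (dl_dist _ _ _ _ D2)].
  - intros p; rewrite (dl_inv _ _ _ _ D1), (dl_inv _ _ _ _ D2); tauto.
  - intros p m n; rewrite (dl_per _ _ _ _ D1), (dl_per _ _ _ _ D2); tauto.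
  - destruct (dl_ex _ _ _ _ D1) as [x Hx]; destruct (dl_ex _ _ _ _ D2) as [y Hy].
    exists (x, y); auto.
  - intros p Hp; apply not_and_or in Hp; destruct Hp as [Hp|Hp].
    + destruct (dl_closed _ _ _ _ D1 _ Hp) as [d [Hd H]]; exists d; split; auto.
      intros q H1 H2 [H3 _]; apply (H _ H1 H3).
    + destruct (dl_closed _ _ _ _ D2 _ Hp) as [d [Hd H]]; exists d; split; auto.
      intros q H1 H2 [_ H3]; apply (H _ H2 H3).
  - intros p e [H1 H2] He.
    destruct (dl_fiber _ _ _ _ D1 _ e H1 He) as [c1 [d1 [Hd1 E1]]].
    destruct (dl_fiber _ _ _ _ D2 _ e H2 He) as [c2 [d2 [Hd2 E2]]].
    exists (c1, c2), (Rmin d1 d2); split; [apply Rmin_pos; auto|]; simpl.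
    intros z Hz1 Hz2; pose proof (Rmin_l d1 d2); pose proof (Rmin_r d1 d2).
    split; [apply E1|apply E2]; lra.
Qed.

(* Suspension flow of [interp al 1]: its orbits are the curves
   [s |-> (interp al s x, s)], and [b] is the vertical speed. *)
Definition flow (al b s : R) (p : Point) : Point :=
  (interp al (snd p + s * b) (interp_inv al (snd p) (fst p)), snd p + s * b).

Lemma interp_inv_shift (al s x : R) (n : Z) : irrational al ->
  interp_inv al (s + IZR n) x = shift al (- n) (interp_inv al s x).
Proof.
  intros Hal; pose proof (interp_family al Hal) as F.
  rewrite <- (cf_left _ _ F (s + IZR n) (shift al (- n) _)).
  rewrite interp_shift, shift_shift, Z.add_opp_diag_r, shift_0, (cf_right _ _ F); auto.
Qed.

Lemma flow_family (al b : R) : irrational al ->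
  torus_family (flow al b) (fun s => flow al b (- s)).
Proof.
  intros Hal; pose proof (interp_family al Hal) as F.
  assert (Hc : forall c (p : R * Point), continuous (fun q : R * Point => snd (snd q) + fst q * c) p).
  { intros c p; apply (continuous_plus (V := R_NormedModule) (fun q : R * Point => snd (snd q))
      (fun q => fst q * c)); [apply continuous_ordinate|].
    apply (continuous_mult (K := R_AbsRing) (fun q : R * Point => fst q) (fun _ => c));
      [apply continuous_time|apply continuous_const]. }
  assert (Hc' : forall c (p : R * Point), continuous (fun q : R * Point =>
      interp al (snd (snd q) + fst q * c) (interp_inv al (snd (snd q)) (fst (snd q)))) p).
  { intros c p.
    apply (continuous_cont2 (interp al) (fun q : R * Point => snd (snd q) + fst q * c)
      (fun q => interp_inv al (snd (snd q)) (fst (snd q)))); [apply F|apply Hc|].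
    apply (continuous_cont2 (interp_inv al) (fun q : R * Point => snd (snd q))
      (fun q => fst (snd q)));
      [apply F|apply continuous_ordinate|apply continuous_abscissa]. }
  assert (Hinv : forall s p, flow al b (- s) (flow al b s p) = p).
  { intros s [x y]; unfold flow; simpl; rewrite (cf_left _ _ F).
    replace (y + s * b + - s * b) with y by ring; rewrite (cf_right _ _ F); auto. }
  constructor.
  - intros p; split; unfold flow; simpl; auto.
  - assert (E : forall u s : R, u + s * - b = u + - s * b) by (intros; ring).
    intros p; split; unfold flow; simpl.
    + apply (continuous_ext (fun q : R * Point =>
        interp al (snd (snd q) + fst q * - b) (interp_inv al (snd (snd q)) (fst (snd q)))));
        [|apply Hc'].
      intros q; rewrite E; auto.
    + apply (continuous_ext (fun q : R * Point => snd (snd q) + fst q * - b)); [|apply Hc].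
      intros q; apply E.
  - intros s p; rewrite <- (Ropp_involutive s) at 1; apply Hinv.
  - apply Hinv.
  - intros s [x y] m n; unfold flow, translate; simpl.
    (* Raising the point by n relabels its leaf by [shift al (- n)], and evaluating the leaf n
       higher applies [shift al n]; the two cancel. *)
    rewrite interp_inv_shift, (cf_inv_add _ _ F) by auto.
    replace (y + IZR n + s * b) with (y + s * b + IZR n) by ring.
    rewrite interp_shift, shift_shift, Z.add_opp_diag_r, shift_0, (cf_add _ _ F); auto.
  - intros [x y]; unfold flow; simpl; rewrite Rmult_0_l, Rplus_0_r, (cf_right _ _ F); auto.
Qed.

Lemma shift_dist (al : R) (n : Z) (x : R) : irrational al ->
  Rabs (shift al n x - x - IZR n * al) <= 4.
Proof.
  intros Hal; pose proof (pos_dist al x Hal) as H1; pose proof (pos_dist al (shift al n x) Hal) as H2.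
  rewrite pos_shift in H2 by auto.
  apply Rabs_le_between in H1, H2; apply Rabs_le_between; lra.
Qed.

Lemma interp_dist (al s x : R) : irrational al -> Rabs (interp al s x - x - s * al) <= 4.
Proof.
  intros Hal; unfold interp; destruct (Int_part_bounds s); set (n := Int_part s) in *.
  pose proof (shift_dist al n x Hal) as H1; pose proof (shift_dist al (n + 1) x Hal) as H2.
  rewrite plus_IZR in H2; apply Rabs_le_between in H1, H2.
  set (f := s - IZR n) in *.
  replace (_ - x - s * al) with ((1 - f) * (shift al n x - x - IZR n * al) +
    f * (shift al (n + 1) x - x - (IZR n + 1) * al)) by (unfold f; ring).
  assert (0 <= f <= 1) by (unfold f; lra).
  apply Rabs_le_between; nra.
Qed.

(** The leaf label is constant along the flow, so the first coordinate of Phi grows at rate al b and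
    the second at rate b. The summand [snd p * al] also compensates the drop of [pos] by n al when p
    is raised by n, so Phi commutes with Z^2. *)
Lemma flow_semiconj (al b : R) : irrational al ->
  torus_semiconj (al * b) b (flow al b 1)
    (fun p => (pos al (interp_inv al (snd p) (fst p)) + snd p * al, snd p))
    (fun p => cantor al (interp_inv al (snd p) (fst p))).
Proof.
  intros Hal; pose proof (interp_family al Hal) as F.
  constructor.
  - intros [x y]; unfold flow; simpl; rewrite (cf_left _ _ F); f_equal; ring.
  - intros [x y] m n; unfold translate; simpl.
    rewrite interp_inv_shift, (cf_inv_add _ _ F), pos_shift, pos_add_IZR by auto.
    rewrite opp_IZR; f_equal; ring.
  - exists 6; intros [x y]; simpl.
    pose proof (interp_dist al y (interp_inv al y x) Hal) as H1.
    rewrite (cf_right _ _ F) in H1.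
    pose proof (pos_dist al (interp_inv al y x) Hal) as H2.
    apply Rabs_le_between in H1, H2; rewrite Rminus_diag, Rabs_R0.
    split; [apply Rabs_le_between; lra|lra].
  - intros [x y]; unfold flow; simpl; rewrite (cf_left _ _ F); tauto.
  - intros [x y] m n; unfold translate; simpl.
    rewrite interp_inv_shift, (cf_inv_add _ _ F), cantor_shift, cantor_add_IZR; tauto.
  - exists (interp al 0 (lo al 0), 0); simpl; rewrite (cf_left _ _ F); apply cantor_lo; auto.
  - intros [x y] Hp; simpl in *.
    destruct (cantor_closed al _ Hp) as [e [He H]].
    pose proof (cf_cont_inv _ _ F (y, x)) as C; rewrite continuous_R2 in C; simpl in C.
    destruct (C e He) as [d [Hd Hc]]; exists d; split; auto.
    intros [x' y'] Hx Hy; simpl in *; apply H, (Hc (y', x')); auto.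
  - intros [x y] e Hp He; simpl in *; set (z0 := interp_inv al y x) in *.
    pose proof (cf_cont _ _ F (y, z0)) as C; rewrite continuous_R2 in C; simpl in C.
    destruct (C e He) as [d1 [Hd1 Hc]]; unfold z0 in Hc; rewrite (cf_right _ _ F) in Hc; fold z0 in Hc.
    set (d := Rmin d1 e).
    assert (Hd : 0 < d /\ d <= d1 /\ d <= e).
    { unfold d; split; [apply Rmin_pos; auto|split; [apply Rmin_l|apply Rmin_r]]. }
    destruct (cantor_fiber al z0 d Hal Hp) as [c [r [Hr Hf]]]; [lra|].
    pose proof (Rabs_pos al).
    (* The first coordinate of Phi mixes the label with the height times al. Dividing r by 1 + |al|
       absorbs the change of height. *)
    assert (Hr' : 0 < r / (1 + Rabs al)) by (apply Rdiv_lt_0_compat; lra).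
    exists (c + y * al, y), (Rmin d (r / (1 + Rabs al))); simpl.
    split; [apply Rmin_pos; lra|]; intros [x' y'] H1 H2; simpl in *.
    set (z := interp_inv al y' x') in *.
    set (m := Rmin d (r / (1 + Rabs al))) in *.
    assert (Hm1 : m <= d) by apply Rmin_l.
    assert (Hm2 : m * (1 + Rabs al) <= r).
    { apply Rle_trans with (r / (1 + Rabs al) * (1 + Rabs al)).
      - apply Rmult_le_compat_r; [lra|apply Rmin_r].
      - right; field; lra. }
    assert (Hz : Rabs (z - z0) < d).
    { apply Hf; replace (pos al z - c) with ((pos al z + y' * al - (c + y * al)) - (y' - y) * al)
        by ring.
      apply Rle_lt_trans with (1 := Rabs_triang _ _).
      rewrite Rabs_Ropp, Rabs_mult.
      assert (Rabs (y' - y) * Rabs al <= m * Rabs al) by (apply Rmult_le_compat_r; lra); lra. }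
    split; [|lra].
    specialize (Hc (y', z)); simpl in Hc; unfold z in Hc; rewrite (cf_right _ _ F) in Hc.
    fold z in Hc; apply Hc; lra.
Qed.

(** * The product of two Denjoy maps *)

(** Common form of [fst] and [snd] as nonexpanding maps to the circle, so that one separation
    argument covers both. *)
Definition coordinate (c : Point -> R) : Prop :=
  forall e x y, tnear e x y -> exists m : Z, Rabs (c x - c y - IZR m) < e.

Lemma coordinate_fst : coordinate fst.
Proof. intros e x y [m [n [H _]]]; eauto. Qed.

Lemma coordinate_snd : coordinate snd.
Proof. intros e x y [m [n [_ H]]]; eauto. Qed.

Definition band (c : Point -> R) (l r : R) (p : Point) : Prop :=
  exists m : Z, l < c p - IZR m < r.

Lemma band_open (c : Point -> R) (l r : R) : coordinate c -> open_in dT (band c l r).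
Proof.
  intros Hc x [m Hm]; exists (Rmin (c x - IZR m - l) (r - (c x - IZR m))).
  split; [apply Rmin_pos; lra|]; intros y Hy.
  pose proof (Rmin_l (c x - IZR m - l) (r - (c x - IZR m))).
  pose proof (Rmin_r (c x - IZR m - l) (r - (c x - IZR m))).
  apply dT_tnear, Hc in Hy; destruct Hy as [k Hk]; apply Rabs_def2 in Hk.
  exists (m - k)%Z; rewrite minus_IZR; lra.
Qed.

(** If c x and c y were different on the circle, each of the two arcs between them would contain a
    point of a gap. These two points g and h cut the circle into two open arcs whose bands separate
    x from y in S. *)
Lemma cantor_band_separated (al : R) (c : Point -> R) (S : Point -> Prop) (x y : Point) :
  irrational al -> coordinate c -> (forall p, S p -> cantor al (c p)) ->
  connected_in dT S -> S x -> S y -> exists m : Z, c x - c y = IZR m.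
Proof.
  intros Hal Hc HS Hconn Sx Sy; apply NNPP; intros Hn; apply Hconn.
  set (i := Int_part (c y - c x)); set (r := c y - c x - IZR i).
  destruct (Int_part_bounds (c y - c x)) as [Hi1 Hi2]; fold i in Hi1, Hi2.
  assert (Hr : 0 < r < 1).
  { unfold r; split; [|lra]; destruct Hi1 as [|E]; [lra|].
    exfalso; apply Hn; exists (- i)%Z; rewrite opp_IZR; lra. }
  destruct (cantor_nowhere_dense al (c x) (c x + r) Hal) as [g [Hg Hg']]; [lra|].
  destruct (cantor_nowhere_dense al (c x + r) (c x + 1) Hal) as [h [Hh Hh']]; [lra|].
  exists (band c (h - 1) g), (band c g h); repeat split; try (apply band_open; auto).
  - intros p Hp; destruct (Int_part_bounds (c p - (h - 1))) as [J1 J2].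
    set (j := Int_part (c p - (h - 1))) in *.
    assert (Hcp : cantor al (c p - IZR j)).
    { unfold Rminus; rewrite <- opp_IZR; apply cantor_add_IZR; auto. }
    destruct J1 as [J1|J1].
    + destruct (Rtotal_order (c p - IZR j) g) as [L|[E|L]].
      * left; exists j; lra.
      * rewrite E in Hcp; tauto.
      * right; exists j; lra.
    + exfalso; apply Hh'; replace h with (c p - IZR j + IZR 1) by (simpl; lra).
      apply cantor_add_IZR; auto.
  - exists x; split; auto; exists 0%Z; lra.
  - exists y; split; auto; exists i; unfold r in *; lra.
  - intros p _ [m Hm] [k Hk].
    assert (m < k + 1)%Z by (apply lt_IZR; rewrite plus_IZR; lra).
    assert (k < m + 1)%Z by (apply lt_IZR; rewrite plus_IZR; lra).
    assert (m = k) by lia; subst; lra.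
Qed.

Definition prod_cantor (a b : R) (p : Point) : Prop := cantor a (fst p) /\ cantor b (snd p).

Lemma prod_cantor_disconnected (a b : R) (S : Point -> Prop) (x y : Point) :
  irrational a -> irrational b -> (forall p, S p -> prod_cantor a b p) ->
  connected_in dT S -> S x -> S y -> teq x y.
Proof.
  intros Ha Hb HS Hc Sx Sy.
  destruct (cantor_band_separated a fst S x y) as [m Hm]; auto using coordinate_fst.
  { intros p Hp; apply HS; auto. }
  destruct (cantor_band_separated b snd S x y) as [n Hn]; auto using coordinate_snd.
  { intros p Hp; apply HS; auto. }
  exists m, n; auto.
Qed.

(** * Points as acyclic continua *)

Lemma joined_sym (S : Point -> Prop) (x y : Point) :
  S x -> S y -> joined S x y -> joined S y x.
Proof.
  intros Sx Sy H U V HU HV Hc Hd Uy; destruct (Hc x Sx) as [|Vx]; auto.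
  exfalso; apply (Hd y Sy Uy), (H V U); auto.
  - intros z Hz; destruct (Hc z Hz); auto.
  - intros z Hz H1 H2; apply (Hd z); auto.
Qed.

Lemma joined_horizontal (S : Point -> Prop) (x y v : R) :
  (forall u, S (u, v)) -> joined S (x, v) (y, v).
Proof.
  intros H; apply joined_segment; intros t _; simpl.
  rewrite Rminus_diag, Rmult_0_r, Rplus_0_r; auto.
Qed.

Lemma joined_vertical (S : Point -> Prop) (u x y : R) :
  (forall v, S (u, v)) -> joined S (u, x) (u, y).
Proof.
  intros H; apply joined_segment; intros t _; simpl.
  rewrite Rminus_diag, Rmult_0_r, Rplus_0_r; auto.
Qed.

Lemma half_not_IZR (m : Z) : / 2 <> IZR m.
Proof.
  intros E; assert (0 < m < 1)%Z; [|lia]; split; apply lt_IZR; lra.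
Qed.

(** The vertical line at c1 and the horizontal line at c2, half a unit away from x, avoid L. A point
    p outside L reaches this cross along its own vertical line, or along its horizontal line when
    the vertical one meets L. *)
Lemma point_compl_connected (L : Point -> Prop) (x : Point) :
  (forall z, L z <-> teq z x) -> connected_in dT (compl L).
Proof.
  intros HL; unfold compl; set (S := fun z => ~ L z).
  assert (Hv : forall u, (forall m, u - fst x <> IZR m) -> forall v, S (u, v)).
  { intros u Hu v Hn; apply HL in Hn; destruct Hn as [m [n [E _]]]; apply (Hu m E). }
  assert (Hh : forall v, (forall m, v - snd x <> IZR m) -> forall u, S (u, v)).
  { intros v Hu u Hn; apply HL in Hn; destruct Hn as [m [n [_ E]]]; apply (Hu n E). }
  set (c1 := fst x + / 2); set (c2 := snd x + / 2).
  assert (H1 : forall v, S (c1, v)).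
  { apply Hv; intros m E; apply (half_not_IZR m); unfold c1 in E; lra. }
  assert (H2 : forall u, S (u, c2)).
  { apply Hh; intros m E; apply (half_not_IZR m); unfold c2 in E; lra. }
  assert (Hj : forall p, S p -> joined S p (c1, c2)).
  { intros [u v] Hp.
    destruct (classic (forall m, u - fst x <> IZR m)) as [Hu|Hu].
    - apply joined_trans with (u, c2); [apply joined_vertical, Hv, Hu|].
      apply joined_horizontal, H2.
    - apply joined_trans with (c1, v); [apply joined_horizontal, Hh|apply joined_vertical, H1].
      intros n E; apply Hp, HL; apply not_all_ex_not in Hu; destruct Hu as [m Hm].
      apply NNPP in Hm; exists m, n; auto. }
  apply joined_connected; intros p q Hp Hq.
  apply joined_trans with (c1, c2); [auto|apply joined_sym; auto].
Qed.

Lemma class_connected (L : Point -> Prop) (x : Point) :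
  (forall z, L z <-> teq z x) -> connected_in dT L.
Proof.
  intros HL; apply joined_connected; intros p q Hp Hq; apply joined_teq.
  apply HL in Hp, Hq; eapply teq_trans; [eauto|apply teq_sym; auto].
Qed.

Lemma class_closed (L : Point -> Prop) (x : Point) :
  (forall z, L z <-> teq z x) -> closed_in dT L.
Proof.
  intros HL z Hz; apply HL.
  assert (H : forall e, 0 < e -> cdist (fst z - fst x) < e /\ cdist (snd z - snd x) < e).
  { intros e He; destruct (Hz e He) as [y [Hy Hd]]; apply HL in Hy.
    apply dT_tnear in Hd; apply (tnear_teq_r _ _ _ _ Hd) in Hy.
    destruct Hy as [m [n [E1 E2]]].
    pose proof (cdist_le (fst z - fst x) m); pose proof (cdist_le (snd z - snd x) n); lra. }
  assert (H0 : forall a, (forall e, 0 < e -> cdist a < e) -> exists m, a = IZR m).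
  { intros a Ha; destruct (cdist_attained a) as [m Hm]; exists m.
    destruct (Req_dec a (IZR m)) as [|Hn]; auto; exfalso.
    specialize (Ha (cdist a)); rewrite <- Hm in Ha.
    assert (0 < Rabs (a - IZR m)) by (apply Rabs_pos_lt; lra); lra. }
  destruct (H0 (fst z - fst x)) as [m Hm]; [apply H|].
  destruct (H0 (snd z - snd x)) as [n Hn]; [apply H|].
  exists m, n; auto.
Qed.

Lemma IZR_small (m : Z) : Rabs (IZR m) < 1 -> m = 0%Z.
Proof. intros H; apply Rabs_def2 in H; assert (-1 < m < 1)%Z; [split; apply lt_IZR; lra|lia]. Qed.

(** In the plane L is a translate of the lattice Z^2. The square of half-side 1/2 about x isolates x
    from the other lattice points, so {x} is a component. *)
Lemma class_bounded (L : Point -> Prop) (x : Point) :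
  (forall z, L z <-> teq z x) -> bounded_T L.
Proof.
  intros HL; exists (fun z => z = x); split; [|exists (dE origin x); intros z ->; lra].
  split; [exists x; auto|split; [|split]].
  - intros z ->; apply HL, teq_refl.
  - intros [U [V [_ [_ [_ [[p [-> Up]] [[q [-> Vq]] Hd]]]]]]]; apply (Hd x); auto.
  - intros D HD Hconn [w [Dw ->]] z Dz; apply NNPP; intros Hzx; apply Hconn.
    exists (fun p => Rabs (fst p - fst x) < / 2 /\ Rabs (snd p - snd x) < / 2),
           (fun p => / 2 < Rabs (fst p - fst x) \/ / 2 < Rabs (snd p - snd x)).
    assert (Hoff : forall p, L p -> p <> x -> 1 <= Rabs (fst p - fst x) \/ 1 <= Rabs (snd p - snd x)).
    { intros [p1 p2] Hp Hpx; apply HL in Hp; destruct Hp as [m [n [E1 E2]]]; simpl in *.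
      rewrite E1, E2; apply NNPP; intros Hn; apply not_or_and in Hn.
      destruct Hn as [Hm' Hn']; apply Rnot_le_lt, IZR_small in Hm', Hn'; subst.
      apply Hpx; destruct x; simpl in *; f_equal; lra. }
    assert (Hlip : forall p q e, dE p q < e -> Rabs (fst q - fst x) < Rabs (fst p - fst x) + e /\
       Rabs (fst p - fst x) < Rabs (fst q - fst x) + e /\
       Rabs (snd q - snd x) < Rabs (snd p - snd x) + e /\
       Rabs (snd p - snd x) < Rabs (snd q - snd x) + e).
    { assert (Ht : forall u v w e, Rabs (u - v) < e -> Rabs (v - w) < Rabs (u - w) + e /\
                      Rabs (u - w) < Rabs (v - w) + e).
      { intros u v w0 e He.
        pose proof (Rabs_triang (v - u) (u - w0)); pose proof (Rabs_triang (u - v) (v - w0)).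
        replace (v - u + (u - w0)) with (v - w0) in H by ring.
        replace (u - v + (v - w0)) with (u - w0) in H0 by ring.
        rewrite (Rabs_minus_sym v u) in H; lra. }
      intros p q e He; apply dE_box in He; destruct He as [E1 E2].
      destruct (Ht _ _ (fst x) _ E1); destruct (Ht _ _ (snd x) _ E2); auto. }
    split; [|split; [|split; [|split; [|split]]]].
    + intros p [E1 E2].
      exists (Rmin (/ 2 - Rabs (fst p - fst x)) (/ 2 - Rabs (snd p - snd x))).
      split; [apply Rmin_pos; lra|]; intros q Hq; apply Hlip in Hq.
      pose proof (Rmin_l (/ 2 - Rabs (fst p - fst x)) (/ 2 - Rabs (snd p - snd x))).
      pose proof (Rmin_r (/ 2 - Rabs (fst p - fst x)) (/ 2 - Rabs (snd p - snd x))); lra.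
    + intros p [E|E].
      * exists (Rabs (fst p - fst x) - / 2); split; [lra|]; intros q Hq; apply Hlip in Hq; lra.
      * exists (Rabs (snd p - snd x) - / 2); split; [lra|]; intros q Hq; apply Hlip in Hq; lra.
    + intros p Dp; destruct (classic (p = x)) as [->|Hp].
      * left; rewrite !Rminus_diag, Rabs_R0; lra.
      * right; destruct (Hoff p (HD p Dp) Hp); lra.
    + exists x; split; auto; rewrite !Rminus_diag, Rabs_R0; lra.
    + exists z; split; auto; destruct (Hoff z (HD z Dz) Hzx); lra.
    + intros p _ [E1 E2] [E3|E3]; lra.
Qed.

Lemma class_is_fill (L : Point -> Prop) (x : Point) :
  (forall z, L z <-> teq z x) -> is_fill L L.
Proof.
  intros HL; split; [|split; auto].
  split; [split; [|split]|split].
  - exists x; apply HL, teq_refl.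
  - eapply class_closed; eauto.
  - eapply class_connected; eauto.
  - eapply class_bounded; eauto.
  - eapply point_compl_connected; eauto.
Qed.

Lemma class_component (M : Point -> Prop) (x : Point) :
  closed_in dT M -> M x ->
  (forall S, (forall p, S p -> M p) -> connected_in dT S -> forall p q, S p -> S q -> teq p q) ->
  component_of dT M (fun z => teq z x).
Proof.
  intros HM Hx Htd; split; [exists x; apply teq_refl|split; [|split]].
  - intros z Hz; apply (closed_teq M x z); auto using teq_sym.
  - apply class_connected with x; tauto.
  - intros D HD Hc [w [Dw Hw]] z Dz; apply teq_trans with w; auto; apply (Htd D); auto.
Qed.

Lemma component_class (M L : Point -> Prop) :
  closed_in dT M ->
  (forall S, (forall p, S p -> M p) -> connected_in dT S -> forall p q, S p -> S q -> teq p q) ->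
  component_of dT M L -> exists x, forall z, L z <-> teq z x.
Proof.
  intros HM Htd [[x Lx] [HLM [Hc Hmax]]]; exists x; intros z; split.
  - intros Lz; apply (Htd L); auto.
  - apply (Hmax (fun z => teq z x)).
    + intros p Hp; apply (closed_teq M x p); auto using teq_sym.
    + apply class_connected with x; tauto.
    + exists x; split; auto using teq_refl.
Qed.

(** The components of M are points, which are their own fills. The collapse phi can therefore be the
    identity and the factor fh can be f. *)
Lemma cantor_extension (f : Point -> Point) (M : Point -> Prop) :
  Homeo_star f -> minimal_set f M -> cantor_set M -> extension_of_cantor f M.
Proof.
  intros Hf Hmin HC; exists (fun L => L).
  destruct HC as [Hne [Hcl [Hperf Htd]]].
  assert (HK : forall y, (exists x L, component_of dT M L /\ L x /\ teq x y) <-> M y).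
  { intros y; split.
    - intros [x [L [[_ [HL _]] [Lx Hxy]]]]; apply (closed_teq M x y); auto.
    - intros Hy; exists y, (fun z => teq z y); split; [apply class_component; auto|].
      split; apply teq_refl. }
  split; [|split].
  - intros L HL; destruct (component_class M L Hcl Htd HL) as [x Hx].
    apply class_is_fill with x; auto.
  - intros L L' HL HL' Hd x Lx L'x; apply Hd.
    destruct (component_class M L Hcl Htd HL) as [u Hu].
    destruct (component_class M L' Hcl Htd HL') as [v Hv].
    assert (teq u v) by (apply teq_trans with x; [apply teq_sym, Hu, Lx|apply Hv, L'x]).
    intros z; rewrite Hu, Hv; split; intros H1; eapply teq_trans; eauto using teq_sym.
  - exists (fun x => x), f.
    assert (Hid : cont_map dT dT (fun x => x)) by (intros x e He; exists e; auto).
    split; [auto|split; [|split; [auto|split; [intros; apply teq_refl|]]]].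
    + exists (fun _ x => x); split; [|split; intros; apply teq_refl].
      intros t x e _ He; exists e; auto.
    + cbv zeta.
      replace (fun y => exists x L, component_of dT M L /\ L x /\ teq x y) with M; [split; auto|].
      * repeat split; auto.
      * apply functional_extensionality; intros y.
        apply propositional_extensionality; symmetry; apply HK.
Qed.

Lemma semiconj_perfect (a b : R) (F Phi : Point -> Point) (M : Point -> Prop) :
  torus_semiconj a b F Phi M -> rat_indep a b -> forall x, M x -> forall e, 0 < e ->
  exists y, M y /\ ~ teq x y /\ dT x y < e.
Proof.
  intros S Hab x Hx e He.
  (* Starting from F x makes the number of iterates positive. The return then cannot hit x itself on
     the torus, since Phi would turn this into an integer value of S n * a. *)
  destruct (semiconj_recurrent _ _ _ _ _ S Hab (F x) x (e / 2) Hx) as [n Hn]; [lra|].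
  rewrite <- Nat.iter_succ_r in Hn; exists (Nat.iter (Datatypes.S n) F x).
  split; [|split].
  - generalize (Datatypes.S n); intros k; induction k; simpl; auto.
    apply (sc_inv _ _ _ _ _ S); auto.
  - intros E; apply teq_translate in E; destruct E as [p [q E]].
    apply (f_equal Phi) in E; rewrite (sc_add _ _ _ _ _ S), (semiconj_iter _ _ _ _ _ S) in E.
    apply (f_equal fst) in E; unfold translate in E; unfold fst at 2 3 in E.
    destruct (Hab p (Z.of_nat (Datatypes.S n)) 0%Z) as [_ [E' _]]; [|lia].
    rewrite <- INR_IZR_INZ; lra.
  - apply tnear_dT, tnear_sym; auto.
Qed.

Lemma gap_point (al : R) : irrational al -> exists x, ~ cantor al x.
Proof.
  intros Hal; destruct (cantor_nowhere_dense al 0 1 Hal) as [z [_ Hz]]; [lra|eauto].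
Qed.

Lemma cantor_type_exists (a b : R) : rat_indep a b ->
  exists f M, Homeo_star f /\ minimal_set f M /\ (exists x, ~ M x) /\ extension_of_cantor f M.
Proof.
  intros Hab; pose proof (rat_indep_irrational_l a b Hab) as Ha.
  pose proof (rat_indep_irrational_r a b Hab) as Hb.
  pose proof (prod_family _ _ _ _ (interp_family a Ha) (interp_family b Hb)) as T.
  pose proof (prod_semiconj a b _ _ _ _ _ _ (interp_denjoy a Ha) (interp_denjoy b Hb)) as S.
  fold (prod_cantor a b) in S.
  change (fun p => cantor a (fst p) /\ cantor b (snd p)) with (prod_cantor a b) in S.
  pose proof (family_Homeo_star _ _ _ _ _ _ T S Hab) as Hs.
  pose proof (family_minimal _ _ _ _ _ _ T S Hab) as Hm.
  exists (prod_map (interp a) (interp b) 1), (prod_cantor a b).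
  split; [auto|split; [auto|split]].
  - destruct (gap_point a Ha) as [x Hx]; exists (x, 0); intros [H _]; auto.
  - apply cantor_extension; auto.
    split; [apply (sc_ex _ _ _ _ _ S)|split; [eapply semiconj_closed; eauto|split]].
    + intros x Hx e He; eapply semiconj_perfect; eauto.
    + intros U HU Hc x y; apply prod_cantor_disconnected with a b; auto.
Qed.

(** * Essential annuli *)

Lemma clopen_component (X A V : Point -> Prop) :
  (forall x, A x -> X x) -> (exists x, A x) -> connected_in dT A ->
  open_in dT A -> open_in dT V -> (forall x, X x -> A x \/ V x) ->
  (forall x, A x -> V x -> False) ->
  component_of dT X A /\
  forall C, component_of dT X C -> (exists x, C x /\ A x) -> forall x, C x <-> A x.
Proof.
  intros HAX Hne Hc HA HV Hcov Hd.
  assert (Hmax : forall D : Point -> Prop, (forall x, D x -> X x) -> connected_in dT D ->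
     (exists x, D x /\ A x) -> forall x, D x -> A x).
  { intros D HD Hconn Hm x Dx; apply NNPP; intros Hn; apply Hconn.
    exists A, V; repeat split; auto.
    - exists x; split; auto; destruct (Hcov x (HD x Dx)); tauto.
    - intros y _; apply Hd. }
  split; [repeat split; auto|].
  intros C [_ [HCX [HCc HCm]]] [z [Cz Az]] x; split.
  - apply Hmax; auto; exists z; auto.
  - apply HCm; auto; exists z; auto.
Qed.

(** * Polar coordinates and embedded annuli *)

Lemma cos_add_2PI_IZR (x : R) (m : Z) : cos (x + 2 * PI * IZR m) = cos x.
Proof.
  destruct (Z_le_gt_dec 0 m) as [H|H].
  - rewrite <- (Z2Nat.id m H), <- INR_IZR_INZ, <- (cos_period x (Z.to_nat m)); f_equal; ring.
  - rewrite <- (cos_period (x + 2 * PI * IZR m) (Z.to_nat (- m))).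
    rewrite INR_IZR_INZ, Z2Nat.id, opp_IZR by lia; f_equal; ring.
Qed.

Lemma sin_add_2PI_IZR (x : R) (m : Z) : sin (x + 2 * PI * IZR m) = sin x.
Proof.
  rewrite <- !cos_shift.
  replace (PI / 2 - (x + 2 * PI * IZR m)) with (PI / 2 - x + 2 * PI * IZR (- m))
    by (rewrite opp_IZR; ring).
  apply cos_add_2PI_IZR.
Qed.

(** Turns continuity of an inner product into continuity of the angle modulo 2 PI. *)
Lemma cos_near (e : R) : 0 < e -> exists d, 0 < d /\
  forall x, 1 - d < cos x -> exists m : Z, Rabs (x / (2 * PI) - IZR m) < e.
Proof.
  intros He; pose proof PI_RGT_0 as Hpi.
  (* The bound 1/2 keeps 2 PI e' within [0, PI], where the cosine is decreasing. *)
  set (e' := Rmin e (/ 2)).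
  assert (He' : 0 < e' /\ e' <= e /\ e' <= / 2).
  { unfold e'; split; [apply Rmin_pos; lra|split; [apply Rmin_l|apply Rmin_r]]. }
  exists (1 - cos (2 * PI * e')); split.
  { rewrite <- cos_0; apply Rlt_0_minus, cos_decreasing_1; nra. }
  intros x Hx; destruct (cdist_attained (x / (2 * PI))) as [m Hm]; exists m.
  assert (Hhalf : Rabs (x / (2 * PI) - IZR m) <= / 2).
  { rewrite Hm; unfold cdist.
    pose proof (Rmin_l (frac_part (x / (2 * PI))) (1 - frac_part (x / (2 * PI)))).
    pose proof (Rmin_r (frac_part (x / (2 * PI))) (1 - frac_part (x / (2 * PI)))); lra. }
  set (y := x / (2 * PI) - IZR m) in *.
  assert (Hcos : cos x = cos (2 * PI * Rabs y)).
  { transitivity (cos (2 * PI * y)).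
    - rewrite <- (cos_add_2PI_IZR (2 * PI * y) m); f_equal; unfold y; field; lra.
    - unfold Rabs; destruct (Rcase_abs y); auto.
      rewrite <- cos_neg; f_equal; ring. }
  apply Rlt_le_trans with e'; [|lra]; apply Rnot_le_lt; intros Hn.
  assert (cos (2 * PI * Rabs y) <= cos (2 * PI * e')); [|lra].
  destruct Hn as [Hn|Hn]; [|rewrite Hn; lra].
  left; apply cos_decreasing_1; pose proof (Rabs_pos y); nra.
Qed.

Lemma cos_eq_1 (x : R) : cos x = 1 -> exists m : Z, x = 2 * PI * IZR m.
Proof.
  intros H; pose proof PI_RGT_0; destruct (cdist_attained (x / (2 * PI))) as [m Hm]; exists m.
  assert (E : x / (2 * PI) - IZR m = 0).
  { apply NNPP; intros Hn; apply Rabs_pos_lt in Hn.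
    destruct (cos_near _ Hn) as [d [Hd Hx]]; destruct (Hx x) as [k Hk]; [lra|].
    pose proof (cdist_le (x / (2 * PI)) k); lra. }
  replace x with (x / (2 * PI) * (2 * PI)) by (field; lra).
  replace (x / (2 * PI)) with (IZR m) by lra; ring.
Qed.

Definition norm2 (u : Point) : R := sqrt (Rsqr (fst u) + Rsqr (snd u)).

Lemma dE_origin (u : Point) : dE origin u = norm2 u.
Proof. unfold dE, norm2, origin; simpl; rewrite !Rminus_0_l, <- !Rsqr_neg; auto. Qed.

Definition polar (r t : R) : Point := (r * cos t, r * sin t).

Lemma norm2_polar (r t : R) : 0 <= r -> norm2 (polar r t) = r.
Proof.
  intros Hr; unfold norm2, polar; simpl.
  replace (Rsqr (r * cos t) + Rsqr (r * sin t)) with (Rsqr r * (Rsqr (sin t) + Rsqr (cos t)))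
    by (unfold Rsqr; ring).
  rewrite sin2_cos2, Rmult_1_r; apply sqrt_Rsqr; auto.
Qed.

Lemma polar_exists (u : Point) : 0 < norm2 u -> exists t, u = polar (norm2 u) t.
Proof.
  destruct u as [x y]; intros H; set (r := norm2 (x, y)) in *.
  assert (Hr : r * r = x * x + y * y).
  { unfold r, norm2; simpl; rewrite sqrt_sqrt; auto.
    pose proof (Rle_0_sqr x); pose proof (Rle_0_sqr y); lra. }
  assert (Hx : -1 <= x / r <= 1).
  { split; [apply Rcomplements.Rle_div_r|apply Rcomplements.Rle_div_l]; auto; nra. }
  assert (Hs : r * sqrt (1 - Rsqr (x / r)) = Rabs y).
  { rewrite <- sqrt_Rsqr_abs, <- (sqrt_Rsqr r) at 1 by lra.
    rewrite <- sqrt_mult_alt by apply Rle_0_sqr; f_equal.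
    unfold Rsqr; transitivity (r * r - x * x); [field; lra|lra]. }
  assert (Hc : r * cos (acos (x / r)) = x) by (rewrite cos_acos; auto; field; lra).
  destruct (Rle_dec 0 y).
  - exists (acos (x / r)); unfold polar.
    rewrite Hc, sin_acos, Hs, Rabs_pos_eq; auto.
  - exists (- acos (x / r)); unfold polar.
    rewrite cos_neg, sin_neg, Hc, sin_acos; auto; f_equal.
    rewrite Ropp_mult_distr_r_reverse, Hs, Rabs_left; lra.
Qed.

(** No branch is fixed. Only the class modulo 2 PI is used; it is continuous and is controlled
    through the cosine of differences. *)
Definition angle (u : Point) : R := epsilon (inhabits 0) (fun t => u = polar (norm2 u) t).

Lemma polar_angle (u : Point) : 0 < norm2 u -> u = polar (norm2 u) (angle u).
Proof.
  intros H; apply (epsilon_spec (inhabits 0) (fun t => u = polar (norm2 u) t)).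
  apply polar_exists; auto.
Qed.

Lemma continuous_norm2 (u : Point) : continuous norm2 u.
Proof.
  apply (continuous_comp (fun u : R * R => Rsqr (fst u) + Rsqr (snd u)) sqrt);
    [|apply continuous_sqrt].
  apply (continuous_plus (V := R_NormedModule) (fun u : R * R => Rsqr (fst u))
    (fun u => Rsqr (snd u))).
  - apply (continuous_mult (K := R_AbsRing) fst fst); apply continuous_fst.
  - apply (continuous_mult (K := R_AbsRing) snd snd); apply continuous_snd.
Qed.

Lemma cos_angle_diff (u v : Point) : 0 < norm2 u -> 0 < norm2 v ->
  cos (angle u - angle v) = (fst u * fst v + snd u * snd v) / (norm2 u * norm2 v).
Proof.
  intros Hu Hv; rewrite cos_minus.
  rewrite (polar_angle u Hu) at 3 4; rewrite (polar_angle v Hv) at 3 4; unfold polar; simpl.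
  field; lra.
Qed.

Lemma continuous_angle (u : Point) (e : R) : 0 < norm2 u -> 0 < e ->
  exists d, 0 < d /\ forall v, Rabs (fst v - fst u) < d -> Rabs (snd v - snd u) < d ->
    exists m : Z, Rabs (angle u / (2 * PI) - angle v / (2 * PI) - IZR m) < e.
Proof.
  intros Hu He; destruct (cos_near e He) as [c [Hc Hcos]].
  set (q := fun v : R * R => (fst u * fst v + snd u * snd v) / (norm2 u * norm2 v)).
  assert (Hq : continuous q u).
  { unfold q, Rdiv; apply (continuous_mult (K := R_AbsRing)
      (fun v : R * R => fst u * fst v + snd u * snd v) (fun v => / (norm2 u * norm2 v))).
    - apply (continuous_plus (V := R_NormedModule) (fun v : R * R => fst u * fst v)
        (fun v => snd u * snd v)).
      + apply (continuous_mult (K := R_AbsRing) (fun _ : R * R => fst u) fst);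
          [apply continuous_const|apply continuous_fst].
      + apply (continuous_mult (K := R_AbsRing) (fun _ : R * R => snd u) snd);
          [apply continuous_const|apply continuous_snd].
    - apply continuous_comp with (g := Rinv).
      + apply (continuous_mult (K := R_AbsRing) (fun _ : R * R => norm2 u) norm2);
          [apply continuous_const|apply continuous_norm2].
      + apply continuous_Rinv; nra. }
  assert (Hqu : q u = 1).
  { unfold q; rewrite <- cos_angle_diff, Rminus_diag, cos_0; auto. }
  pose proof (proj1 (continuous_R2 _ _) Hq c Hc) as [d1 [Hd1 H1]].
  pose proof (proj1 (continuous_R2 _ _) (continuous_norm2 u) (norm2 u) Hu) as [d2 [Hd2 H2]].
  exists (Rmin d1 d2); split; [apply Rmin_pos; auto|]; intros v Hv1 Hv2.
  pose proof (Rmin_l d1 d2); pose proof (Rmin_r d1 d2).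
  specialize (H1 v ltac:(lra) ltac:(lra)); specialize (H2 v ltac:(lra) ltac:(lra)).
  apply Rabs_def2 in H1, H2; rewrite Hqu in H1.
  assert (Hv : 0 < norm2 v) by lra.
  unfold q in H1; rewrite <- cos_angle_diff in H1 by auto.
  destruct (Hcos (angle u - angle v)) as [m Hm]; [lra|]; exists m.
  unfold Rdiv in *; rewrite <- Rmult_minus_distr_r; auto.
Qed.

Lemma continuous_polar (r t : R) (e : R) : 0 < e ->
  exists d, 0 < d /\ forall r' t', Rabs (r' - r) < d -> Rabs (t' - t) < d ->
    dE (polar r t) (polar r' t') < e.
Proof.
  intros He.
  assert (H1 : continuous (fun q : R * R => fst q * cos (snd q)) (r, t)).
  { apply (continuous_mult (K := R_AbsRing) (fun q : R * R => fst q) (fun q => cos (snd q)));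
      [apply continuous_fst|].
    apply (continuous_comp snd cos); [apply continuous_snd|apply continuous_cos]. }
  assert (H2 : continuous (fun q : R * R => fst q * sin (snd q)) (r, t)).
  { apply (continuous_mult (K := R_AbsRing) (fun q : R * R => fst q) (fun q => sin (snd q)));
      [apply continuous_fst|].
    apply (continuous_comp snd sin); [apply continuous_snd|apply continuous_sin]. }
  rewrite continuous_R2 in H1, H2.
  destruct (H1 (e / 2)) as [d1 [Hd1 C1]]; [lra|]; destruct (H2 (e / 2)) as [d2 [Hd2 C2]]; [lra|].
  exists (Rmin d1 d2); split; [apply Rmin_pos; auto|]; intros r' t' Hr Ht.
  pose proof (Rmin_l d1 d2); pose proof (Rmin_r d1 d2).
  specialize (C1 (r', t')); specialize (C2 (r', t')); simpl in C1, C2.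
  apply box_dE; unfold polar; simpl; rewrite Rabs_minus_sym; [apply C1|apply C2]; lra.
Qed.

(** The radius becomes the abscissa in (l, l + w) and the angle, in full turns, the ordinate. The
    ambiguity of the angle disappears modulo 1. *)
Definition annulus_map (l w : R) (u : Point) : Point :=
  (l + w * (norm2 u - 1), angle u / (2 * PI)).

Lemma annulus_embedding (l w : R) : 0 < w < 1 -> embedding std_annulus (annulus_map l w).
Proof.
  intros Hw; pose proof PI_RGT_0 as Hpi.
  assert (Hn : forall u, std_annulus u -> 1 < norm2 u < 2).
  { intros u Hu; unfold std_annulus in Hu; rewrite dE_origin in Hu; auto. }
  split; [|split].
  - intros u Hu e He; apply Hn in Hu.
    destruct (continuous_angle u (e / 2)) as [d1 [Hd1 H1]]; [lra|lra|].
    destruct (proj1 (continuous_R2 _ _) (continuous_norm2 u) (e / 2)) as [d2 [Hd2 H2]]; [lra|].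
    exists (Rmin d1 d2); split; [apply Rmin_pos; auto|]; intros v _ Hv.
    apply dE_box in Hv; rewrite (Rabs_minus_sym (fst u)), (Rabs_minus_sym (snd u)) in Hv.
    pose proof (Rmin_l d1 d2); pose proof (Rmin_r d1 d2).
    destruct (H1 v) as [m Hm]; try lra; specialize (H2 v ltac:(lra) ltac:(lra)).
    apply tnear_dT; exists 0%Z, m; unfold annulus_map; simpl; split; auto.
    replace (_ - 0) with (w * (norm2 u - norm2 v)) by ring.
    rewrite Rabs_mult, (Rabs_pos_eq w), Rabs_minus_sym by lra.
    pose proof (Rabs_pos (norm2 v - norm2 u)); nra.
  - intros u v Hu Hv [m [n [E1 E2]]]; apply Hn in Hu, Hv; unfold annulus_map in *; simpl in *.
    assert (m = 0%Z).
    { apply IZR_small; rewrite <- E1; apply Rabs_def1; nra. }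
    subst m; assert (En : norm2 u = norm2 v) by nra.
    rewrite (polar_angle u), (polar_angle v), En by lra.
    replace (angle u) with (angle v + 2 * PI * IZR n).
    + unfold polar; rewrite cos_add_2PI_IZR, sin_add_2PI_IZR; auto.
    + rewrite <- E2; field; lra.
  - intros u Hu e He; apply Hn in Hu.
    destruct (continuous_polar (norm2 u) (angle u) e He) as [d [Hd H]].
    (* The bound 1 - w excludes a nonzero integer shift of the abscissa, as abscissas in the band
       differ by less than w. The other two rescale d for the radius and for the angle. *)
    set (c := Rmin (1 - w) (Rmin (d * w) (d / (2 * PI)))).
    assert (Hc : 0 < c /\ c <= 1 - w /\ c <= d * w /\ c <= d / (2 * PI)).
    { unfold c; pose proof (Rmin_l (1 - w) (Rmin (d * w) (d / (2 * PI)))).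
      pose proof (Rmin_r (1 - w) (Rmin (d * w) (d / (2 * PI)))).
      pose proof (Rmin_l (d * w) (d / (2 * PI))); pose proof (Rmin_r (d * w) (d / (2 * PI))).
      split; [|lra]; repeat apply Rmin_pos; try nra. apply Rdiv_lt_0_compat; lra. }
    exists c; split; [lra|]; intros v Hv Huv; apply Hn in Hv.
    apply dT_tnear in Huv; destruct Huv as [m [n [H1 H2]]].
    unfold annulus_map in H1, H2; simpl in H1, H2.
    assert (m = 0%Z).
    { apply IZR_small; apply Rabs_def2 in H1; apply Rabs_def1; nra. }
    subst m.
    rewrite (polar_angle u), (polar_angle v) by lra.
    replace (polar (norm2 v) (angle v)) with (polar (norm2 v) (angle v + 2 * PI * IZR n))
      by (unfold polar; rewrite cos_add_2PI_IZR, sin_add_2PI_IZR; auto).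
    apply H.
    + apply Rabs_def2 in H1; apply Rabs_def1; nra.
    + replace (angle v + 2 * PI * IZR n - angle u) with
        (- (angle u / (2 * PI) - angle v / (2 * PI) - IZR n) * (2 * PI)) by (field; lra).
      rewrite Rabs_mult, Rabs_Ropp, (Rabs_pos_eq (2 * PI)) by lra.
      apply Rcomplements.Rlt_div_r; lra.
Qed.

Lemma annulus_image (l w : R) : 0 < w < 1 ->
  forall x, band fst l (l + w) x <-> image std_annulus (annulus_map l w) x.
Proof.
  intros Hw x; pose proof PI_RGT_0 as Hpi; split.
  - intros [m Hm].
    set (r := 1 + (fst x - IZR m - l) / w); set (t := 2 * PI * snd x).
    assert (Hr : 1 < r < 2).
    { unfold r; assert (0 < (fst x - IZR m - l) / w) by (apply Rdiv_lt_0_compat; lra).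
      assert ((fst x - IZR m - l) / w < 1) by (apply Rcomplements.Rlt_div_l; lra); lra. }
    assert (Hnorm : norm2 (polar r t) = r) by (apply norm2_polar; lra).
    exists (polar r t); split; [unfold std_annulus; rewrite dE_origin, Hnorm; auto|].
    assert (Hp := polar_angle (polar r t)); rewrite Hnorm in Hp.
    specialize (Hp ltac:(lra)); set (a := angle (polar r t)) in *.
    unfold polar in Hp; injection Hp; intros Hs Hc.
    apply Rmult_eq_reg_l in Hs, Hc; try lra.
    destruct (cos_eq_1 (a - t)) as [n Hn].
    { rewrite cos_minus, <- Hs, <- Hc; pose proof (sin2_cos2 t); unfold Rsqr in *; lra. }
    exists (- m)%Z, n; unfold annulus_map; rewrite Hnorm; fold a; simpl; split.
    + rewrite opp_IZR; unfold r; field; lra.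
    + replace a with (t + 2 * PI * IZR n) by lra; unfold t; field; lra.
  - intros [u [Hu [m [n [E _]]]]]; unfold std_annulus in Hu; rewrite dE_origin in Hu.
    unfold annulus_map in E; simpl in E; exists (- m)%Z; rewrite opp_IZR; nra.
Qed.

Lemma convex_between (l r u v t : R) : 0 <= t <= 1 -> l < u < r -> l < v < r ->
  l < (1 - t) * u + t * v < r.
Proof.
  intros Ht Hu Hv; destruct (Rle_dec u v).
  - assert (0 <= t * (v - u) <= v - u) by nra; lra.
  - assert (0 <= t * (u - v) <= u - v) by nra; lra.
Qed.

Lemma band_connected (l r : R) : connected_in dT (band fst l r).
Proof.
  apply joined_connected; intros x y [m Hm] [n Hn].
  apply joined_trans with (translate x (- m) 0); [apply joined_teq, teq_sym, translate_teq|].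
  apply joined_trans with (translate y (- n) 0); [|apply joined_teq, translate_teq].
  apply joined_segment; intros t Ht; exists 0%Z; unfold in01 in Ht; simpl.
  rewrite !opp_IZR; set (u := fst x - IZR m) in *; set (v := fst y - IZR n) in *.
  replace (_ - 0) with ((1 - t) * u + t * v) by (unfold u, v; ring).
  apply convex_between; auto.
Qed.

(** * Lifting circle-valued maps on a square *)

Definition cnear (e x y : R) : Prop := exists m : Z, Rabs (x - y - IZR m) < e.

Lemma cnear_trans (e e' x y z : R) : cnear e x y -> cnear e' y z -> cnear (e + e') x z.
Proof.
  intros [m Hm] [n Hn]; exists (m + n)%Z; rewrite plus_IZR.
  replace (x - z - (IZR m + IZR n)) with ((x - y - IZR m) + (y - z - IZR n)) by ring.
  apply Rle_lt_trans with (1 := Rabs_triang _ _); lra.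
Qed.

Lemma cnear_sym (e x y : R) : cnear e x y -> cnear e y x.
Proof.
  intros [m Hm]; exists (- m)%Z; rewrite opp_IZR, <- Rabs_Ropp.
  replace (- (y - x - - IZR m)) with (x - y - IZR m) by ring; auto.
Qed.

Lemma cnear_minus (e x y x' y' : R) : cnear e x x' -> cnear e y y' ->
  cnear (e + e) (x - y) (x' - y').
Proof.
  intros [m Hm] [n Hn]; exists (m - n)%Z; rewrite minus_IZR.
  replace (x - y - (x' - y') - (IZR m - IZR n)) with ((x - x' - IZR m) + - (y - y' - IZR n)) by ring.
  apply Rle_lt_trans with (1 := Rabs_triang _ _); rewrite Rabs_Ropp; lra.
Qed.

(** The representative modulo 1 in [-1/2, 1/2), used to lift small increments on the circle; its
    jump at 1/2 is kept at a distance. *)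
Definition centered (x : R) : R := frac_part (x + / 2) - / 2.

Lemma centered_eq (x : R) (m : Z) : - / 2 <= x - IZR m < / 2 -> centered x = x - IZR m.
Proof. intros H; unfold centered, frac_part; rewrite (Int_part_eq _ m); lra. Qed.

Lemma centered_congr (x : R) : exists m : Z, centered x = x - IZR m.
Proof. exists (Int_part (x + / 2)); unfold centered, frac_part; lra. Qed.

Lemma centered_continuous (x y e : R) : cnear (/ 4) x 0 -> e <= / 4 -> cnear e x y ->
  Rabs (centered x - centered y) < e.
Proof.
  intros [m Hm] He [n Hn]; rewrite Rminus_0_r in Hm.
  pose proof (Rabs_def2 _ _ Hm); pose proof (Rabs_def2 _ _ Hn).
  rewrite (centered_eq x m), (centered_eq y (m - n)) by (rewrite ?minus_IZR; lra).
  rewrite minus_IZR; replace (_ - _) with (x - y - IZR n) by ring; auto.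
Qed.

Definition cont_square (L : R -> R -> R) : Prop :=
  forall s t e, in01 s -> in01 t -> 0 < e -> exists d, 0 < d /\
    forall s' t', in01 s' -> in01 t' -> Rabs (s - s') < d -> Rabs (t - t') < d ->
      Rabs (L s t - L s' t') < e.

Definition circle_cont_square (K : R -> R -> R) : Prop :=
  forall s t e, in01 s -> in01 t -> 0 < e -> exists d, 0 < d /\
    forall s' t', in01 s' -> in01 t' -> Rabs (s - s') < d -> Rabs (t - t') < d ->
      cnear e (K s t) (K s' t').

Lemma circle_uniformly_cont (K : R -> R -> R) (e : R) : circle_cont_square K -> 0 < e ->
  exists d, 0 < d /\ forall s t s' t', in01 s -> in01 t -> in01 s' -> in01 t' ->
    Rabs (s - s') < d -> Rabs (t - t') < d -> cnear e (K s t) (K s' t').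
Proof.
  intros HK He.
  (* The factor 2 is the usual slack of a Lebesgue number: a point within d of (s, t), which itself
     lies within the radius of a center, is within twice that radius of the center. *)
  set (Q := fun s t (d : posreal) => in01 s -> in01 t -> forall s' t', in01 s' -> in01 t' ->
     Rabs (s - s') < 2 * d -> Rabs (t - t') < 2 * d -> cnear (e / 2) (K s t) (K s' t')).
  assert (HQ : forall s t, exists d, Q s t d).
  { intros s t; destruct (classic (in01 s /\ in01 t)) as [[Hs Ht]|Hn].
    - destruct (HK s t (e / 2) Hs Ht) as [d [Hd H]]; [lra|].
      assert (Hd2 : 0 < d / 2) by lra; exists (mkposreal _ Hd2).
      intros _ _ s' t' Hs' Ht'; simpl; replace (2 * (d / 2)) with d by lra; auto.
    - exists (mkposreal 1 Rlt_0_1); intros Hs Ht; tauto. }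
  set (dl := fun s t => epsilon (inhabits (mkposreal 1 Rlt_0_1)) (Q s t)).
  assert (Hdl : forall s t, Q s t (dl s t)) by (intros; apply epsilon_spec, HQ).
  destruct (compactness_value_2d 0 1 0 1 dl) as [d Hd].
  exists d; split; [apply cond_pos|]; intros s t s' t' Hs Ht Hs' Ht' H1 H2.
  destruct (NNPP _ (Hd s t Hs Ht)) as [u [v [Hu [Hv [E1 [E2 E3]]]]]].
  assert (A : forall x y z, Rabs (x - z) <= Rabs (y - z) + Rabs (y - x)).
  { intros x y z; rewrite (Rabs_minus_sym y x), Rplus_comm.
    replace (x - z) with ((x - y) + (y - z)) by ring; apply Rabs_triang. }
  replace e with (e / 2 + e / 2) by lra; apply cnear_trans with (K u v).
  - apply cnear_sym, Hdl; auto; rewrite Rabs_minus_sym; pose proof (cond_pos (dl u v)); lra.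
  - apply Hdl; auto.
    + pose proof (A u s s'); lra.
    + pose proof (A v t t'); lra.
Qed.

(** Lifts K along the segment from (0, 0) to (s, t) by adding centered increments over steps of
    length 1/N of the segment. Lifting radially makes all points of the square use the same formula,
    so continuity is an induction on n. *)
Fixpoint partial_lift (K : R -> R -> R) (N n : nat) (s t : R) : R :=
  match n with
  | O => K 0 0
  | S n => partial_lift K N n s t +
      centered (K (s * (INR (S n) / INR N)) (t * (INR (S n) / INR N)) -
                K (s * (INR n / INR N)) (t * (INR n / INR N)))
  end.

Lemma partial_lift_S (K : R -> R -> R) (N n : nat) (s t : R) :
  partial_lift K N (S n) s t = partial_lift K N n s t +
    centered (K (s * (INR (S n) / INR N)) (t * (INR (S n) / INR N)) -
              K (s * (INR n / INR N)) (t * (INR n / INR N))).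
Proof. reflexivity. Qed.

Lemma partial_lift_congr (K : R -> R -> R) (N n : nat) (s t : R) :
  exists m : Z, partial_lift K N n s t = K (s * (INR n / INR N)) (t * (INR n / INR N)) - IZR m.
Proof.
  induction n as [|n [m Hm]].
  - exists 0%Z; simpl; unfold Rdiv; rewrite !Rmult_0_l, !Rmult_0_r, Rminus_0_r; auto.
  - rewrite partial_lift_S, Hm.
    match goal with |- context [centered ?x] => destruct (centered_congr x) as [k Hk] end.
    exists (m + k)%Z; rewrite Hk, plus_IZR; ring.
Qed.

Lemma partial_lift_cont (K : R -> R -> R) (N n : nat) (d : R) : (n <= N)%nat ->
  circle_cont_square K -> / INR N < d ->
  (forall s t s' t', in01 s -> in01 t -> in01 s' -> in01 t' ->
    Rabs (s - s') < d -> Rabs (t - t') < d -> cnear (/ 4) (K s t) (K s' t')) ->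
  cont_square (partial_lift K N n).
Proof.
  intros HnN HK HN Hu; induction n as [|n IH].
  - intros s t e _ _ He; exists 1; split; [lra|]; intros; simpl.
    rewrite Rminus_diag, Rabs_R0; auto.
  - assert (HNp : 0 < INR N) by (apply lt_0_INR; lia).
    assert (Hfr : forall k, (k <= N)%nat -> 0 <= INR k / INR N <= 1).
    { intros k Hk; apply le_INR in Hk; pose proof (pos_INR k).
      split; [apply Rcomplements.Rdiv_le_0_compat; lra|apply Rcomplements.Rle_div_l; lra]. }
    assert (Hin : forall k x, (k <= N)%nat -> in01 x -> in01 (x * (INR k / INR N))).
    { intros k x Hk Hx; specialize (Hfr k Hk); unfold in01 in *; nra. }
    assert (Hsc : forall k x y d, (k <= N)%nat -> Rabs (x - y) < d ->
      Rabs (x * (INR k / INR N) - y * (INR k / INR N)) < d).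
    { intros k x y r Hk Hxy; specialize (Hfr k Hk).
      rewrite <- Rmult_minus_distr_r, Rabs_mult, (Rabs_pos_eq (INR k / INR N)) by lra.
      pose proof (Rabs_pos (x - y)); nra. }
    assert (Hstep : forall x, in01 x ->
      Rabs (x * (INR (S n) / INR N) - x * (INR n / INR N)) < d).
    { intros x Hx; rewrite S_INR.
      replace (x * ((INR n + 1) / INR N) - x * (INR n / INR N)) with (x * / INR N) by (field; lra).
      apply Rinv_0_lt_compat in HNp; unfold in01 in Hx; rewrite Rabs_pos_eq; nra. }
    intros s t e Hs Ht He.
    set (e' := Rmin (e / 2) (/ 4)).
    assert (He' : 0 < e' /\ e' <= e / 2 /\ e' <= / 4).
    { unfold e'; split; [apply Rmin_pos; lra|split; [apply Rmin_l|apply Rmin_r]]. }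
    destruct (IH ltac:(lia) s t (e / 2) Hs Ht) as [d1 [Hd1 H1]]; [lra|].
    assert (Sn : (S n <= N)%nat) by auto; assert (Nn : (n <= N)%nat) by lia.
    destruct (HK _ _ (e' / 2) (Hin (S n) s Sn Hs) (Hin (S n) t Sn Ht)) as [d2 [Hd2 H2]]; [lra|].
    destruct (HK _ _ (e' / 2) (Hin n s Nn Hs) (Hin n t Nn Ht)) as [d3 [Hd3 H3]]; [lra|].
    exists (Rmin d1 (Rmin d2 d3)); split; [repeat apply Rmin_pos; auto|].
    intros s' t' Hs' Ht' Hss Htt; rewrite !partial_lift_S.
    pose proof (Rmin_l d1 (Rmin d2 d3)); pose proof (Rmin_r d1 (Rmin d2 d3)).
    pose proof (Rmin_l d2 d3); pose proof (Rmin_r d2 d3).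
    assert (Hl : Rabs (partial_lift K N n s t - partial_lift K N n s' t') < e / 2)
      by (apply H1; auto; lra).
    match goal with |- Rabs (?a + centered ?b - (?c + centered ?f)) < _ =>
      assert (Hcen : Rabs (centered b - centered f) < e');
        [|replace (a + centered b - (c + centered f)) with ((a - c) + (centered b - centered f))
            by ring; apply Rle_lt_trans with (1 := Rabs_triang _ _); lra]
    end.
    apply centered_continuous; [|lra|].
    + destruct (Hu _ _ _ _ (Hin _ _ Sn Hs) (Hin _ _ Sn Ht) (Hin _ _ Nn Hs) (Hin _ _ Nn Ht)
        (Hstep s Hs) (Hstep t Ht)) as [m Hm]; exists m; rewrite Rminus_0_r; auto.
    + replace e' with (e' / 2 + e' / 2) by lra; apply cnear_minus;
        [apply H2|apply H3]; auto; apply Hsc; auto; lra.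
Qed.

Lemma square_lift (K : R -> R -> R) : circle_cont_square K ->
  exists L, cont_square L /\ forall s t, exists m : Z, L s t = K s t - IZR m.
Proof.
  intros HK; destruct (circle_uniformly_cont K (/ 4) HK) as [d [Hd Hu]]; [lra|].
  destruct (archimed_cor1 d Hd) as [N [HN HN0]].
  exists (partial_lift K N N); split; [apply (partial_lift_cont K N N d); auto|].
  intros s t; destruct (partial_lift_congr K N N s t) as [m Hm]; exists m.
  assert (0 < INR N) by (apply lt_0_INR; auto).
  unfold Rdiv in Hm; rewrite Rinv_r, !Rmult_1_r in Hm by lra; auto.
Qed.

Lemma constant_mod_1 (f : R -> R) (c : R) :
  (forall t e, in01 t -> 0 < e -> exists d, 0 < d /\ forall s, in01 s -> Rabs (t - s) < d ->
     Rabs (f t - f s) < e) ->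
  (forall t, in01 t -> exists m : Z, f t = c - IZR m) -> f 0 = f 1.
Proof.
  intros Hf Hc.
  assert (Hloc : forall t, in01 t -> exists d, 0 < d /\
     forall s, in01 s -> Rabs (s - t) < d -> f s = f t).
  { intros t Ht; destruct (Hf t 1 Ht Rlt_0_1) as [d [Hd H]]; exists d; split; auto.
    intros s Hs Hst; rewrite Rabs_minus_sym in Hst; specialize (H s Hs Hst).
    destruct (Hc t Ht) as [m Hm]; destruct (Hc s Hs) as [n Hn]; rewrite Hm, Hn in *.
    replace (c - IZR m - (c - IZR n)) with (IZR (n - m)) in H by (rewrite minus_IZR; ring).
    apply IZR_small in H; replace n with m by lia; auto. }
  symmetry; apply (interval_connected (fun t => f t = f 0) (fun t => f t <> f 0)); auto.
  - intros; apply classic.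
  - intros t Ht E; destruct (Hloc t Ht) as [d [Hd H]]; exists d; split; auto.
    intros s Hs Hst; rewrite H; auto.
  - intros t Ht E; destruct (Hloc t Ht) as [d [Hd H]]; exists d; split; auto.
    intros s Hs Hst; rewrite H; auto.
Qed.

(* A nullhomotopy in the torus shows that the second coordinate of the loop lifts to a
   closed loop in the line; the affine homotopy of the lifts then stays in the band. *)
Lemma band_pi1_injective (l r : R) (S : Point -> Prop) : l < r < l + 1 ->
  (forall x, S x <-> band fst l r x) -> pi1_injective S.
Proof.
  intros Hlr HS g [HgS [Hg01 Hgc]] [H [_ [Hc [H0 [H1 Hside]]]]].
  destruct (square_lift (fun s t => snd (H s t))) as [L [HL HLK]].
  { intros s t e Hs Ht He; destruct (Hc s t e Hs Ht He) as [d [Hd Hd']]; exists d; split; auto.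
    intros s' t' Hs' Ht' E1 E2; specialize (Hd' s' t' Hs' Ht' E1 E2).
    apply dT_tnear in Hd'; destruct Hd' as [m [n [_ Hn]]]; exists n; auto. }
  assert (I0 : in01 0) by (unfold in01; lra); assert (I1 : in01 1) by (unfold in01; lra).
  assert (Hsnd : forall s t p, teq (H s t) p -> exists m : Z, L s t = snd p - IZR m).
  { intros s t p [m [n [_ E]]]; destruct (HLK s t) as [k Hk]; simpl in Hk.
    exists (k - n)%Z; rewrite minus_IZR; lra. }
  assert (HLs : forall t, in01 t -> L 0 t = L 1 t \/ (t <> 0 /\ t <> 1)).
  { intros t Ht; destruct (Req_dec t 0) as [->|]; [left|destruct (Req_dec t 1) as [->|]; auto; left].
    - apply (constant_mod_1 (fun s => L s 0) (snd (g 0))).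
      + intros s e Hs He; destruct (HL s 0 e Hs I0 He) as [d [Hd Hd']]; exists d; split; auto.
        intros s' Hs' E; apply Hd'; auto; rewrite Rminus_diag, Rabs_R0; auto.
      + intros s Hs; apply Hsnd, Hside, Hs.
    - apply (constant_mod_1 (fun s => L s 1) (snd (g 0))).
      + intros s e Hs He; destruct (HL s 1 e Hs I1 He) as [d [Hd Hd']]; exists d; split; auto.
        intros s' Hs' E; apply Hd'; auto; rewrite Rminus_diag, Rabs_R0; auto.
      + intros s Hs; apply Hsnd, Hside, Hs. }
  assert (HLt : forall s t e, in01 s -> in01 t -> 0 < e -> exists d, 0 < d /\
     forall t', in01 t' -> Rabs (t - t') < d -> Rabs (L s t - L s t') < e).
  { intros s t e Hs Ht He; destruct (HL s t e Hs Ht He) as [d [Hd Hd']]; exists d; split; auto.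
    intros t' Ht' E; apply Hd'; auto; rewrite Rminus_diag, Rabs_R0; auto. }
  (* The sides t = 0, t = 1 and s = 1 of the homotopy stay at the base point, so the lift is
     constant along each of them and agrees at the two ends of the remaining side. *)
  assert (Hclosed : L 0 0 = L 0 1).
  { destruct (HLs 0 I0) as [E0|[]]; [|tauto]; destruct (HLs 1 I1) as [E1|[]]; [|tauto].
    rewrite E0, E1; apply (constant_mod_1 (fun t => L 1 t) (snd (g 0))); auto. }
  set (y := fun t => L 0 t).
  set (x := fun t => l + frac_part (fst (g t) - l)).
  assert (Hx : forall t, in01 t -> l < x t < r /\ exists m : Z, x t = fst (g t) - IZR m).
  { intros t Ht; destruct (proj1 (HS (g t)) (HgS t Ht)) as [m Hm].
    assert (E : Int_part (fst (g t) - l) = m) by (apply Int_part_eq; lra).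
    unfold x, frac_part; rewrite E; split; [lra|exists m; ring]. }
  assert (Hy : forall t, in01 t -> exists m : Z, y t = snd (g t) - IZR m)
    by (intros t Ht; apply Hsnd; auto).
  assert (Hxc : forall t e, in01 t -> 0 < e -> exists d, 0 < d /\
     forall s, in01 s -> Rabs (t - s) < d -> Rabs (x t - x s) < e).
  { intros t e Ht He; set (e' := Rmin e (1 - (r - l))).
    assert (He' : 0 < e' /\ e' <= e /\ e' <= 1 - (r - l)).
    { unfold e'; split; [apply Rmin_pos; lra|split; [apply Rmin_l|apply Rmin_r]]. }
    destruct (Hgc t e' Ht) as [d [Hd Hd']]; [lra|]; exists d; split; auto; intros s Hs Hts.
    specialize (Hd' s Hs Hts); apply dT_tnear in Hd'; destruct Hd' as [k [_ [Hk _]]].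
    destruct (Hx t Ht) as [B1 [m1 E1]]; destruct (Hx s Hs) as [B2 [m2 E2]].
    assert (Hk' : (k - m1 + m2)%Z = 0%Z).
    { apply IZR_small; rewrite plus_IZR, minus_IZR; apply Rabs_def2 in Hk; apply Rabs_def1; lra. }
    apply (f_equal IZR) in Hk'; rewrite plus_IZR, minus_IZR in Hk'.
    replace (x t - x s) with (fst (g t) - fst (g s) - IZR k) by lra; lra. }
  assert (Hx01 : x 0 = x 1).
  { destruct Hg01 as [k [_ [Hk _]]].
    destruct (Hx 0 I0) as [B1 [m1 E1]]; destruct (Hx 1 I1) as [B2 [m2 E2]].
    assert (Hk' : (k - m1 + m2)%Z = 0%Z).
    { apply IZR_small; rewrite plus_IZR, minus_IZR; apply Rabs_def1; lra. }
    apply (f_equal IZR) in Hk'; rewrite plus_IZR, minus_IZR in Hk'; lra. }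
  assert (Hteq : forall t, in01 t -> teq (x t, y t) (g t)).
  { intros t Ht; destruct (Hx t Ht) as [_ [m E1]]; destruct (Hy t Ht) as [n E2].
    exists (- m)%Z, (- n)%Z; rewrite !opp_IZR; simpl; lra. }
  exists (fun s t => ((1 - s) * x t + s * x 0, (1 - s) * y t + s * y 0)).
  split; [|split; [|split; [|split]]].
  - intros s t Hs Ht; apply HS; exists 0%Z; simpl; rewrite Rminus_0_r.
    apply convex_between; [auto|apply Hx; auto|apply Hx; auto].
  - assert (Hmix : forall f : R -> R, (forall t e, in01 t -> 0 < e -> exists d, 0 < d /\
        forall s, in01 s -> Rabs (t - s) < d -> Rabs (f t - f s) < e) ->
      forall s t e, in01 s -> in01 t -> 0 < e -> exists d, 0 < d /\
        forall s' t', in01 s' -> in01 t' -> Rabs (s - s') < d -> Rabs (t - t') < d ->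
        Rabs ((1 - s) * f t + s * f 0 - ((1 - s') * f t' + s' * f 0)) < e).
    { intros f Hf s t e Hs Ht He; destruct (Hf t (e / 2) Ht) as [d [Hd Hd']]; [lra|].
      set (B := Rabs (f t - f 0) + 1).
      assert (HB : 0 < B) by (unfold B; pose proof (Rabs_pos (f t - f 0)); lra).
      exists (Rmin d (e / 2 / B)); split.
      { apply Rmin_pos; auto; apply Rdiv_lt_0_compat; lra. }
      intros s' t' Hs' Ht' E1 E2.
      pose proof (Rmin_l d (e / 2 / B)); pose proof (Rmin_r d (e / 2 / B)).
      replace (_ - _) with ((1 - s') * (f t - f t') + (s' - s) * (f t - f 0)) by ring.
      apply Rle_lt_trans with (1 := Rabs_triang _ _); rewrite !Rabs_mult.
      assert (F4 := Hd' t' Ht' ltac:(lra)).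
      assert (F5 : Rabs (1 - s') <= 1) by (unfold in01 in Hs'; apply Rabs_le_between; lra).
      assert (F6 : Rabs (s' - s) * B <= e / 2).
      { rewrite Rabs_minus_sym; apply Rle_trans with (e / 2 / B * B).
        - apply Rmult_le_compat_r; lra.
        - right; field; lra. }
      unfold B in F6; pose proof (Rabs_pos (f t - f t')); pose proof (Rabs_pos (s' - s)); nra. }
    intros s t e Hs Ht He.
    destruct (Hmix x Hxc s t (e / 2) Hs Ht) as [d1 [Hd1 E1]]; [lra|].
    destruct (Hmix y (fun t e Ht He => HLt 0 t e I0 Ht He) s t (e / 2) Hs Ht) as [d2 [Hd2 E2]]; [lra|].
    exists (Rmin d1 d2); split; [apply Rmin_pos; auto|]; intros s' t' Hs' Ht' F1 F2.
    pose proof (Rmin_l d1 d2); pose proof (Rmin_r d1 d2).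
    apply tnear_dT, box_tnear; simpl; [apply E1|apply E2]; auto; lra.
  - intros t Ht; replace ((1 - 0) * x t + 0 * x 0, (1 - 0) * y t + 0 * y 0) with (x t, y t)
      by (f_equal; ring); auto.
  - intros t Ht; replace ((1 - 1) * x t + 1 * x 0, (1 - 1) * y t + 1 * y 0) with (x 0, y 0)
      by (f_equal; ring); auto.
  - intros s Hs; rewrite <- Hx01; change (y 1) with (L 0 1); rewrite <- Hclosed; fold (y 0).
    replace ((1 - s) * x 0 + s * x 0, (1 - s) * y 0 + s * y 0) with (x 0, y 0)
      by (f_equal; ring); auto.
Qed.

(** * Complementary annuli of the product with a rotation *)

Lemma gap_width (al t : R) : irrational al -> hi al t < lo al t + 1.
Proof.
  intros Hal; change 1 with (IZR 1); rewrite <- lo_add_IZR; apply hi_lt_lo; auto; lra.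
Qed.

(** A common point has its [pos] determined modulo 1, so t and u differ by an integer and the bands
    coincide. *)
Lemma gap_band_overlap (al t u : R) (p q : Point) : irrational al ->
  band fst (lo al t) (hi al t) p -> band fst (lo al u) (hi al u) p ->
  band fst (lo al u) (hi al u) q -> band fst (lo al t) (hi al t) q.
Proof.
  intros Hal [m Hm] [n Hn] [k Hk].
  assert (E1 : pos al (fst p - IZR m) = t) by (apply pos_spec; auto; lra).
  assert (E2 : pos al (fst p - IZR n) = u) by (apply pos_spec; auto; lra).
  assert (E : u = t + IZR (m - n)).
  { rewrite <- E1, <- E2, <- pos_add_IZR, minus_IZR by auto; f_equal; ring. }
  rewrite E, lo_add_IZR, hi_add_IZR, minus_IZR in Hk.
  exists (k + m - n)%Z; rewrite minus_IZR, plus_IZR; lra.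
Qed.

Lemma annulus_type_exists (a b : R) : rat_indep a b ->
  exists f M, Homeo_star f /\ minimal_set f M /\ (exists x, ~ M x) /\
    (forall C, component_of dT (compl M) C -> is_disk C \/ is_essential_annulus C) /\
    (exists C, component_of dT (compl M) C /\ is_essential_annulus C).
Proof.
  intros Hab; pose proof (rat_indep_irrational_l a b Hab) as Ha.
  pose proof (prod_family _ _ _ _ (interp_family a Ha) (translation_family b)) as T.
  pose proof (prod_semiconj a b (interp a) (fun s x => x + s * b) _ _ _ _
    (interp_denjoy a Ha) (translation_denjoy b)) as S.
  pose proof (family_Homeo_star _ _ _ _ _ _ T S Hab) as Hs.
  pose proof (family_minimal _ _ _ _ _ _ T S Hab) as Hm.
  set (M := fun p : Point => cantor a (fst p) /\ True) in *.
  set (A := fun t => band fst (lo a t) (hi a t)).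
  assert (HAM : forall t p, A t p -> compl M p).
  { intros t p [m Hp] [Hc _]; apply (Hc (t + IZR m)); rewrite lo_add_IZR, hi_add_IZR; lra. }
  assert (HMA : forall p, compl M p -> exists t, A t p).
  { intros p Hp; destruct (cantor_compl a (fst p)) as [t Ht]; [intros Hc; apply Hp; split; auto|].
    exists t, 0%Z; lra. }
  assert (Hcomp : forall t p, A t p -> component_of dT (compl M) (A t) /\
     forall C, component_of dT (compl M) C -> (exists x, C x /\ A t x) -> forall x, C x <-> A t x).
  { intros t p Hp; apply clopen_component with (fun q => exists u, A u q /\ ~ A t q).
    - apply HAM.
    - exists p; auto.
    - apply band_connected.
    - apply band_open, coordinate_fst.
    - intros q [u [Hq Hn]].
      destruct (band_open fst (lo a u) (hi a u) coordinate_fst q Hq) as [e [He H]].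
      exists e; split; auto; intros q' Hq'; exists u; split; [apply H; auto|].
      intros Hn'; apply Hn; apply (gap_band_overlap a t u q'); auto; apply H; auto.
    - intros q Hq; destruct (classic (A t q)); auto; right.
      destruct (HMA q Hq) as [u Hu]; exists u; auto.
    - intros q Hq [u [_ Hn]]; auto. }
  assert (Hann : forall t p (C : Point -> Prop), A t p -> (forall x, C x <-> A t x) ->
     is_essential_annulus C).
  { intros t p C [m Hp] HC; pose proof (gap_width a t Ha).
    set (w := hi a t - lo a t); assert (Hw : 0 < w < 1) by (unfold w; lra).
    split; [|apply (band_pi1_injective (lo a t) (hi a t)); auto; lra].
    exists (annulus_map (lo a t) w); split; [apply annulus_embedding; auto|].
    intros x; rewrite HC; unfold A; rewrite <- annulus_image by auto.
    unfold w; replace (lo a t + (hi a t - lo a t)) with (hi a t) by ring; tauto. }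
  destruct (gap_point a Ha) as [z Hz]; assert (HzM : compl M (z, 0)) by (intros [H _]; auto).
  exists (prod_map (interp a) (fun s x => x + s * b) 1), M.
  split; [auto|split; [auto|split; [exists (z, 0); auto|split]]].
  - intros C HC; right; destruct HC as [[x Cx] HC'].
    destruct (HMA x (proj1 HC' x Cx)) as [t Ht].
    apply (Hann t x); auto; apply (Hcomp t x Ht).
    + split; auto; exists x; auto.
    + exists x; auto.
  - destruct (HMA (z, 0) HzM) as [t Ht]; exists (A t); split; [apply (Hcomp t _ Ht)|].
    apply (Hann t _ _ Ht); tauto.
Qed.

(** * The complementary strip of the suspension flow *)

(* A homeomorphism from the unit disk to [(c - w, c + w) x R], with inverse [of_strip]. *)
Definition to_strip (c w : R) (u : Point) : Point :=
  (c + w * fst u, snd u / sqrt (1 - fst u * fst u - snd u * snd u)).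

Definition of_strip (c w : R) (q : Point) : Point :=
  let x := (fst q - c) / w in (x, snd q * sqrt ((1 - x * x) / (1 + snd q * snd q))).

Lemma unit_disk_iff (u : Point) : unit_disk u <-> 0 < 1 - fst u * fst u - snd u * snd u.
Proof.
  unfold unit_disk; rewrite dE_origin; unfold norm2, Rsqr; rewrite <- sqrt_1 at 1; split; intros H.
  - apply sqrt_lt_0_alt in H; lra.
  - apply sqrt_lt_1_alt; split; [nra|lra].
Qed.

Lemma of_to_strip (c w : R) (u : Point) : w <> 0 -> unit_disk u -> of_strip c w (to_strip c w u) = u.
Proof.
  intros Hw Hu; apply unit_disk_iff in Hu; destruct u as [x y]; simpl in Hu.
  unfold of_strip, to_strip; simpl.
  set (d := 1 - x * x - y * y) in *.
  assert (Hd : 0 < sqrt d) by (apply sqrt_lt_R0; auto).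
  assert (Hdd : sqrt d * sqrt d = d) by (apply sqrt_sqrt; lra).
  replace ((c + w * x - c) / w) with x by (field; auto).
  replace ((1 - x * x) / (1 + y / sqrt d * (y / sqrt d))) with d.
  - f_equal; field; lra.
  - replace (y / sqrt d * (y / sqrt d)) with (y * y / d) by (rewrite <- Hdd at 1; field; lra).
    replace (1 - x * x) with (d + y * y) by (unfold d; ring).
    field; split; [lra|nra].
Qed.

Lemma to_of_strip (c w : R) (q : Point) : 0 < w -> c - w < fst q < c + w ->
  unit_disk (of_strip c w q) /\ to_strip c w (of_strip c w q) = q.
Proof.
  intros Hw Hq; destruct q as [x s]; rewrite unit_disk_iff; unfold of_strip, to_strip; simpl in *.
  set (u := (x - c) / w).
  assert (Hu : -1 < u < 1).
  { unfold u; split; [apply Rcomplements.Rlt_div_r|apply Rcomplements.Rlt_div_l]; lra. }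
  (* The preimage has ordinate s sqrt d with d = 1 - u^2 - (s sqrt d)^2; this is the solution for
     d. *)
  set (d := (1 - u * u) / (1 + s * s)).
  assert (Hd : 0 < d) by (apply Rdiv_lt_0_compat; nra).
  assert (Hdd : sqrt d * sqrt d = d) by (apply sqrt_sqrt; lra).
  assert (Hsd : 0 < sqrt d) by (apply sqrt_lt_R0; auto).
  assert (E : 1 - u * u - s * sqrt d * (s * sqrt d) = d).
  { replace (s * sqrt d * (s * sqrt d)) with (s * s * d) by (rewrite <- Hdd at 1; ring).
    unfold d; field; nra. }
  rewrite E; split; auto; f_equal; [unfold u; field; lra|field; lra].
Qed.

Lemma continuous_to_strip (c w : R) (u : Point) : unit_disk u ->
  continuous (fun v => fst (to_strip c w v)) u /\ continuous (fun v => snd (to_strip c w v)) u.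
Proof.
  intros Hu; apply unit_disk_iff in Hu; unfold to_strip; simpl.
  assert (Hf : continuous (fun v : Point => fst v) u) by apply continuous_fst.
  assert (Hs : continuous (fun v : Point => snd v) u) by apply continuous_snd.
  split.
  - apply (continuous_plus (V := R_NormedModule) (fun _ : Point => c) (fun v => w * fst v));
      [apply continuous_const|].
    apply (continuous_mult (K := R_AbsRing) (fun _ : Point => w) (fun v => fst v));
      [apply continuous_const|auto].
  - apply (continuous_mult (K := R_AbsRing) (fun v : Point => snd v)
      (fun v => / sqrt (1 - fst v * fst v - snd v * snd v))); [auto|].
    apply (continuous_comp (fun v : Point => sqrt (1 - fst v * fst v - snd v * snd v)) Rinv).
    + apply (continuous_comp (fun v : Point => 1 - fst v * fst v - snd v * snd v) sqrt);
        [|apply continuous_sqrt].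
      apply (continuous_minus (V := R_NormedModule) (fun v : Point => 1 - fst v * fst v)
        (fun v => snd v * snd v)).
      * apply (continuous_minus (V := R_NormedModule) (fun v : Point => 1)
          (fun v => fst v * fst v)); [apply continuous_const|].
        apply (continuous_mult (K := R_AbsRing) (fun v : Point => fst v) (fun v => fst v)); auto.
      * apply (continuous_mult (K := R_AbsRing) (fun v : Point => snd v) (fun v => snd v)); auto.
    + apply continuous_Rinv, Rgt_not_eq, sqrt_lt_R0; auto.
Qed.

Lemma continuous_of_strip (c w : R) (q : Point) :
  continuous (fun p => fst (of_strip c w p)) q /\ continuous (fun p => snd (of_strip c w p)) q.
Proof.
  unfold of_strip; simpl.
  assert (Hf : continuous (fun v : Point => (fst v - c) / w) q).
  { apply (continuous_mult (K := R_AbsRing) (fun v : Point => fst v - c) (fun _ => / w));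
      [|apply continuous_const].
    apply (continuous_minus (V := R_NormedModule) (fun v : Point => fst v) (fun _ => c));
      [apply continuous_fst|apply continuous_const]. }
  assert (Hs : continuous (fun v : Point => snd v) q) by apply continuous_snd.
  split; auto.
  apply (continuous_mult (K := R_AbsRing) (fun v : Point => snd v) (fun v =>
    sqrt ((1 - (fst v - c) / w * ((fst v - c) / w)) / (1 + snd v * snd v)))); auto.
  apply (continuous_comp (fun v : Point =>
    (1 - (fst v - c) / w * ((fst v - c) / w)) / (1 + snd v * snd v)) sqrt); [|apply continuous_sqrt].
  apply (continuous_mult (K := R_AbsRing) (fun v : Point =>
    1 - (fst v - c) / w * ((fst v - c) / w)) (fun v => / (1 + snd v * snd v))).
  - apply (continuous_minus (V := R_NormedModule) (fun _ : Point => 1)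
      (fun v => (fst v - c) / w * ((fst v - c) / w))); [apply continuous_const|].
    apply (continuous_mult (K := R_AbsRing) (fun v : Point => (fst v - c) / w)
      (fun v => (fst v - c) / w)); auto.
  - apply (continuous_comp (fun v : Point => 1 + snd v * snd v) Rinv).
    + apply (continuous_plus (V := R_NormedModule) (fun _ : Point => 1) (fun v => snd v * snd v));
        [apply continuous_const|].
      apply (continuous_mult (K := R_AbsRing) (fun v : Point => snd v) (fun v => snd v)); auto.
    + apply continuous_Rinv; nra.
Qed.

(** Straightens the suspension: the flow lines in the plane are the images of the vertical lines,
    indexed by their label at height 0. *)
Definition leaf_map (al : R) (q : Point) : Point := (interp al (snd q) (fst q), snd q).
Definition leaf_inv (al : R) (p : Point) : Point := (interp_inv al (snd p) (fst p), snd p).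

Lemma leaf_inv_map (al : R) (q : Point) : irrational al -> leaf_inv al (leaf_map al q) = q.
Proof.
  intros Hal; destruct q as [x s]; unfold leaf_inv, leaf_map; simpl.
  rewrite (cf_left _ _ (interp_family al Hal)); auto.
Qed.

Definition gap_center (al : R) : R := (lo al 0 + hi al 0) / 2.
Definition gap_radius (al : R) : R := (hi al 0 - lo al 0) / 2.

Definition disk_map (al : R) (u : Point) : Point :=
  leaf_map al (to_strip (gap_center al) (gap_radius al) u).

Lemma gap_radius_pos (al : R) : 0 < gap_radius al.
Proof.
  assert (H : orbit al 0) by (exists 0%Z, 0%Z; ring).
  apply lo_lt_hi in H; unfold gap_radius; lra.
Qed.

Lemma to_strip_gap (al : R) (u : Point) : unit_disk u ->
  lo al 0 < fst (to_strip (gap_center al) (gap_radius al) u) < hi al 0.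
Proof.
  intros Hu; apply unit_disk_iff in Hu; pose proof (gap_radius_pos al) as Hw.
  assert (-1 < fst u < 1) by nra.
  assert (E : lo al 0 = gap_center al - gap_radius al /\ hi al 0 = gap_center al + gap_radius al)
    by (unfold gap_center, gap_radius; lra).
  destruct E as [-> ->]; unfold to_strip; simpl; nra.
Qed.

(* The strip over a gap is disjoint from its nontrivial integer translates,
   since these lie over the gaps at [m - n al]. *)
Lemma strip_translate (al : R) (q : Point) (m n : Z) : irrational al ->
  lo al 0 < fst q < hi al 0 ->
  lo al 0 < fst (leaf_inv al (translate (leaf_map al q) m n)) < hi al 0 ->
  m = 0%Z /\ n = 0%Z.
Proof.
  intros Hal Hq; destruct q as [x s]; unfold leaf_inv, leaf_map, translate; simpl in *.
  pose proof (interp_family al Hal) as F.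
  rewrite interp_inv_shift, (cf_inv_add _ _ F), (cf_left _ _ F) by auto; intros H.
  assert (E : pos al (shift al (- n) (x + IZR m)) = 0) by (apply pos_spec; auto; lra).
  rewrite pos_shift, pos_add_IZR in E by auto.
  assert (E0 : pos al x = 0) by (apply pos_spec; auto; lra).
  assert (Hn : (- n)%Z = 0%Z) by (apply (Hal m); lra).
  assert (n = 0%Z) by lia; subst n; split; auto; apply eq_IZR; simpl in E; lra.
Qed.

Lemma continuous_leaf_inv (al : R) (p : Point) : irrational al ->
  continuous (fun v => fst (leaf_inv al v)) p.
Proof.
  intros Hal; unfold leaf_inv; simpl.
  apply (continuous_cont2 (interp_inv al) (fun v : Point => snd v) (fun v => fst v));
    [apply interp_family; auto|apply continuous_snd|apply continuous_fst].
Qed.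

(** In the plane this is a composition of homeomorphisms onto open sets. On the torus a nearby image
    might belong to another integer translate of the strip; since the strip is open and disjoint
    from its nontrivial translates, closeness excludes this. *)
Lemma disk_map_embedding (al : R) : irrational al -> embedding unit_disk (disk_map al).
Proof.
  intros Hal; pose proof (gap_radius_pos al) as Hw; pose proof (interp_family al Hal) as F.
  set (c := gap_center al) in *; set (w := gap_radius al) in *.
  split; [|split].
  - intros u Hu e He; destruct (continuous_to_strip c w u Hu) as [C1 C2].
    assert (C3 : continuous (fun v => interp al (snd (to_strip c w v)) (fst (to_strip c w v))) u).
    { apply (continuous_cont2 (interp al) (fun v => snd (to_strip c w v))
        (fun v => fst (to_strip c w v))); auto; apply F. }
    destruct (proj1 (continuous_R2 _ _) C2 (e / 2)) as [d2 [Hd2 H2]]; [lra|].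
    destruct (proj1 (continuous_R2 _ _) C3 (e / 2)) as [d3 [Hd3 H3]]; [lra|].
    exists (Rmin d2 d3); split; [apply Rmin_pos; auto|]; intros v _ Hv.
    apply dE_box in Hv; rewrite (Rabs_minus_sym (fst u)), (Rabs_minus_sym (snd u)) in Hv.
    pose proof (Rmin_l d2 d3); pose proof (Rmin_r d2 d3).
    apply tnear_dT, tnear_sym, box_tnear; [apply H3|apply H2]; lra.
  - intros u v Hu Hv E; apply teq_translate in E; destruct E as [m [n E]].
    pose proof (to_strip_gap al u Hu) as Gu; pose proof (to_strip_gap al v Hv) as Gv.
    unfold disk_map in E; fold c w in E, Gu, Gv.
    rewrite <- (leaf_inv_map al (to_strip c w u) Hal), E in Gu.
    destruct (strip_translate al _ m n Hal Gv Gu); subst m n.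
    rewrite <- (of_to_strip c w u), <- (of_to_strip c w v) by (auto; lra).
    rewrite <- (leaf_inv_map al (to_strip c w u) Hal), E; f_equal.
    rewrite <- (leaf_inv_map al (to_strip c w v) Hal) at 2; f_equal.
    unfold translate; rewrite !Rplus_0_r; symmetry; apply surjective_pairing.
  - intros u Hu e He.
    pose proof (to_strip_gap al u Hu) as Gu; fold c w in Gu.
    set (p := disk_map al u).
    assert (Ep : leaf_inv al p = to_strip c w u) by (apply leaf_inv_map; auto).
    set (I := fun q => of_strip c w (leaf_inv al q)).
    assert (Cl : continuous (fun q => fst (leaf_inv al q)) p) by (apply continuous_leaf_inv; auto).
    assert (CL : continuous (leaf_inv al) p).
    { pose proof (proj1 (continuous_R2 _ _) Cl) as Cl'.
      unfold continuous; rewrite filterlim_locally; intros r.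
      destruct (Cl' r (cond_pos r)) as [d [Hd H]].
      assert (Hm : 0 < Rmin d r) by (apply Rmin_pos; auto; apply cond_pos).
      exists (mkposreal _ Hm); intros q [Q1 Q2]; simpl in Q1, Q2.
      change (Rabs (fst q - fst p) < Rmin d r) in Q1; change (Rabs (snd q - snd p) < Rmin d r) in Q2.
      pose proof (Rmin_l d r); pose proof (Rmin_r d r).
      split; [apply H|]; eapply Rlt_le_trans; try exact Q1; try exact Q2; auto. }
    destruct (continuous_of_strip c w (leaf_inv al p)) as [O1 O2].
    assert (I1 : continuous (fun q => fst (I q)) p)
      by (apply (continuous_comp (leaf_inv al) (fun q => fst (of_strip c w q))); auto).
    assert (I2 : continuous (fun q => snd (I q)) p)
      by (apply (continuous_comp (leaf_inv al) (fun q => snd (of_strip c w q))); auto).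
    (* The distance of the label to the ends of the gap: a translate whose label moves by less than
       g still lies over the gap, so [strip_translate] makes it trivial. *)
    set (g := Rmin (fst (to_strip c w u) - lo al 0) (hi al 0 - fst (to_strip c w u))).
    assert (Hg : 0 < g) by (apply Rmin_pos; lra).
    destruct (proj1 (continuous_R2 _ _) Cl g Hg) as [d1 [Hd1 H1]].
    destruct (proj1 (continuous_R2 _ _) I1 (e / 2)) as [d2 [Hd2 H2]]; [lra|].
    destruct (proj1 (continuous_R2 _ _) I2 (e / 2)) as [d3 [Hd3 H3]]; [lra|].
    set (d := Rmin d1 (Rmin d2 d3)).
    assert (Hd : 0 < d /\ d <= d1 /\ d <= d2 /\ d <= d3).
    { unfold d; pose proof (Rmin_l d1 (Rmin d2 d3)); pose proof (Rmin_r d1 (Rmin d2 d3)).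
      pose proof (Rmin_l d2 d3); pose proof (Rmin_r d2 d3).
      split; [repeat apply Rmin_pos; auto|lra]. }
    exists d; split; [lra|]; intros v Hv Huv; fold p in Huv.
    pose proof (to_strip_gap al v Hv) as Gv; fold c w in Gv.
    apply dT_tnear, tnear_translate in Huv; destruct Huv as [q [Hq [Q1 Q2]]].
    rewrite Rabs_minus_sym in Q1, Q2.
    apply teq_sym, teq_translate in Hq; destruct Hq as [m [n ->]].
    assert (G := H1 (translate (disk_map al v) m n) ltac:(lra) ltac:(lra)).
    rewrite Ep in G; apply Rabs_def2 in G.
    pose proof (Rmin_l (fst (to_strip c w u) - lo al 0) (hi al 0 - fst (to_strip c w u))) as G1.
    pose proof (Rmin_r (fst (to_strip c w u) - lo al 0) (hi al 0 - fst (to_strip c w u))) as G2.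
    fold g in G1, G2.
    destruct (strip_translate al (to_strip c w v) m n Hal Gv) as [-> ->];
      [unfold disk_map in G; fold c w in G; lra|].
    assert (Ev : translate (disk_map al v) 0 0 = disk_map al v)
      by (unfold translate; rewrite !Rplus_0_r; symmetry; apply surjective_pairing).
    rewrite Ev in Q1, Q2.
    assert (EI : forall z, unit_disk z -> I (disk_map al z) = z).
    { intros z Hz; unfold I, disk_map; rewrite leaf_inv_map by auto.
      apply of_to_strip; auto; apply Rgt_not_eq, Hw. }
    specialize (H2 (disk_map al v) ltac:(lra) ltac:(lra)).
    specialize (H3 (disk_map al v) ltac:(lra) ltac:(lra)).
    unfold p in H2, H3; rewrite !EI in H2, H3 by auto.
    apply box_dE; rewrite Rabs_minus_sym; auto.
Qed.

Lemma disk_type_exists (a b : R) : rat_indep a b ->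
  exists f M, Homeo_star f /\ minimal_set f M /\ (exists x, ~ M x) /\
    (forall C, component_of dT (compl M) C -> is_disk C).
Proof.
  (* A flow of slope al and vertical speed b has rotation vector (al b, b), which must be (a, b). *)
  intros Hab; set (al := a / b).
  assert (Hal : irrational al) by (apply rat_indep_irrational_div; auto).
  assert (Hb : b <> 0) by (apply irrational_neq_0, (rat_indep_irrational_r a), Hab).
  pose proof (interp_family al Hal) as F.
  pose proof (flow_family al b Hal) as T; pose proof (flow_semiconj al b Hal) as S.
  replace (al * b) with a in S by (unfold al; field; auto).
  pose proof (family_Homeo_star _ _ _ _ _ _ T S Hab) as Hs.
  pose proof (family_minimal _ _ _ _ _ _ T S Hab) as Hm.
  set (M := fun p : Point => cantor al (interp_inv al (snd p) (fst p))) in *.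
  assert (Hleaf : forall q, lo al 0 < fst q < hi al 0 -> compl M (leaf_map al q)).
  { intros q Hq H; unfold M, leaf_map in H; simpl in H; rewrite (cf_left _ _ F) in H.
    apply (H 0); auto. }
  assert (Hcompl : forall p, compl M p ->
            exists q, lo al 0 < fst q < hi al 0 /\ teq (leaf_map al q) p).
  { intros [X s] Hp; unfold compl, M in Hp; simpl in Hp.
    destruct (cantor_compl al _ Hp) as [t Ht].
    assert (Ho : orbit al t) by (apply lo_lt_hi; lra); destruct Ho as [n [m Et]].
    set (x := interp_inv al s X) in *.
    (* A label in the gap over n al + m is moved to the gap over 0 by going up n units and left m
       units. So the translates of a single strip cover the complement of M. *)
    exists (shift al (- n) x + IZR (- m), s + IZR n); simpl; split.
    - apply (shift_gap al (- n)) in Ht; auto.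
      replace (t + IZR (- n) * al) with (0 + IZR m) in Ht by (rewrite opp_IZR, Et; ring).
      rewrite lo_add_IZR, hi_add_IZR in Ht; rewrite opp_IZR; lra.
    - exists (- m)%Z, n; unfold leaf_map; simpl.
      rewrite interp_shift, shift_add_IZR, shift_shift, Z.add_opp_diag_r, shift_0 by auto.
      rewrite (cf_add _ _ F); unfold x; rewrite (cf_right _ _ F); lra. }
  assert (Hper : forall p q, compl M p -> teq p q -> compl M q).
  { intros p q Hp E Hq; apply Hp; apply teq_translate in E; destruct E as [m [n ->]].
    apply (sc_per _ _ _ _ _ S); auto. }
  assert (Hconn : connected_in dT (compl M)).
  { apply joined_connected; intros p q Hp Hq.
    destruct (Hcompl p Hp) as [[x s] [Hx Ex]]; destruct (Hcompl q Hq) as [[y t] [Hy Ey]].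
    simpl in Hx, Hy.
    apply joined_trans with (leaf_map al (x, s)); [apply joined_teq, teq_sym; auto|].
    apply joined_trans with (leaf_map al (y, t)); [|apply joined_teq; auto].
    (* A straight segment in the coordinates (label, height), where the strip is convex. *)
    assert (J := joined_path (compl M)
      (fun r => interp al ((1 - r) * s + r * t) ((1 - r) * x + r * y))
      (fun r => (1 - r) * s + r * t)); simpl in J.
    unfold leaf_map; simpl.
    replace ((1 - 0) * s + 0 * t) with s in J by ring.
    replace ((1 - 0) * x + 0 * y) with x in J by ring.
    replace ((1 - 1) * s + 1 * t) with t in J by ring.
    replace ((1 - 1) * x + 1 * y) with y in J by ring.
    apply J; intros r Hr.
    assert (Caff : forall u v, continuous (fun r => (1 - r) * u + r * v) r).
    { intros u v; apply (continuous_plus (V := R_NormedModule) (fun r => (1 - r) * u)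
        (fun r => r * v)).
      - apply (continuous_mult (K := R_AbsRing) (fun r => 1 - r) (fun _ => u));
          [|apply continuous_const].
        apply (continuous_minus (V := R_NormedModule) (fun _ => 1) (fun r => r));
          [apply continuous_const|apply continuous_id].
      - apply (continuous_mult (K := R_AbsRing) (fun r => r) (fun _ => v));
          [apply continuous_id|apply continuous_const]. }
    split; [apply continuous_cont2; auto; apply F|split; auto].
    apply (Hleaf ((1 - r) * x + r * y, (1 - r) * s + r * t)); simpl.
    apply convex_between; auto. }
  assert (Hne : compl M (leaf_map al (gap_center al, 0))).
  { apply Hleaf; simpl; pose proof (gap_radius_pos al); unfold gap_radius, gap_center in *; lra. }
  exists (flow al b 1), M; split; [auto|split; [auto|split; [eauto|]]].
  intros C HC; exists (disk_map al); split; [apply disk_map_embedding; auto|].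
  assert (HCM : forall x, C x <-> compl M x).
  (* The complement is connected, hence its own only component. *)
  { assert (Hopen : open_in dT (compl M)).
    { intros x Hx; apply NNPP; intros Hn; apply Hx, (semiconj_closed _ _ _ _ _ S).
      intros e He; apply NNPP; intros Hn'; apply Hn; exists e; split; auto.
      intros y Hy My; apply Hn'; exists y; auto. }
    assert (Hex : exists x, C x /\ compl M x).
    { destruct HC as [[x Cx] [HCM _]]; exists x; auto. }
    apply (clopen_component (compl M) (compl M) (fun _ => False)); eauto; try tauto.
    intros x []. }
  intros x; rewrite HCM; split.
  - intros Hx; destruct (Hcompl x Hx) as [q [Hq Eq]].
    destruct (to_of_strip (gap_center al) (gap_radius al) q (gap_radius_pos al)) as [U E].
    { unfold gap_center, gap_radius; lra. }
    exists (of_strip (gap_center al) (gap_radius al) q); split; auto.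
    unfold disk_map; rewrite E; auto.
  - intros [u [Hu E]]; apply (Hper (disk_map al u)); auto.
    apply Hleaf, to_strip_gap; auto.
Qed.

Theorem theoremB :
  (exists (f1 : Point -> Point) (M1 : Point -> Prop),
     Homeo_star f1 /\ minimal_set f1 M1 /\ (exists x, ~ M1 x) /\
     (forall C, component_of dT (compl M1) C -> is_disk C)) /\
  (exists (f2 : Point -> Point) (M2 : Point -> Prop),
     Homeo_star f2 /\ minimal_set f2 M2 /\ (exists x, ~ M2 x) /\
     (forall C, component_of dT (compl M2) C ->
        is_disk C \/ is_essential_annulus C) /\
     (exists C, component_of dT (compl M2) C /\ is_essential_annulus C)) /\
  (exists (f3 : Point -> Point) (M3 : Point -> Prop),
     Homeo_star f3 /\ minimal_set f3 M3 /\ (exists x, ~ M3 x) /\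
     extension_of_cantor f3 M3).
Proof.
  destruct rat_indep_exists as [a [b Hab]].
  split; [exact (disk_type_exists a b Hab)|].
  split; [exact (annulus_type_exists a b Hab)|exact (cantor_type_exists a b Hab)].
Qed.
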